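(* Let $T>0$, $a>0$, $N\geq 1$ and $2\leq p<3$. If $f\in \mathcal{C}_b^3(\mathbb{R};\mathcal{L}(\mathbb{R}^N,\mathbb{R}))$, that is, if $f$ is $3$-times differentiable, bounded with bounded derivatives, and if $\mathbb{X}=(\mathbb{X}^1,\mathbb{X}^2)$ is a continuous geometric $N$-dimensional $p$-variation rough path on $[0,T]$, then the reflected rough differential equation $$d y_t = f(y_t)\, d\mathbb{X}_t + d m_t,\qquad y_t\, d m_t=0,$$ admits a unique solution $(y,m)$ on $[0,T]$ with initial condition $a$ (in the sense defined in the context).
   Context: Increments. For a path $g$ on $[0,T]$, $\delta g_{st}:=g_t-g_s$; for a two-index map $g$, $\delta g_{sut}:=g_{st}-g_{su}-g_{ut}$. Controls. For an interval $I$ let $\mathcal{S}_I:=\{(s,t)\in I^2: s\leq t\}$. A control on $I$ is a map $\omega:\mathcal{S}_I\to[0,\infty)$ with $\omega(s,u)+\omega(u,t)\leq\omega(s,t)$ for $s\leq u\leq t$. It is regular if $\lim_{|t-s|\to0}\omega(s,t)=0$. Variation spaces. For $q>0$, a Banach space $E$ and $g:\mathcal{S}_I\to E$, set $\|g\|_{\bar V^q_2(I;E)}:=\sup_{(t_i)}\big(\sum_i|g_{t_it_{i+1}}|^q\big)^{1/q}$, the supremum being over all partitions $(t_i)$ of $I$; $\bar V^q_2(I;E)$ is the set of $g$ for which this is finite, and then $\omega_g(s,t):=\|g\|^q_{\bar V^q_2([s,t];E)}$ is a control on $I$. $V^q_2(I;E)$ is the set of $g\in\bar V^q_2(I;E)$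 such that $\omega_g$ is regular. $\bar V^q_1(I;E)$ (resp. $V^q_1(I;E)$) is the set of paths $g:I\to E$ such that $\delta g\in\bar V^q_2(I;E)$ (resp. $V^q_2(I;E)$). $V^q_{2,\mathrm{loc}}(I;E)$ is the set of maps $g:\mathcal{S}_I\to E$ for which there is a countable covering $\{I_k\}_k$ of $I$ by intervals with $g\in V^q_2(I_k;E)$ for every $k$. If $E$ is replaced by a subset of a Banach space, the path is required to take values in that subset. Rough paths. A continuous $N$-dimensional $p$-variation rough path on $[0,T]$ is a pair $\mathbb{X}=(\mathbb{X}^1,\mathbb{X}^2)\in V^p_2([0,T];\mathbb{R}^N)\times V^{p/2}_2([0,T];\mathbb{R}^{N\times N})$ such that $\delta\mathbb{X}^{1}_{sut}=0$ and $\delta\mathbb{X}^{2;ij}_{sut}=\mathbb{X}^{1,i}_{su}\mathbb{X}^{1,j}_{ut}$ for all $s<u<t$ in $[0,T]$ and $i,j\in\{1,\dots,N\}$. It is geometric if it is the limit, in the $p$-variation topology of $V^p_2\times V^{p/2}_2$, of a sequence of smooth rough paths $\mathbb{X}^\varepsilon=(\mathbb{X}^{\varepsilon,1},\mathbb{X}^{\varepsilon,2})$ given by $\mathbb{X}^{\varepsilon,1,i}_{st}:=\delta x^{\varepsilon,i}_{st}$, $\mathbb{X}^{\varepsilon,2,ij}_{st}:=\int_s^t\delta x^{\varepsilon,i}_{su}\,dx^{\varepsilon,j}_u$ for some smooth path $x^\varepsilon:[0,T]\to\mathbb{R}^N$. Solution. Write $f_1,\dots,f_N$ for the components of $f$ and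 $f_{2,ij}(\xi):=f_i'(\xi)f_j(\xi)$; repeated indices are summed. A pair $(y,m)\in V^p_1([0,T];\mathbb{R}_{\geq0})\times V^1_1([0,T];\mathbb{R}_{\geq0})$ with $m$ increasing (nondecreasing; $m$ is also regarded as a measure with $m([0,t])=m_t$) is a solution on $[0,T]$ with initial condition $a$ if there exists $y^\natural\in V^{p/3}_{2,\mathrm{loc}}([0,T];\mathbb{R})$ such that for all $s\leq t$ in $[0,T]$ $$\delta y_{st}=f_i(y_s)\mathbb{X}^{1,i}_{st}+f_{2,ij}(y_s)\mathbb{X}^{2,ij}_{st}+\delta m_{st}+y^\natural_{st},\qquad y_0=a,\qquad m_t=\int_0^t\mathbf{1}_{\{y_u=0\}}\,dm_u .$$
   Formalization: In the definition of solution the second-order term is taken as f_{2,ij}(y_s) X^{2,ji} instead of f_{2,ij}(y_s) X^{2,ij}; with the printed indices Chen's relation makes existence fail for N≥2 and non-commuting fields (e.g. a Brownian rough path). *)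

(* Defs.v *)
From HB Require Import structures.
From mathcomp Require Export all_boot all_order all_algebra.
From mathcomp Require Export all_classical all_reals all_analysis.
Export Order.TTheory GRing.Theory Num.Theory.
Export numFieldNormedType.Exports.

Set Implicit Arguments.
Unset Strict Implicit.
Unset Printing Implicit Defensive.

Local Open Scope classical_set_scope.
Local Open Scope ring_scope.

(* Paths and two-index maps on an interval I are represented by total functions
   R -> E and R -> R -> E; only their values at t in I, respectively at
   s <= t in I, are ever used. R^N is 'rV[R]_N, R^(N x N) is 'M[R]_N, both with
   the library's sup norm. *)

Section increments.
Context {R : realType} {E : zmodType}.

Definition delta1 (g : R -> E) (s t : R) : E := g t - g s.

Definition delta2 (g : R -> R -> E) (s u t : R) : E :=
  g s t - g s u - g u t.

End increments.

Section variation.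
Context {R : realType} {E : normedModType R}.
Implicit Types (I : set R) (q : R) (g : R -> R -> E).

(* For I = [a, b] this is a subdivision a = t_0 < ... < t_n = b. For an interval
   that does not contain one of its endpoints there is nothing to reach at that
   end, so that only the endpoints belonging to I are required. *)
Definition is_partition I (s : seq R) : Prop :=
  [/\ sorted <%R s, [set` s] `<=` I
    & I `&` (lbound I `|` ubound I) `<=` [set` s]].

Definition var_sum q g (s : seq R) : R :=
  \sum_(0 <= i < (size s).-1) `|g s`_i s`_i.+1| `^ q.

Definition var_norm q I g : \bar R :=
  ereal_sup [set ((var_sum q g s) `^ q^-1)%:E | s in is_partition I].

Definition var_control q g (s t : R) : \bar R := (var_norm q `[s, t] g `^ q)%E.

Definition regular I (w : R -> R -> \bar R) : Prop :=
  forall e : R, 0 < e -> exists2 d : R, 0 < d &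
    forall s t, I s -> I t -> s <= t -> t - s < d -> (w s t < e%:E)%E.

Definition Vbar2 q I g : Prop := (var_norm q I g < +oo)%E.

Definition V2 q I g : Prop := Vbar2 q I g /\ regular I (var_control q g).

Definition V1 q I (g : R -> E) : Prop := V2 q I (delta1 g).

(* Finite coverings are included, since the I_ k may repeat. *)
Definition V2loc q I g : Prop :=
  exists I_ : nat -> set R,
    [/\ forall k, is_interval (I_ k), \bigcup_k I_ k = I
      & forall k, V2 q (I_ k) g].

End variation.

Section rough_paths.
Context {R : realType} {N : nat}.
Implicit Types (p T : R).

Definition rough_path p T (X1 : R -> R -> 'rV[R]_N)
    (X2 : R -> R -> 'M[R]_N) : Prop :=
  [/\ V2 p `[0, T] X1, V2 (p / 2) `[0, T] X2
    & forall s u t, 0 <= s -> s < u -> u < t -> t <= T ->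
        delta2 X1 s u t = 0 /\
        forall i j, delta2 X2 s u t i j = X1 s u ord0 i * X1 u t ord0 j].

(* A smooth path on [0, T] is the restriction of a smooth path on R. *)
Definition smooth (x : R -> 'rV[R]_N) : Prop :=
  forall n t, derivable (derive1n n x) t 1.

Definition smooth_lift1 (x : R -> 'rV[R]_N) : R -> R -> 'rV[R]_N := delta1 x.

Definition smooth_lift2 (x : R -> 'rV[R]_N) (s t : R) : 'M[R]_N :=
  \matrix_(i, j) \int[lebesgue_measure]_(u in `[s, t])
    (delta1 x s u ord0 i * derive1 (fun v => x v ord0 j) u).

Definition geometric p T (X1 : R -> R -> 'rV[R]_N)
    (X2 : R -> R -> 'M[R]_N) : Prop :=
  exists x : nat -> R -> 'rV[R]_N,
    [/\ forall n, smooth (x n),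
        var_norm p `[0, T]
          (fun s t => X1 s t - smooth_lift1 (x n) s t) @[n --> \oo] --> 0%E
      & var_norm (p / 2) `[0, T]
          (fun s t => X2 s t - smooth_lift2 (x n) s t) @[n --> \oo] --> 0%E].

Definition geometric_rough_path p T (X1 : R -> R -> 'rV[R]_N)
    (X2 : R -> R -> 'M[R]_N) : Prop :=
  rough_path p T X1 X2 /\ geometric p T X1 X2.

End rough_paths.

Section reflected_equation.
Context {R : realType} {N : nat}.

(* An element of L(R^N, R) is given by the row vector of its coefficients. *)
Definition Cb (k : nat) (f : R -> 'rV[R]_N) : Prop :=
  (forall n, (n < k)%N -> forall x, derivable (derive1n n f) x 1) /\
  (forall n, (n <= k)%N -> bounded_fun (derive1n n f)).

Definition coef (f : R -> 'rV[R]_N) (i : 'I_N) (x : R) : R := f x ord0 i.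

Definition coef2 (f : R -> 'rV[R]_N) (i j : 'I_N) (x : R) : R :=
  derive1 (coef f i) x * coef f j x.

(* The measure mu induced by m is determined on [0, T] by the values
   mu [0, t] = m t; in particular mu {0} = m 0. *)
Definition measure_of_path (T : R) (m : R -> R)
    (mu : {measure set (measurableTypeR R) -> \bar R}) : Prop :=
  forall t, t \in `[0, T] -> mu `[0, t]%classic = (m t)%:E.

(* The second-order Taylor term is f_i'(y_s) f_j(y_s) int_s^t dx^j dx^i, where the
   derivative falls on the field that is integrated last. Since X2 i j stands
   for int dx^i dx^j, the coefficient f_i' f_j multiplies X2 j i. The other
   contraction, with X2 i j, agrees with it when N = 1 or when the fields f_i
   commute; otherwise it violates the Chen relation up to order 3 / p, and the
   equation has in general no solution. *)
Definition solution (p T a : R) (f : R -> 'rV[R]_N)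
    (X1 : R -> R -> 'rV[R]_N) (X2 : R -> R -> 'M[R]_N) (y m : R -> R) : Prop :=
  [/\ V1 p `[0, T] y /\ {in `[0, T], forall t, 0 <= y t},
      [/\ V1 1 `[0, T] m, {in `[0, T], forall t, 0 <= m t} &
          {in `[0, T] &, {homo m : s t / s <= t}}],
      exists2 ynat : R -> R -> R, V2loc (p / 3) `[0, T] ynat &
        forall s t, 0 <= s -> s <= t -> t <= T ->
          delta1 y s t =
            \sum_i coef f i (y s) * X1 s t ord0 i
            + \sum_i \sum_j coef2 f i j (y s) * X2 s t j i
            + delta1 m s t + ynat s t,
      y 0 = a
    & exists2 mu : {measure set (measurableTypeR R) -> \bar R},
        measure_of_path T m mu &
        {in `[0, T], forall t, (m t)%:E =
          (\int[mu]_(u in `[0%R, t]) (\1_[set v | y v = 0%R] u)%:E)%E}].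

End reflected_equation.

(* Main.v *)
From HB Require Import structures.
Require Import Defs.
From mathcomp Require Import ring lra.

(** The unknown is scalar, so the flow phi of the unreflected equation
    dy = f(y) dX consists of increasing maps of the line, and conjugating with
    it removes the rough term: if y_t = phi_0t(z_t), then reflection at 0 means
    that z is nondecreasing and only grows when it touches the moving barrier
    phi_0t^-1(0). Skorokhod's formula solves this problem explicitly, and
    undoing the change of variables gives
      y_t = max (phi_0t(a), sup_(s <= t) phi_st(0)).
    All statements about y and m reduce to statements about the defect
      A_st = y_t - phi_st(y_s),
    the amount by which y was pushed above the flow between s and t.

    The flow. With mu_st(x) = x + f(x) X1_st + f'f(x) X2_st and a control w that
    dominates the driver, mu_ut o mu_su - mu_st is of order w^(3/p) both
    uniformly and in Lipschitz seminorm (rde_germ_almost_flow). As 3/p > 1,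
    compositions of mu along partitions stay that close to mu
    (local_sewing), hence have slopes in a fixed interval [c, L] with c > 0,
    and converge when the partition is refined (sewing); the limit is the
    flow (almost_flow_sewing).

    Existence. The path y above is nonnegative, satisfies A >= 0 and A_st = 0
    when y > 0 on [s, t] (reflected_flow, reflected_defect0). Since slopes of
    the flow are bounded below, the sums of A over partitions are bounded by
    A_st / c; and A_st - A_su - A_ut is at most a multiple of
    w(u, t)^(1/p) A_su, because phi_ut - id has a Lipschitz constant of order
    w(u, t)^(1/p). So A is sewn into an additive map, the increments of m
    (defect_sewing), with an error of order w^(1/p) dm. As 1/p + 1 >= 3/p for
    p >= 2, this error is an admissible remainder (remainder_bound).

    Uniqueness. For an arbitrary solution (y, m), the equation says that
    A - dm has finite (p/3)-variation on each interval of a countable covering,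
    so its sums over fine partitions vanish there. Hence r |-> phi_rt(y_r) is
    nondecreasing on each of these intervals, with increments bounded by a
    multiple of those of m. A continuous function that is nondecreasing on each
    of countably many sets covering an interval is nondecreasing
    (le_of_countable_cover), so both bounds hold on [0, T]: y dominates the flow
    and follows it while m is constant, in particular after its last zero. This
    forces the formula for y (unique_path); then m is determined up to a
    constant on each interval, and again by continuity on [0, T]
    (unique_push). *)

Set Implicit Arguments.
Unset Strict Implicit.
Unset Printing Implicit Defensive.
Local Open Scope classical_set_scope.
Local Open Scope ring_scope.

(** * Partitions and controls *)

Section partitions.
Context {R : realType}.
Implicit Types (s t u v e d : R) (l : seq R) (w A : R -> R -> R).

(** A regular control that also dominates the elapsed time. The lower bound
    makes it positive off the diagonal, so that it can be halved when a
    partition is split, and makes its mesh control the time mesh. *)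
Record clock (T : R) (w : R -> R -> R) : Prop := Clock {
  clock_len : forall s t, 0 <= s -> s <= t -> t <= T -> t - s <= w s t;
  clock_add : forall s u t, 0 <= s -> s <= u -> u <= t -> t <= T ->
    w s u + w u t <= w s t;
  clock_reg : forall e, 0 < e -> exists2 d, 0 < d &
    forall s t, 0 <= s -> s <= t -> t <= T -> t - s < d -> w s t < e }.

(** A partition of [s, t] is stored without its first point s; the empty list
    is then the only partition of [s, s]. *)
Definition part s t l : bool := path <%R s l && (last s l == t).

Definition mesh w e s l : bool := path (fun u v => w u v <= e) s l.

Fixpoint psum A s l : R :=
  if l is u :: l' then A s u + psum A u l' else 0.

(** The earliest step is applied first: mu_(u_n t) o ... o mu_(s u_1). *)
Fixpoint comp_along (mu : R -> R -> R -> R) s l (x : R) : R :=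
  if l is u :: l' then comp_along mu u l' (mu s u x) else x.

Lemma part_nil s : part s s [::].
Proof. by rewrite /part /= eqxx. Qed.

Lemma part_cons s t v l : part s t (v :: l) = (s < v) && part v t l.
Proof. by rewrite /part /= andbA. Qed.

Lemma part_le s t l : part s t l -> s <= t.
Proof.
elim: l s => [|v l IH] s; first by rewrite /part /= => /eqP ->.
by rewrite part_cons => /andP[/ltW sv /IH]; apply: le_trans.
Qed.

Lemma part_diag s l : part s s l -> l = [::].
Proof.
case: l => // v l; rewrite part_cons => /andP[sv /part_le vs].
by have := lt_le_trans sv vs; rewrite ltxx.
Qed.

Lemma part_cat s u t l1 l2 : part s u l1 -> part u t l2 -> part s t (l1 ++ l2).
Proof.
move=> /andP[p1 /eqP e1] /andP[p2 /eqP e2].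
by rewrite /part cat_path last_cat e1 p1 p2 e2 eqxx.
Qed.

Lemma part_catP s t l1 l2 :
  part s t (l1 ++ l2) -> part s (last s l1) l1 /\ part (last s l1) t l2.
Proof.
by rewrite /part cat_path last_cat eqxx andbT => /andP[/andP[-> ->] ->].
Qed.

Lemma part1 s t : s < t -> part s t [:: t].
Proof. by move=> st; rewrite part_cons st part_nil. Qed.

Lemma part_mem s t l u : part s t l -> u \in l -> s < u /\ u <= t.
Proof.
elim: l s => // v l IH s; rewrite part_cons inE => /andP[sv pl].
case/predU1P => [->|/(IH _ pl)[vu ut]]; first by split=> //; apply: part_le pl.
by split=> //; apply: lt_trans vu.
Qed.

Lemma psum_cat A s l1 l2 :
  psum A s (l1 ++ l2) = psum A s l1 + psum A (last s l1) l2.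
Proof. by elim: l1 s => [|v l IH] s /=; rewrite ?add0r // IH addrA. Qed.

Lemma comp_cat mu s l1 l2 x :
  comp_along mu s (l1 ++ l2) x = comp_along mu (last s l1) l2 (comp_along mu s l1 x).
Proof. by elim: l1 s x => [|v l IH] s x //=; rewrite IH. Qed.

Lemma mesh_cat w e s l1 l2 :
  mesh w e s (l1 ++ l2) = mesh w e s l1 && mesh w e (last s l1) l2.
Proof. exact: cat_path. Qed.

Lemma mesh_le w e e' s l : e <= e' -> mesh w e s l -> mesh w e' s l.
Proof.
by move=> ee; apply: sub_path => u v /= /le_trans; apply.
Qed.

Lemma psum_ge0 A s t l :
  (forall u v, s <= u -> u < v -> v <= t -> 0 <= A u v) ->
  part s t l -> 0 <= psum A s l.
Proof.
elim: l s => //= v l IH s A0; rewrite part_cons => /andP[sv pl].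
rewrite addr_ge0 //; first by apply: A0 => //; apply: part_le pl.
by apply: IH => // u v' vu; apply: A0; apply: le_trans vu; apply: ltW.
Qed.

Lemma le_psum A B s t l :
  (forall u v, s <= u -> u < v -> v <= t -> A u v <= B u v) ->
  part s t l -> psum A s l <= psum B s l.
Proof.
elim: l s => //= v l IH s AB; rewrite part_cons => /andP[sv pl].
rewrite lerD //; first by apply: AB => //; apply: part_le pl.
by apply: IH => // u v' vu; apply: AB; apply: le_trans vu; apply: ltW.
Qed.

Lemma psumZ c A s l : psum (fun u v => c * A u v) s l = c * psum A s l.
Proof. by elim: l s => [|v l IH] s /=; rewrite ?mulr0 // IH mulrDr. Qed.

Lemma psumD A B s l :
  psum (fun u v => A u v + B u v) s l = psum A s l + psum B s l.
Proof. by elim: l s => [|v l IH] s /=; rewrite ?addr0 // IH addrACA. Qed.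

Lemma psum_delta1 (h : R -> R) s t l : part s t l -> psum (delta1 h) s l = h t - h s.
Proof.
elim: l s => [|v l IH] s /=; first by rewrite /part /= => /eqP ->; rewrite subrr.
by rewrite part_cons => /andP[_ /IH ->]; rewrite /delta1; ring.
Qed.

End partitions.

Section clock_theory.
Context {R : realType} {T : R} {w : R -> R -> R}.
Context (cw : clock T w).
Implicit Types (s t u v e d : R) (l : seq R) (A : R -> R -> R).

Lemma clock_ge0 s t : 0 <= s -> s <= t -> t <= T -> 0 <= w s t.
Proof.
by move=> s0 st tT; apply: le_trans (clock_len cw s0 st tT); rewrite subr_ge0.
Qed.

Lemma clock_gt0 s t : 0 <= s -> s < t -> t <= T -> 0 < w s t.
Proof.
move=> s0 st tT; apply: lt_le_trans (clock_len cw s0 (ltW st) tT).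
by rewrite subr_gt0.
Qed.

Lemma clock_diag s : 0 <= s -> s <= T -> w s s = 0.
Proof.
move=> s0 sT; apply/eqP; rewrite eq_le clock_ge0 // andbT.
by have := clock_add cw s0 (lexx s) (lexx s) sT; rewrite gerDl.
Qed.

Lemma clock_mono s t u v : 0 <= s -> s <= u -> u <= v -> v <= t -> t <= T ->
  w u v <= w s t.
Proof.
move=> s0 su uv vt tT.
have u0 := le_trans s0 su; have v0 := le_trans u0 uv.
have vT := le_trans vt tT; have ut := le_trans uv vt.
apply: le_trans (clock_add cw s0 su ut tT).
apply: (@le_trans _ _ (w u t)); last by rewrite lerDr clock_ge0 // (le_trans ut).
by apply: le_trans (clock_add cw u0 uv vt tT); rewrite lerDl clock_ge0.
Qed.

Lemma psum_clock s t l : 0 <= s -> t <= T -> part s t l -> psum w s l <= w s t.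
Proof.
elim: l s => [|v l IH] s s0 tT /=.
  by move=> pl; rewrite clock_ge0 // (part_le pl).
rewrite part_cons => /andP[sv pl]; have vt := part_le pl.
apply: le_trans (clock_add cw s0 (ltW sv) vt tT).
by rewrite lerD2l IH // (le_trans s0) // ltW.
Qed.

Lemma mesh_part s t l e : 0 <= s -> t <= T -> w s t <= e -> part s t l ->
  mesh w e s l.
Proof.
elim: l s => // v l IH s s0 tT wst; rewrite part_cons => /andP[sv pl].
have vt := part_le pl.
rewrite /mesh /=; apply/andP; split.
  by apply: le_trans wst; apply: clock_mono => //; exact: ltW.
apply: IH => //; first exact: le_trans (ltW sv).
by apply: le_trans wst; apply: clock_mono => //; exact: ltW.
Qed.

(** A step of half the modulus of regularity at level e always fits, and
    finitely many of them reach t. *)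
Lemma exists_mesh s t e : 0 <= s -> s <= t -> t <= T -> 0 < e ->
  exists2 l, part s t l & mesh w e s l.
Proof.
move=> s0 st tT e0; have [d d0 dw] := clock_reg cw e0.
have [n] : exists n : nat, t - s < n%:R * (d / 2).
  exists (Num.bound ((t - s) / (d / 2))); rewrite -ltr_pdivrMr ?divr_gt0 //.
  by apply: archi_boundP; rewrite divr_ge0 ?subr_ge0 // divr_ge0 // ltW.
elim: n s s0 st => [|n IH] s s0 st.
  by rewrite mul0r subr_lt0 => /lt_le_trans/(_ st); rewrite ltxx.
move=> tsn; have [->|nst] := eqVneq s t; first by exists [::]; rewrite ?part_nil.
have {}st : s < t by rewrite lt_neqAle nst.
have [tsd|tsd] := ltP (t - s) d.
  exists [:: t]; first exact: part1.
  by rewrite /mesh /= andbT ltW // dw // ltW.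
rewrite -natr1 mulrDl mul1r in tsn.
have [||| l pl fl] := IH (s + d / 2); [lra | lra | lra |].
exists (s + d / 2 :: l); first by rewrite part_cons pl andbT; lra.
rewrite /mesh /= -/(mesh w e _ l) fl andbT ltW // dw //; lra.
Qed.

End clock_theory.

(** * Nonlinear sewing *)

Section common_refinement.
Context {R : realType}.
Implicit Types (s t u v : R) (l : seq R).

(** Refinements are described by inclusion of the sets of points; a
    refinement of v :: l splits at v into a partition of [s, v] and a refinement
    of l. *)
Lemma part_sub_cons s v l t l' : path <%R s (v :: l) -> part s t l' ->
  {subset v :: l <= l'} ->
  exists a b, [/\ l' = rcons a v ++ b, part s v (rcons a v), part v t b
    & {subset l <= b}].
Proof.
move=> pvl pl' sub; have vl' : v \in l' by rewrite sub // mem_head.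
move: pl' sub; case/splitPr: vl' => a b pl' sub; exists a, b.
move: pl' sub; rewrite -cat_rcons => pl' sub.
have := part_catP pl'; rewrite last_rcons => -[pa pb]; split=> // u ul.
have vu : v < u.
  move: pvl => /= /andP[_]; rewrite lt_path_sortedE => /andP[/allP + _].
  by apply.
have := sub u; rewrite inE ul orbT mem_cat => /(_ isT) /orP[|//].
by move=> /(part_mem pa)[_]; rewrite leNgt vu.
Qed.

Lemma part_merge s t l l' : part s t l -> part s t l' ->
  exists m, [/\ part s t m, {subset l <= m} & {subset l' <= m}].
Proof.
move=> pl pl'; pose m := sort <=%R (undup (l ++ l')).
have memm u : (u \in m) = (u \in l) || (u \in l').
  by rewrite mem_sort mem_undup mem_cat.
have [st|st] := eqVneq s t.
  by rewrite -st in pl pl' *; exists [::]; rewrite part_nil (part_diag pl) (part_diag pl').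
exists m; split; last by move=> u; rewrite memm => ->; rewrite orbT.
  2: by move=> u; rewrite memm => ->.
have mst u : u \in m -> s < u /\ u <= t.
  by rewrite memm => /orP[/(part_mem pl)|/(part_mem pl')].
have pm : path <%R s m.
  rewrite lt_path_sortedE sort_lt_sorted undup_uniq andbT.
  by apply/allP => u /mst[].
rewrite /part pm /=.
have tm : t \in m.
  rewrite memm; case: l pl {memm mst pm m} => [/andP[_ /eqP /= e]|v l /andP[_ /eqP /= <-]].
    by rewrite e eqxx in st.
  by rewrite mem_last.
case/splitPr: tm mst pm => a b mst; rewrite cat_path last_cat /=.
case: b mst => [|u b] mst; first by rewrite eqxx.
case/and4P=> _ _ tu _.
have /mst[_ ut] : u \in a ++ [:: t, u & b] by rewrite mem_cat !inE eqxx !orbT.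
by have := lt_le_trans tu ut; rewrite ltxx.
Qed.

Lemma mesh_refine (T : R) w d s t l l' : clock T w -> 0 <= s -> t <= T ->
  part s t l -> part s t l' -> {subset l <= l'} -> mesh w d s l ->
  mesh w d s l'.
Proof.
move=> cw; elim: l l' s => [|v l IH] l' s s0 tT.
  by rewrite {1}/part /= => /eqP -> /part_diag ->.
move=> pvl pl' sub /= /andP[wsv fl].
have [a [b [e pa pb lb]]] := part_sub_cons (proj1 (andP pvl)) pl' sub.
move: pvl; rewrite part_cons => /andP[sv pl].
have vt := part_le pl; have v0 := le_trans s0 (ltW sv).
rewrite e mesh_cat last_rcons; apply/andP; split; last exact: IH.
by apply: (mesh_part cw s0 _ wsv pa); apply: le_trans tT.
Qed.

End common_refinement.

Section sewing.
Context {R : realType} {T : R} {w : R -> R -> R} (cw : clock T w).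
Context (mu : R -> R -> R -> R) (eta : R -> R -> R) (d0 L : R).
Context (d0_gt0 : 0 < d0) (L_ge1 : 1 <= L).
Implicit Types (s t u v : R) (l : seq R) (phi : R -> R -> R -> R).
Context (lip_comp : forall s t l x x', 0 <= s -> t <= T -> part s t l ->
  mesh w d0 s l -> `|comp_along mu s l x - comp_along mu s l x'| <= L * `|x - x'|).
Context (close_comp : forall s t l x, 0 <= s -> s < t -> t <= T -> part s t l ->
  w s t <= d0 -> `|comp_along mu s l x - mu s t x| <= eta s t).
Context (small_eta : forall e, 0 < e -> exists2 d, 0 < d &
  forall s t l, 0 <= s -> t <= T -> part s t l -> mesh w d s l ->
  psum eta s l <= e).

(** Replacing the steps of l by their refinements one at a time costs
    eta for each step, carried to the final time by the Lipschitz bound. *)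
Lemma comp_refine s t l l' x : 0 <= s -> t <= T -> part s t l -> part s t l' ->
  {subset l <= l'} -> mesh w d0 s l -> mesh w d0 s l' ->
  `|comp_along mu s l' x - comp_along mu s l x| <= L * psum eta s l.
Proof.
elim: l l' s x => [|v l IH] l' s x s0 tT.
  rewrite {1}/part /= => /eqP -> /part_diag ->.
  by rewrite /= subrr normr0 mulr0.
move=> pvl pl' sub /= /andP[wsv fl] fl'.
have [a [b [e pa pb lb]]] := part_sub_cons (proj1 (andP pvl)) pl' sub.
move: pvl; rewrite part_cons => /andP[sv pl].
have vt := part_le pl; have v0 := le_trans s0 (ltW sv).
move: fl'; rewrite e mesh_cat last_rcons => /andP[fa fb].
rewrite comp_cat last_rcons mulrDr.
set X := comp_along mu s (rcons a v) x; set Y := mu s v x.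
rewrite -(subrKA (comp_along mu v b Y)); apply: le_trans (ler_normD _ _) _.
rewrite lerD //; last exact: IH.
apply: le_trans (lip_comp _ _ v0 tT pb fb) _.
rewrite ler_wpM2l ?(le_trans ler01) //.
by apply: close_comp => //; apply: le_trans vt tT.
Qed.

(** Pointwise convergence suffices: bounds on phi are inherited from bounds
    on compositions, which are uniform. *)
Definition sewn phi := forall s t x e, 0 <= s -> s <= t -> t <= T -> 0 < e ->
  exists2 d, 0 < d & forall l, part s t l -> mesh w d s l ->
    `|comp_along mu s l x - phi s t x| <= e.

(** Two fine partitions are compared through a common refinement. *)
Lemma comp_cauchy e : 0 < e -> exists2 d, 0 < d &
  forall s t l l' x, 0 <= s -> t <= T -> part s t l -> part s t l' ->
    mesh w d s l -> mesh w d s l' -> `|comp_along mu s l x - comp_along mu s l' x| <= e.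
Proof.
move=> e0; have e1 : 0 < e / (2 * L) by rewrite divr_gt0 // mulr_gt0 // (lt_le_trans ltr01).
have [d d_gt0 dP] := small_eta e1; exists (Num.min d d0).
  by rewrite lt_min d_gt0.
move=> s t l l' x s0 tT pl pl' fl fl'.
have [m [pm sub sub']] := part_merge pl pl'.
have fd k : mesh w (Num.min d d0) s k -> mesh w d s k.
  by apply: mesh_le; rewrite ge_min lexx.
have fd0 k : mesh w (Num.min d d0) s k -> mesh w d0 s k.
  by apply: mesh_le; rewrite ge_min lexx orbT.
have fm : mesh w d0 s m by exact: mesh_refine cw s0 tT pl pm sub (fd0 _ fl).
have h1 := comp_refine x s0 tT pl pm sub (fd0 _ fl) fm.
have h2 := comp_refine x s0 tT pl' pm sub' (fd0 _ fl') fm.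
have L0 : 0 < L by apply: lt_le_trans L_ge1.
have Le : L * (e / (2 * L)) = e / 2 by field; rewrite gt_eqF.
have k1 : L * psum eta s l <= e / 2.
  by rewrite -Le ler_pM2l //; exact: dP pl (fd _ fl).
have k2 : L * psum eta s l' <= e / 2.
  by rewrite -Le ler_pM2l //; exact: dP pl' (fd _ fl').
move: h1 h2; rewrite !ler_norml => /andP[? ?] /andP[? ?]; apply/andP; split; lra.
Qed.

(** The limit is taken as a lower limit over partitions of vanishing mesh,
    which needs no choice of a sequence of partitions; the Cauchy property
    makes it a limit. *)
Theorem sewing : exists phi, sewn phi.
Proof.
pose E s t x : set R := [set z | exists2 d, 0 < d &
  forall l, part s t l -> mesh w d s l -> z <= comp_along mu s l x].
exists (fun s t x => sup (E s t x)) => s t x e s0 st tT e0.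
have [d d_gt0 dP] := comp_cauchy e0; exists d => // l pl fl.
have El : E s t x (comp_along mu s l x - e).
  exists d => // l' pl' fl'; have := dP _ _ _ _ x s0 tT pl pl' fl fl'.
  by rewrite ler_norml => /andP[_]; lra.
have ubE : ubound (E s t x) (comp_along mu s l x + e).
  move=> z [d' d'0 /= zP].
  have dd' : 0 < Num.min d d' by rewrite lt_min d_gt0.
  have [l' pl' fl'] := exists_mesh cw s0 st tT dd'.
  have := dP _ _ _ _ x s0 tT pl pl' fl.
  move=> /(_ (mesh_le _ fl')); rewrite ge_min lexx => /(_ isT).
  have := zP _ pl' (mesh_le _ fl'); rewrite ge_min lexx orbT => /(_ isT).
  by rewrite ler_norml => ? /andP[? _]; lra.
have h1 : sup (E s t x) <= comp_along mu s l x + e.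
  by apply: ge_sup => //; exists (comp_along mu s l x - e).
have h2 : comp_along mu s l x - e <= sup (E s t x).
  by apply: ub_le_sup => //; exists (comp_along mu s l x + e).
by rewrite ler_norml; apply/andP; split; lra.
Qed.

Section limit.
Context (phi : R -> R -> R -> R) (phiP : sewn phi).

(** One partition serves finitely many starting points, so that inequalities
    between values of a composition pass to the limit. *)
Lemma sewn_approx s t e (xs : seq R) : 0 <= s -> s <= t -> t <= T -> 0 < e ->
  exists l, [/\ part s t l, mesh w e s l &
    forall x, x \in xs -> `|comp_along mu s l x - phi s t x| <= e].
Proof.
move=> s0 st tT e0.
have [d d_gt0 dP] : exists2 d, 0 < d & forall l, part s t l -> mesh w d s l ->
    forall x, x \in xs -> `|comp_along mu s l x - phi s t x| <= e.
  elim: xs => [|x xs [d d0' dP]]; first by exists 1.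
  have [d1 d10 d1P] := phiP x s0 st tT e0.
  exists (Num.min d d1); first by rewrite lt_min d0'.
  move=> l pl fl x'; rewrite inE => /predU1P[->|].
    by apply: d1P => //; apply: mesh_le fl; rewrite ge_min lexx orbT.
  by apply: dP => //; apply: mesh_le fl; rewrite ge_min lexx.
have de : 0 < Num.min d e by rewrite lt_min d_gt0.
have [l pl fl] := exists_mesh cw s0 st tT de.
exists l; split=> //; first by apply: mesh_le fl; rewrite ge_min lexx orbT.
by apply: dP => //; apply: mesh_le fl; rewrite ge_min lexx.
Qed.

Lemma sewn_id s x : 0 <= s -> s <= T -> phi s s x = x.
Proof.
move=> s0 sT; apply/eqP; rewrite eq_sym -subr_eq0 -normr_le0.
apply/ler_addgt0Pr => e e0; rewrite add0r.
have [d _ dP] := phiP x s0 (lexx s) sT e0.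
exact: (dP [::] (part_nil _)).
Qed.

Lemma sewn_flow s u t x : 0 <= s -> s <= u -> u <= t -> t <= T ->
  phi u t (phi s u x) = phi s t x.
Proof.
move=> s0 su ut tT; have u0 := le_trans s0 su; have uT := le_trans ut tT.
have st := le_trans su ut.
apply/eqP; rewrite -subr_eq0 -normr_le0.
apply/ler_addgt0Pr => e e0; rewrite add0r.
have L0 : 0 < L by apply: lt_le_trans L_ge1.
have e1 : 0 < e / (3 * L) by rewrite divr_gt0 // mulr_gt0.
have e3 : 0 < e / 3 by rewrite divr_gt0.
have [d d_gt0 dP] := phiP x s0 st tT e3.
have [d1 d1_gt0 d1P] := phiP (phi s u x) u0 ut tT e3.
have m_gt0 : 0 < Num.min (Num.min d d1) (Num.min (e / (3 * L)) d0).
  by rewrite !lt_min d_gt0 d1_gt0 e1 d0_gt0.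
have [l [pl fl lP]] := sewn_approx [:: x] s0 su uT m_gt0.
have [l' pl' fl'] := exists_mesh cw u0 ut tT m_gt0.
have /andP[_ /eqP el] := pl.
have h1 : `|comp_along mu u l' (comp_along mu s l x) - phi s t x| <= e / 3.
  rewrite -[in comp_along mu u _ _]el -comp_cat; apply: dP; first exact: part_cat pl'.
  rewrite mesh_cat el; apply/andP; split;
   by [apply: mesh_le fl; rewrite !ge_min lexx | apply: mesh_le fl'; rewrite !ge_min lexx].
have h2 : `|comp_along mu u l' (phi s u x) - phi u t (phi s u x)| <= e / 3.
  apply: d1P => //; apply: mesh_le fl'; by rewrite !ge_min lexx orbT.
have h3 : `|comp_along mu u l' (comp_along mu s l x) - comp_along mu u l' (phi s u x)| <= e / 3.
  apply: le_trans (lip_comp _ _ u0 tT pl' _) _.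
    by apply: mesh_le fl'; rewrite !ge_min lexx !orbT.
  have := lP x (mem_head _ _) => /le_trans; move/(_ (e / (3 * L))).
  rewrite !ge_min lexx orbT => /(_ isT); rewrite -(ler_pM2l L0) => /le_trans; apply.
  rewrite le_eqVlt; apply/orP; left; apply/eqP; field; rewrite gt_eqF //.
move: h1 h2 h3; rewrite !ler_norml => /andP[? ?] /andP[? ?] /andP[? ?].
by apply/andP; split; lra.
Qed.

Lemma sewn_close s t x : 0 <= s -> s < t -> t <= T -> w s t <= d0 ->
  `|phi s t x - mu s t x| <= eta s t.
Proof.
move=> s0 st tT wst; apply/ler_addgt0Pr => e e0.
have [l [pl fl lP]] := sewn_approx [:: x] s0 (ltW st) tT e0.
have := lP x (mem_head _ _); have := close_comp x s0 st tT pl wst.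
rewrite (_ : phi s t x - mu s t x = - (comp_along mu s l x - phi s t x) +
  (comp_along mu s l x - mu s t x)); last by ring.
move=> h1 h2; apply: le_trans (ler_normD _ _) _; rewrite normrN; lra.
Qed.

End limit.
End sewing.

(** * Perturbations of near-identity maps *)

Section perturbations.
Context {R : realType}.
Implicit Types (g h m : R -> R) (a b c e x y : R).

(** One constant for the sup norm and for the Lipschitz seminorm: both have
    to be propagated together along compositions. *)
Definition C01 e h : Prop :=
  (forall x, `|h x| <= e) /\ (forall x y, `|h x - h y| <= e * `|x - y|).

Definition lip e h : Prop := forall x y, `|h x - h y| <= e * `|x - y|.

(** The four-point inequality holds when the derivative of m - id is bounded
    by c and c-Lipschitz, but it needs no derivative and is what survives in the
    Lipschitz estimate of near_id_perturb. *)
Definition near_id c m : Prop :=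
  C01 c (fun x => m x - x) /\
  forall a b a' b',
    `|((m a - a) - (m b - b)) - ((m a' - a') - (m b' - b'))| <=
    c * (`|(a - b) - (a' - b')| + (`|a - a'| + `|b - b'|) * `|a' - b'|).

Definition slopes a b g : Prop := forall x y, x <= y ->
  a * (y - x) <= g y - g x <= b * (y - x).

Lemma C01_le e e' h : e <= e' -> C01 e h -> C01 e' h.
Proof.
move=> ee [h1 h2]; split=> [x|x y]; first exact: le_trans ee.
by apply: le_trans (h2 x y) _; rewrite ler_wpM2r.
Qed.

Lemma C01_eq e g h : g =1 h -> C01 e g -> C01 e h.
Proof. by move=> gh [h1 h2]; split=> [x|x y]; rewrite -!gh. Qed.

Lemma C01D e e' g h : C01 e g -> C01 e' h -> C01 (e + e') (fun x => g x + h x).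
Proof.
move=> [g1 g2] [h1 h2]; split=> [x|x y].
  by apply: le_trans (ler_normD _ _) _; rewrite lerD.
rewrite (_ : _ - _ = (g x - g y) + (h x - h y)); last by ring.
by apply: le_trans (ler_normD _ _) _; rewrite mulrDl lerD.
Qed.

Lemma C01_ge0 e h : C01 e h -> 0 <= e.
Proof. by move=> [/(_ 0) + _]; apply: le_trans. Qed.

Lemma C01_comp e b g h : 1 <= b -> C01 e h -> lip b g ->
  C01 (e * b) (fun x => h (g x)).
Proof.
move=> b1 Ch lg; have e0 := C01_ge0 Ch; case: Ch => h1 h2; split=> [x|x y].
  by apply: le_trans (h1 _) _; rewrite ler_peMr.
by apply: le_trans (h2 _ _) _; rewrite -mulrA ler_wpM2l.
Qed.

Lemma lip_comp a b g h : 0 <= a -> lip a h -> lip b g -> lip (a * b) (fun x => h (g x)).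
Proof.
by move=> a0 lh lg x y; apply: le_trans (lh _ _) _; rewrite -mulrA ler_wpM2l.
Qed.

Lemma lip_le a b g : a <= b -> lip a g -> lip b g.
Proof. by move=> ab lg x y; apply: le_trans (lg _ _) _; rewrite ler_wpM2r. Qed.

Lemma lip_C01 a e g h : lip a g -> C01 e (fun x => h x - g x) -> lip (a + e) h.
Proof.
move=> lg [_ he] x y; have := lg x y; have := he x y.
rewrite mulrDl => h1 h2.
rewrite (_ : h x - h y = (g x - g y) + (h x - g x - (h y - g y))); last by ring.
by apply: le_trans (ler_normD _ _) _; rewrite lerD.
Qed.

Lemma near_id_lip c m : near_id c m -> lip (1 + c) m.
Proof.
case=> Cm _; apply: lip_C01 Cm => x y; by rewrite mul1r.
Qed.

(** Composing on the left with a near-identity map transports a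
    perturbation h - g with its two norms almost unchanged; the four-point
    inequality handles the Lipschitz seminorm. *)
Lemma near_id_perturb c m g h e : near_id c m -> lip 2 g -> e <= 1 ->
  C01 e (fun x => h x - g x) ->
  C01 ((1 + 6 * c) * e) (fun x => m (h x) - m (g x)).
Proof.
move=> [Cm m4] lg e1 Che.
have lh := lip_C01 lg Che; have e0 := C01_ge0 Che.
have c0 := C01_ge0 Cm.
case: Cm => _ mlip; case: Che => he1 he2; split=> [x|x y].
  rewrite (_ : m (h x) - m (g x) = (h x - g x) + ((m (h x) - h x) - (m (g x) - g x))); last by ring.
  apply: le_trans (ler_normD _ _) _.
  have := he1 x; have := mlip (h x) (g x).
  have : c * `|h x - g x| <= c * e by rewrite ler_wpM2l.
  by have : 0 <= c * e by [rewrite mulr_ge0]; lra.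
rewrite (_ : m (h x) - m (g x) - _ = (h x - g x - (h y - g y)) +
  (m (h x) - h x - (m (g x) - g x) - (m (h y) - h y - (m (g y) - g y)))); last by ring.
apply: le_trans (ler_normD _ _) _.
apply: le_trans (lerD (he2 _ _) (m4 _ _ _ _)) _.
have h1 : `|h x - h y| <= 3 * `|x - y|.
  by apply: le_trans (lh _ _) _; rewrite ler_wpM2r //; lra.
have h2 : (`|h x - h y| + `|g x - g y|) * `|h y - g y| <= 5 * `|x - y| * e.
  apply: ler_pM => //.
  by have := lg x y; lra.
rewrite (_ : (1 + 6 * c) * e * `|x - y| =
  e * `|x - y| + c * (e * `|x - y| + 5 * `|x - y| * e)); last by ring.
by rewrite lerD2l ler_wpM2l // lerD.
Qed.

(** The induction step of the discrete sewing estimate: the outer factors of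
    m3 o m2 o m1 are perturbed into g3 and g1, while m3 o m2 o m1 is itself
    close to m123 by two applications of the almost flow property. The factor
    2 + 20 c0 in front of e is what the halving of the control must beat. *)
Lemma perturbed_triple_composition (m1 m2 m3 m12 m123 g1 g3 : R -> R) c c0 D e :
  near_id c m1 -> near_id c m2 -> near_id c m3 -> near_id c m12 ->
  c <= c0 -> c0 <= 20^-1 -> D <= 1 -> e <= c0 ->
  C01 D (fun x => m2 (m1 x) - m12 x) -> C01 D (fun x => m3 (m12 x) - m123 x) ->
  C01 e (fun x => g1 x - m1 x) -> C01 e (fun x => g3 x - m3 x) ->
  C01 (e * (2 + 20 * c0) + 3 * D) (fun x => g3 (m2 (g1 x)) - m123 x).
Proof.
move=> n1 n2 n3 n12 cc0 c020 D1 ec0 CD1 CD2 Cg1 Cg3.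
have c_ge0 := C01_ge0 (proj1 n1); have e_ge0 := C01_ge0 Cg1.
have D_ge0 := C01_ge0 CD1.
have c0_ge0 := le_trans c_ge0 cc0.
have c00 : c0 * c0 <= c0 * 20^-1 by rewrite ler_wpM2l.
have cc00 : c * c <= c0 * c0 by rewrite ler_pM.
have ec00 : c * e <= c0 * c0 by rewrite ler_pM.
have lg1 : lip (1 + 2 * c0) g1.
  by apply: lip_le (lip_C01 (near_id_lip n1) Cg1); lra.
have lw' : lip (1 + 4 * c0) (fun x => m2 (g1 x)).
  apply: (lip_le _ (lip_comp _ (near_id_lip n2) lg1)); last by lra.
  have : c * c0 <= c0 * c0 by rewrite ler_wpM2r.
  lra.
have lw : lip 2 (fun x => m2 (m1 x)).
  apply: (lip_le _ (lip_comp _ (near_id_lip n2) (near_id_lip n1))); last by lra.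
  lra.
have T1 := C01_comp (_ : 1 <= 1 + 4 * c0) Cg3 lw'.
have lm1 : lip 2 m1 by apply: lip_le (near_id_lip n1); lra.
have P1 := near_id_perturb n2 lm1 (_ : e <= 1) Cg1.
have P2 := near_id_perturb n3 lw (_ : (1 + 6 * c) * e <= 1) (P1 _).
have lm12 : lip 2 m12 by apply: lip_le (near_id_lip n12); lra.
have P3 := near_id_perturb n3 lm12 D1 CD1.
have h1 : 1 <= 1 + 4 * c0 by lra.
have h2 : e <= 1 by lra.
have h3 : (1 + 6 * c) * e <= 1.
  apply: (@le_trans _ _ (1 * 1)); last by rewrite mul1r.
  by rewrite mulrDl mul1r -mulrA; lra.
have := C01D (C01D (C01D (T1 h1) (P2 h3 h2)) P3) CD2.
move/(C01_eq (h := fun x => g3 (m2 (g1 x)) - m123 x)) => /(_ _) H.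
apply: (C01_le _ (H _)) => [|x]; last by ring.
have k1 : (1 + 6 * c) * ((1 + 6 * c) * e) <= (1 + 14 * c0) * e.
  rewrite mulrA ler_wpM2r //; lra.
have k2 : (1 + 6 * c) * D <= 2 * D by rewrite ler_wpM2r //; lra.
have k3 : 0 <= e * c0 by rewrite mulr_ge0.
lra.
Qed.

End perturbations.

Section splitting.
Context {R : realType} {T : R} {w : R -> R -> R} (cw : clock T w).
Implicit Types (s t u v d : R) (l : seq R).

(** The first point v of the partition beyond which the control exceeds d;
    superadditivity bounds the control of what follows v. *)
Lemma part_split s t l d : part s t l -> 0 <= s -> t <= T -> 0 <= d -> d < w s t ->
  exists l1 v l2, [/\ l = l1 ++ v :: l2, w s (last s l1) <= d & d < w s v].
Proof.
move=> pl s0 tT d0 dw.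
suff H u : w s u <= d -> part u t l ->
    exists l1 v l2, [/\ l = l1 ++ v :: l2, w s (last u l1) <= d & d < w s v].
  by apply: H => //; rewrite (clock_diag cw) // (le_trans (part_le pl)).
elim: l u {pl} => [|v l IH] u wu.
  by rewrite /part /= => /eqP ut; move: wu; rewrite ut leNgt dw.
rewrite part_cons => /andP[_ pl].
have [wv|wv] := leP (w s v) d; last by exists [::], v, l.
have [l1 [v' [l2 [-> h1 h2]]]] := IH _ wv pl.
by exists (v :: l1), v', l2.
Qed.

End splitting.

(** * Discrete sewing of almost flows *)

Section pth_root.
Context {R : realType} (p : R) (p_gt0 : 0 < p).

Definition pth_root (x : R) : R := x `^ p^-1.

Lemma pth_root_ge0 x : 0 <= pth_root x. Proof. exact: powR_ge0. Qed.

Lemma pth_root_le x y : 0 <= x -> x <= y -> pth_root x <= pth_root y.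
Proof.
move=> x0 xy; apply: ge0_ler_powR => //; rewrite ?nnegrE ?invr_ge0 ?(ltW p_gt0) //.
exact: le_trans xy.
Qed.

Lemma pth_rootK x : 0 <= x -> pth_root (x `^ p) = x.
Proof. by move=> x0; rewrite /pth_root -powRrM mulfV ?gt_eqF // powRr1. Qed.

Lemma pth_root_small e : 0 < e -> exists2 d : R, 0 < d &
  forall x : R, 0 <= x -> x <= d -> pth_root x <= e.
Proof.
move=> e0; exists (e `^ p); first exact: powR_gt0.
by move=> x x0 xe; rewrite -[leRHS]pth_rootK ?(ltW e0) //; apply: pth_root_le.
Qed.

(** Since 3 / p > 1, halving the control divides its power 3 / p by more
    than 2. *)
Lemma pth_root3_half : p < 3 -> exists2 rho : R, 0 <= rho < 2^-1 &
  forall x y : R, 0 <= x -> x <= y / 2 -> pth_root x ^+ 3 <= rho * pth_root y ^+ 3.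
Proof.
move=> p3; exists (pth_root 2^-1 ^+ 3).
  rewrite exprn_ge0 ?pth_root_ge0 //=.
  rewrite -powR_mulrn ?pth_root_ge0 // /pth_root -powRrM.
  rewrite /powR gt_eqF ?invr_gt0 // -[ltRHS]lnK ?posrE ?invr_gt0 // ltr_expR.
  have h2 : 0 < 2^-1 :> R /\ 2^-1 < 1 :> R by split; lra.
  rewrite gtr_nMl ?ln_lt0 ?h2.1 ?h2.2 //.
  by rewrite mulrC ltr_pdivlMr // mul1r.
move=> x y x0 xy; have y0 : 0 <= y by lra.
rewrite -exprMn -powRM ?invr_ge0 // ler_pXn2r ?nnegrE ?powR_ge0 //.
by apply: pth_root_le => //; rewrite mulrC.
Qed.

End pth_root.

Section almost_flows.
Context {R : realType} {T : R} {w : R -> R -> R} (cw : clock T w).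
Context (p : R) (p_gt0 : 0 < p) (p_lt3 : p < 3).
Implicit Types (s t u v : R) (l : seq R) (mu : R -> R -> R -> R).
Local Notation nu s t := (pth_root p (w s t)).

(** The order 3 / p > 1 of the composition defect is what makes compositions
    along partitions converge. *)
Record almost_flow mu (C d : R) : Prop := AlmostFlow {
  af_id : forall s x, mu s s x = x;
  af_near : forall s t, 0 <= s -> s <= t -> t <= T -> w s t <= d ->
    near_id (C * nu s t) (mu s t);
  af_defect : forall s u t, 0 <= s -> s <= u -> u <= t -> t <= T -> w s t <= d ->
    C01 (C * nu s t ^+ 3) (fun x => mu u t (mu s u x) - mu s t x) }.

Context (mu : R -> R -> R -> R) (C d1 : R) (C_ge0 : 0 <= C) (d1_gt0 : 0 < d1).
Context (af : almost_flow mu C d1).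

Lemma nu_mono s t u v : 0 <= s -> s <= u -> u <= v -> v <= t -> t <= T ->
  nu u v <= nu s t.
Proof.
move=> s0 su uv vt tT; apply: pth_root_le => //; last exact: (clock_mono cw).
by apply: (clock_ge0 cw); [apply: le_trans su | | apply: le_trans tT].
Qed.

(** Induction on the number of points. The partition is cut at an interval
    [u, v] such that both [s, u] and [v, t] carry at most half of the control; by
    induction their contributions are at most rho * K * nu^3 each with
    rho < 1/2, which leaves room for the defects of the germ. *)
Lemma local_sewing : exists K d : R, [/\ 0 <= K, 0 < d, d <= d1 &
  forall s t l, 0 <= s -> t <= T -> part s t l -> w s t <= d ->
    C01 (K * nu s t ^+ 3) (fun x => comp_along mu s l x - mu s t x)].
Proof.
have [rho /andP[rho0 rho2] rhoP] := pth_root3_half p_gt0 p_lt3.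
(* K and c0 are such that K * rho * (2 + 20 * c0) + 3 * C <= K. *)
have [K K0 KE] : exists2 K : R, 0 <= K & 3 * C = K * ((1 - 2 * rho) / 2).
  exists (6 * C / (1 - 2 * rho)); last by field; rewrite gt_eqF //; lra.
  by rewrite divr_ge0 // ?mulr_ge0 //; lra.
have [c0 c0E] : exists c0 : R, c0 = (1 - 2 * rho) / 20 by eexists.
have c0_gt0 : 0 < c0 by lra.
have c0_le : c0 <= 20^-1 by lra.
have C0 := C_ge0.
have S0 : 0 < C + K + 1 by lra.
have eta0 : 0 < c0 / (C + K + 1) by rewrite divr_gt0.
have [d2 d2_gt0 d2P] := pth_root_small p_gt0 eta0.
exists K, (Num.min d1 d2); split=> //; first by rewrite lt_min d1_gt0.
  by rewrite ge_min lexx.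
move=> s t l; have [n] := ubnP (size l).
elim: n s t l => // n IH s t l /ltnSE sz s0 tT pl wd.
have st := part_le pl.
have wd1 : w s t <= d1 by apply: le_trans wd _; rewrite ge_min lexx.
have nu_ge0 := pth_root_ge0 p (w s t).
have nu_le : nu s t <= c0 / (C + K + 1).
  by apply: d2P; [exact: (clock_ge0 cw) | apply: le_trans wd _; rewrite ge_min lexx orbT].
have nuc0 : C * nu s t + K * nu s t + nu s t <= c0.
  move: nu_le; rewrite ler_pdivlMr //; lra.
have Cnu0 : 0 <= C * nu s t by rewrite mulr_ge0.
have Knu0 : 0 <= K * nu s t by rewrite mulr_ge0.
have nu1 : nu s t <= 1 by lra.
have nu3 : nu s t ^+ 3 <= nu s t by rewrite -[leRHS]expr1 ler_wiXn2l.
have nu3_ge0 : 0 <= nu s t ^+ 3 by rewrite exprn_ge0.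
have [st_eq|st_ne] := eqVneq s t.
  rewrite -st_eq in pl *; rewrite (part_diag pl) /=.
  split=> [x|x y]; rewrite !(af_id af) ?subrr normr0 ?mulr_ge0 ?exprn_ge0 ?pth_root_ge0 //.
have {}st_lt : s < t by rewrite lt_neqAle st_ne.
have w0 := clock_gt0 cw s0 st_lt tT.
have half0 : 0 <= w s t / 2 by lra.
have half1 : w s t / 2 < w s t by lra.
have [l1 [v [l2 [el wu wv]]]] := part_split cw pl s0 tT half0 half1.
set u := last s l1 in wu.
have [p1 p2] : part s u l1 /\ part u t (v :: l2) by apply: part_catP; rewrite -el.
move: p2; rewrite part_cons => /andP[uv p2].
have su := part_le p1; have vt := part_le p2.
have sv : s <= v by apply: le_trans su (ltW uv).
have u0 : 0 <= u by apply: le_trans su. have v0 : 0 <= v by apply: le_trans sv.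
have vT : v <= T by apply: le_trans vt tT. have uT : u <= T by apply: le_trans (ltW uv) vT.
have wvt : w v t <= w s t / 2.
  by have := clock_add cw s0 sv vt tT; lra.
have sz12 : (size l1 < n)%N /\ (size l2 < n)%N.
  by move: sz; rewrite el size_cat /= addnS => sz; split; apply: leq_trans sz;
    rewrite ltnS ?leq_addr ?leq_addl.
have g1 : C01 (K * (rho * nu s t ^+ 3)) (fun x => comp_along mu s l1 x - mu s u x).
  apply: C01_le (IH s u l1 sz12.1 s0 uT p1 _); last by lra.
  by rewrite ler_wpM2l // rhoP // (clock_ge0 cw).
have g3 : C01 (K * (rho * nu s t ^+ 3)) (fun x => comp_along mu v l2 x - mu v t x).
  apply: C01_le (IH v t l2 sz12.2 v0 tT p2 _); last by lra.
  by rewrite ler_wpM2l // rhoP // (clock_ge0 cw).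
have near a b : s <= a -> a <= b -> b <= t -> near_id (C * nu s t) (mu a b).
  move=> sa ab bt.
  have wab : w a b <= w s t by apply: (clock_mono cw).
  have := af_near af (le_trans s0 sa) ab (le_trans bt tT) (le_trans wab wd1).
  have nuab : C * nu a b <= C * nu s t by rewrite ler_wpM2l // nu_mono.
  case=> h1 h2; split; first exact: C01_le h1.
  move=> a1 b1 a' b'; apply: le_trans (h2 _ _ _ _) _.
  by rewrite ler_wpM2r // addr_ge0 // mulr_ge0 // addr_ge0.
have D1 : C01 (C * nu s t ^+ 3) (fun x => mu u v (mu s u x) - mu s v x).
  apply: C01_le (af_defect af s0 su (ltW uv) vT _).
    by rewrite ler_wpM2l // lerXn2r ?nnegrE ?pth_root_ge0 // nu_mono.
  by apply: le_trans wd1; apply: (clock_mono cw).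
have D2 := af_defect af s0 sv vt tT wd1.
have rho3 : rho * nu s t ^+ 3 <= 2^-1 * nu s t by rewrite ler_pM // ltW.
have := perturbed_triple_composition (near s u _ _ _) (near u v _ _ _)
  (near v t _ _ _) (near s v _ _ _)
  (_ : C * nu s t <= c0) c0_le (_ : C * nu s t ^+ 3 <= 1)
  (_ : K * (rho * nu s t ^+ 3) <= c0) D1 D2 g1 g3.
have Crho : C * nu s t ^+ 3 <= C * nu s t by rewrite ler_wpM2l.
have Krho : K * (rho * nu s t ^+ 3) <= K * (2^-1 * nu s t) by rewrite ler_wpM2l.
move=> /(_ (lexx _) su (ltW (lt_le_trans uv vt)) su (ltW uv) vt sv vt (lexx _) (lexx _) sv vt).
move=> H.
apply: (@C01_eq _ _ (fun x =>
  comp_along mu v l2 (mu u v (comp_along mu s l1 x)) - mu s t x)).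
  by move=> x; rewrite el comp_cat.
apply: C01_le (H _ _ _); [|lra..].
have -> : K * (rho * nu s t ^+ 3) * (2 + 20 * c0) + 3 * (C * nu s t ^+ 3) =
  nu s t ^+ 3 * (K * (rho * (2 + 20 * c0)) + 3 * C) by ring.
rewrite mulrC ler_wpM2r //.
rewrite KE -mulrDr ler_piMr //.
have : rho * c0 <= 2^-1 * c0 by rewrite ler_wpM2r // ltW.
rewrite c0E; lra.
Qed.

End almost_flows.

(** * The flow of an almost flow *)

Section slopes_theory.
Context {R : realType}.
Implicit Types (g h : R -> R) (a b : R).

Lemma slopes_le a b a' b' g : a' <= a -> b <= b' -> slopes a b g -> slopes a' b' g.
Proof.
move=> aa bb sg x y xy; have /andP[h1 h2] := sg x y xy; apply/andP; split.
  by apply: le_trans h1; rewrite ler_wpM2r // subr_ge0.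
by apply: le_trans h2 _; rewrite ler_wpM2r // subr_ge0.
Qed.

Lemma slopes_mono a b g x y : 0 <= a -> slopes a b g -> x <= y -> g x <= g y.
Proof.
move=> a0 sg xy; have /andP[h1 _] := sg x y xy; rewrite -subr_ge0.
by apply: le_trans h1; rewrite mulr_ge0 // subr_ge0.
Qed.

Lemma slopes_comp a b a' b' g h : 0 <= a -> 0 <= a' -> 0 <= b' ->
  slopes a b g -> slopes a' b' h -> slopes (a' * a) (b' * b) (fun x => h (g x)).
Proof.
move=> a0 a'0 b'0 sg sh x y xy; have /andP[h1 h2] := sg x y xy.
have /andP[k1 k2] := sh _ _ (slopes_mono a0 sg xy).
apply/andP; split.
  by apply: le_trans k1; rewrite -mulrA ler_wpM2l.
by apply: le_trans k2 _; rewrite -mulrA ler_wpM2l.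
Qed.

Lemma slopes_lip a b g x y : 0 <= a -> slopes a b g -> `|g x - g y| <= b * `|x - y|.
Proof.
move=> a0 sg; wlog xy : x y / x <= y.
  move=> H; have [xy|/ltW yx] := leP x y; first exact: H.
  by rewrite distrC [X in _ * X]distrC; apply: H.
have /andP[_ h] := sg x y xy.
by rewrite distrC [X in _ * X]distrC !ger0_norm ?subr_ge0 // (slopes_mono a0 sg).
Qed.

Lemma C01_slopes e g : C01 e (fun x => g x - x) -> slopes (1 - e) (1 + e) g.
Proof.
move=> [_ h] x y xy; have := h y x.
rewrite [X in _ * X]ger0_norm ?subr_ge0 // ler_norml => /andP[h1 h2].
by rewrite mulrBl mulrDl mul1r; apply/andP; split; lra.
Qed.

End slopes_theory.

Section small_sums.
Context {R : realType} (p : R) (p_gt0 : 0 < p) (p_lt3 : p < 3).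

Lemma pth_root3_small e : 0 < e -> exists2 d : R, 0 < d &
  forall x : R, 0 <= x -> x <= d -> pth_root p x ^+ 3 <= e * x.
Proof.
move=> e0; pose q := 3 / p - 1.
have q0 : 0 < q by rewrite /q subr_gt0 ltr_pdivlMr // mul1r.
have q1 : 0 < q^-1 by rewrite invr_gt0.
have [d d0 dP] := pth_root_small q1 e0; exists d => // x x0 xd.
have := dP x x0 xd; rewrite /pth_root invrK -powR_mulrn ?powR_ge0 // -powRrM.
have -> : p^-1 * 3 = 1 + q by rewrite /q; ring.
move: x0; rewrite le_eqVlt => /orP[/eqP <-|x0] h.
  by rewrite powR0 ?mulr0 // gt_eqF // ltr_wpDl.
rewrite powRD; last by rewrite (gt_eqF x0) implybT.
by rewrite powRr1 ?(ltW x0) // mulrC ler_wpM2r // ltW.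
Qed.

(** Young's argument: on steps where w is small, w^(3/p) is a small
    multiple of w, and w sums to at most w s t. *)
Lemma psum_root3_small T w K e : clock T w -> 0 <= K -> 0 < e -> exists2 d : R, 0 < d &
  forall s t l, 0 <= s -> t <= T -> part s t l -> mesh w d s l ->
  psum (fun u v => K * pth_root p (w u v) ^+ 3) s l <= e.
Proof.
move=> cw K0 e0; have [T0|T0] := ltP T 0.
  exists 1 => // s t l s0 tT pl; have := part_le pl; lra.
have W0 : 0 <= w 0 T by apply: (clock_ge0 cw).
have e1 : 0 < e / (K * w 0 T + 1) by rewrite divr_gt0 // ltr_wpDl // mulr_ge0.
have [d d0 dP] := pth_root3_small e1; exists d => // s t l s0 tT pl fl.
have h : psum (fun u v => pth_root p (w u v) ^+ 3) s l <= e / (K * w 0 T + 1) * w s t.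
  apply: (@le_trans _ _ (e / (K * w 0 T + 1) * psum w s l)); last first.
    by rewrite ler_wpM2l ?(ltW e1) // (psum_clock cw).
  rewrite -psumZ; elim: l s s0 pl fl => //= v l IH s s0; rewrite part_cons.
  move=> /andP[sv pl] /andP[wv fl]; rewrite lerD //; last first.
    by apply: IH => //; apply: le_trans (ltW sv).
  apply: dP => //; apply: (clock_ge0 cw) => //; first exact: ltW.
  exact: le_trans (part_le pl) tT.
rewrite psumZ; apply: le_trans (ler_wpM2l K0 h) _.
have st := part_le pl.
have hw : w s t <= w 0 T by apply: (clock_mono cw).
apply: (@le_trans _ _ (e / (K * w 0 T + 1) * (K * w 0 T))).
  by rewrite mulrCA ler_wpM2l ?(ltW e1) // ler_wpM2l.
have S0 : 0 < K * w 0 T + 1 by rewrite ltr_wpDl // mulr_ge0.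
rewrite mulrAC ler_pdivrMr // ler_wpM2l ?(ltW e0) //; lra.
Qed.

End small_sums.

Section flows.
Context {R : realType} {T : R} {w : R -> R -> R} (cw : clock T w).
Context (p : R) (p_gt0 : 0 < p) (p_lt3 : p < 3).
Implicit Types (s t u v : R) (l : seq R).
Local Notation nu s t := (pth_root p (w s t)).

(** Rates are available only on intervals where w is at most d. The global
    bounds on slopes and displacements, obtained by chaining such intervals, let
    the flow be applied between arbitrary times. *)
Record rough_flow (mu phi : R -> R -> R -> R) (K B d c L M : R) : Prop := RoughFlow {
  rf_cst : [/\ 0 <= K, 0 <= B & 0 < d] /\ [/\ 0 < c, 1 <= L & 0 <= M];
  rf_id : forall s x, 0 <= s -> s <= T -> phi s s x = x;
  rf_flow : forall s u t x, 0 <= s -> s <= u -> u <= t -> t <= T ->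
    phi u t (phi s u x) = phi s t x;
  rf_germ : forall s t x, 0 <= s -> s < t -> t <= T -> w s t <= d ->
    `|phi s t x - mu s t x| <= K * nu s t ^+ 3;
  rf_near : forall s t, 0 <= s -> s <= t -> t <= T -> w s t <= d ->
    C01 (B * nu s t) (fun x => phi s t x - x);
  rf_slopes : forall s t, 0 <= s -> s <= t -> t <= T -> slopes c L (phi s t);
  rf_disp : forall s t x, 0 <= s -> s <= t -> t <= T -> `|phi s t x - x| <= M }.

Context (mu : R -> R -> R -> R) (C d1 : R) (C_ge0 : 0 <= C) (d1_gt0 : 0 < d1).
Context (af : almost_flow (T := T) (w := w) p mu C d1).

Lemma comp_local : exists K B d : R, [/\ 0 <= K, 0 <= B, 0 < d &
  forall s t l, 0 <= s -> t <= T -> part s t l -> w s t <= d ->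
    [/\ C01 (K * nu s t ^+ 3) (fun x => comp_along mu s l x - mu s t x),
        C01 (B * nu s t) (fun x => comp_along mu s l x - x) & B * nu s t <= 2^-1]].
Proof.
have [K [d [K0 d0 dd1 dP]]] := local_sewing cw p_gt0 p_lt3 C_ge0 d1_gt0 af.
have C0 := C_ge0.
have S0 : 0 < 2 * (C + K + 1) by lra.
have e0 : 0 < (2 * (C + K + 1))^-1 by rewrite invr_gt0.
have [d2 d2_gt0 d2P] := pth_root_small p_gt0 e0.
exists K, (C + K), (Num.min d d2); split=> //; first by rewrite addr_ge0.
  by rewrite lt_min d0.
move=> s t l s0 tT pl wd; have st := part_le pl.
have wd' : w s t <= d by apply: le_trans wd _; rewrite ge_min lexx.
have H := dP _ _ _ s0 tT pl wd'.
have nu0 := pth_root_ge0 p (w s t).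
have nu_le : nu s t <= (2 * (C + K + 1))^-1.
  by apply: d2P; [exact: (clock_ge0 cw) | apply: le_trans wd _; rewrite ge_min lexx orbT].
have nu2 : C * nu s t + K * nu s t + nu s t <= 2^-1.
  by move: nu_le; rewrite -[leRHS]mul1r ler_pdivlMr //; lra.
have Cn : 0 <= C * nu s t by rewrite mulr_ge0.
have Kn : 0 <= K * nu s t by rewrite mulr_ge0.
have nu3 : nu s t ^+ 3 <= nu s t by rewrite -[leRHS]expr1 ler_wiXn2l //; lra.
split=> //; last by lra.
have [N1 _] := af_near af s0 st tT (le_trans wd' dd1).
apply: (@C01_eq _ _ (fun x => (comp_along mu s l x - mu s t x) + (mu s t x - x))).
  by move=> x; ring.
apply: C01_le (C01D H N1).
have : K * nu s t ^+ 3 <= K * nu s t by rewrite ler_wpM2l.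
lra.
Qed.

(** An interval is cut into at most w 0 T / d + 1 blocks on which the local
    bounds apply, separated by single steps; slopes multiply and displacements
    add up. *)
Lemma comp_global (d : R) :
  (0 < d) ->
  (forall s t l, 0 <= s -> t <= T -> part s t l -> w s t <= d ->
    C01 2^-1 (fun x => comp_along mu s l x - x)) ->
  exists c L M : R, [/\ 0 < c, 1 <= L, 0 <= M &
    forall s t l, 0 <= s -> t <= T -> part s t l -> mesh w d s l ->
    slopes c L (comp_along mu s l) /\ forall x, `|comp_along mu s l x - x| <= M].
Proof.
move=> d0 loc.
have locS s t l : 0 <= s -> t <= T -> part s t l -> w s t <= d ->
    slopes 2^-1 2 (comp_along mu s l).
  move=> s0 tT pl wd; apply: slopes_le (C01_slopes (loc s t l s0 tT pl wd)); lra.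
suff H n : exists c L M : R, [/\ [/\ 0 < c, c <= 1, 1 <= L & 0 <= M] &
    forall s t l, 0 <= s -> t <= T -> part s t l -> mesh w d s l ->
    w s t <= n%:R * d ->
    slopes c L (comp_along mu s l) /\ forall x, `|comp_along mu s l x - x| <= M].
  have [c [L [M [[c0 c1 L1 M0] H']]]] := H (Num.bound (`|w 0 T| / d)).
  exists c, L, M; split=> // s t l s0 tT pl fl; have st := part_le pl.
  apply: (H' s t l s0 tT pl fl).
  apply: (@le_trans _ _ (w 0 T)); first exact: (clock_mono cw).
  apply: (le_trans (ler_norm _)); rewrite -ler_pdivrMr // ltW //.
  by apply: archi_boundP; rewrite divr_ge0 // ltW.
elim: n => [|n [c [L [M [[c0 c1 L1 M0] IH]]]]].
  exists 1, 1, 0; split=> // s t l s0 tT pl fl; rewrite mul0r => w0.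
  have := part_le pl; rewrite le_eqVlt => /orP[/eqP e|st]; last first.
    by have := clock_gt0 cw s0 st tT; rewrite ltNge w0.
  rewrite -e in pl; rewrite (part_diag pl) /=; split=> [x y xy|x].
    by rewrite mul1r lexx.
  by rewrite subrr normr0.
exists (c / 4), (4 * L), (M + 1); split; first by split; lra.
move=> s t l s0 tT pl fl wn; have st := part_le pl.
have [wd|wd] := leP (w s t) d.
  split=> [|x]; first by apply: slopes_le (locS _ _ _ s0 tT pl wd); lra.
  by have [/(_ x) h _] := loc _ _ _ s0 tT pl wd; apply: le_trans h _; lra.
have [l1 [v [l2 [el wu wv]]]] := part_split cw pl s0 tT (ltW d0) wd.
set u := last s l1 in wu.
have [p1 p2] : part s u l1 /\ part u t (v :: l2) by apply: part_catP; rewrite -el.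
move: p2; rewrite part_cons => /andP[uv p2].
have su := part_le p1; have vt := part_le p2.
have sv : s <= v by apply: le_trans su (ltW uv).
have u0 : 0 <= u by apply: le_trans su. have v0 : 0 <= v by apply: le_trans sv.
have vT : v <= T by apply: le_trans vt tT. have uT : u <= T by apply: le_trans (ltW uv) vT.
have wvt : w v t <= n%:R * d.
  by have := clock_add cw s0 sv vt tT; rewrite -natr1 mulrDl mul1r in wn; lra.
move: fl; rewrite el mesh_cat => /andP[f1]; rewrite /mesh /= -/u => /andP[wuv f2].
have [S3 D3] := IH _ _ _ v0 tT p2 f2 wvt.
have S1 := locS _ _ _ s0 uT p1 wu.
have S2 := locS _ _ _ u0 vT (part1 uv) wuv.
have D1 := (loc _ _ _ s0 uT p1 wu).1.
have D2 := (loc _ _ _ u0 vT (part1 uv) wuv).1.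
have eq_comp x : comp_along mu s (l1 ++ v :: l2) x =
    comp_along mu v l2 (mu u v (comp_along mu s l1 x)).
  by rewrite comp_cat.
split=> [|x].
  have S := slopes_comp _ _ _ (slopes_comp _ _ _ S1 S2) S3.
  move=> x y xy; rewrite !eq_comp.
  apply: (slopes_le _ _ (S _ _ _ _ _ _)) => //=; lra.
rewrite eq_comp; set X := comp_along mu s l1 x.
have := D1 x; have := D2 X; have := D3 (mu u v X); rewrite -/X /=.
rewrite !ler_norml => /andP[? ?] /andP[? ?] /andP[? ?]; apply/andP; split; lra.
Qed.

Theorem almost_flow_sewing : exists phi (K B d c L M : R), rough_flow mu phi K B d c L M.
Proof.
have [K [B [d [K0 B0 d0 loc]]]] := comp_local.
have loc2 s t l : 0 <= s -> t <= T -> part s t l -> w s t <= d ->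
    C01 2^-1 (fun x => comp_along mu s l x - x).
  by move=> s0 tT pl wd; have [_ h1 h2] := loc _ _ _ s0 tT pl wd; apply: C01_le h1.
have [c [L [M [c0 L1 M0 glob]]]] := comp_global d0 loc2.
have lipc s t l x x' : 0 <= s -> t <= T -> part s t l -> mesh w d s l ->
    `|comp_along mu s l x - comp_along mu s l x'| <= L * `|x - x'|.
  move=> s0 tT pl fl; have [S _] := glob _ _ _ s0 tT pl fl.
  by apply: slopes_lip S; apply: ltW.
have close s t l x : 0 <= s -> s < t -> t <= T -> part s t l -> w s t <= d ->
    `|comp_along mu s l x - mu s t x| <= K * nu s t ^+ 3.
  by move=> s0 st tT pl wd; have [[h _] _ _] := loc _ _ _ s0 tT pl wd.
have small e : 0 < e -> exists2 d, 0 < d & forall s t l, 0 <= s -> t <= T ->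
    part s t l -> mesh w d s l -> psum (fun u v => K * nu u v ^+ 3) s l <= e.
  exact: psum_root3_small.
have [phi phiP] := sewing cw d0 L1 lipc close small.
exists phi, K, B, d, c, L, M.
(* Closed conditions on compositions pass to the limit. *)
have approx s t (e : R) (xs : seq R) (s0 : 0 <= s) (st : s <= t) (tT : t <= T) (e0 : 0 < e) :
    exists l, [/\ part s t l, mesh w d s l &
      forall x, x \in xs -> `|comp_along mu s l x - phi s t x| <= e].
  have me : 0 < Num.min e d by rewrite lt_min e0.
  have [l [pl fl lP]] := sewn_approx cw phiP xs s0 st tT me.
  exists l; split=> // [|x /lP]; first by apply: mesh_le fl; rewrite ge_min lexx orbT.
  by move=> /le_trans; apply; rewrite ge_min lexx.
split=> //.
- by move=> s x; exact: (sewn_id phiP).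
- move=> s u t x; exact: (sewn_flow cw d0 L1 lipc phiP).
- move=> s t x; exact: (sewn_close cw close phiP).
- move=> s t s0 st tT wd; split=> [x|x y]; apply/ler_addgt0Pr => e e0.
    have [l [pl fl lP]] := approx s t e [:: x] s0 st tT e0.
    have [_ [h _] _] := loc _ _ _ s0 tT pl wd.
    have := h x; have := lP x (mem_head _ _).
    rewrite !ler_norml => /andP[? ?] /andP[? ?]; apply/andP; split; lra.
  have e2 : 0 < e / 2 by lra.
  have [l [pl fl lP]] := approx s t (e / 2) [:: x; y] s0 st tT e2.
  have [_ [_ h] _] := loc _ _ _ s0 tT pl wd.
  have := h x y; have := lP x; have := lP y; rewrite !inE !eqxx orbT.
  move=> /(_ isT) + /(_ isT).
  rewrite !ler_norml => /andP[? ?] /andP[? ?] /andP[? ?]; apply/andP; split; lra.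
- move=> s t s0 st tT x y xy; apply/andP; split; apply/ler_addgt0Pr => e e0;
  have e2 : 0 < e / 2 by [lra];
  have [l [pl fl lP]] := approx s t (e / 2) [:: x; y] s0 st tT e2;
  have [/(_ x y xy)/andP[h1 h2] _] := glob _ _ _ s0 tT pl fl;
  have := lP x; have := lP y; rewrite !inE !eqxx orbT;
  move=> /(_ isT) + /(_ isT); rewrite !ler_norml => /andP[? ?] /andP[? ?]; lra.
- move=> s t x s0 st tT; apply/ler_addgt0Pr => e e0.
  have [l [pl fl lP]] := approx s t e [:: x] s0 st tT e0.
  have [_ /(_ x) h] := glob _ _ _ s0 tT pl fl.
  have := lP x (mem_head _ _); move: h.
  rewrite !ler_norml => /andP[? ?] /andP[? ?]; apply/andP; split; lra.
Qed.

End flows.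

(** * Functions with Lipschitz derivative *)

Section C11_functions.
Context {R : realType}.
Implicit Types (g h : R -> R) (m M a b x y : R).

Definition C11 M g g1 : Prop :=
  [/\ forall x, is_derive x 1 g (g1 x), forall x, `|g x| <= M & C01 M g1].

Lemma mean_value g g1 : (forall x, is_derive x 1 g (g1 x)) ->
  forall x y, exists2 z, `|z - x| <= `|y - x| & g y - g x = g1 z * (y - x).
Proof.
move=> dg; suff H x y : x <= y -> exists2 z, z \in `[x, y] & g y - g x = g1 z * (y - x).
  move=> x y; have [xy|/ltW yx] := leP x y.
    have [z] := H _ _ xy; rewrite in_itv /= => /andP[h1 h2] e; exists z => //.
    by rewrite !ger0_norm ?subr_ge0 // lerD2r.
  have [z] := H _ _ yx; rewrite in_itv /= => /andP[h1 h2] e; exists z.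
    rewrite !ler0_norm ?subr_le0 // ?opprB ?lerD2l ?lerN2 //.
  by apply/eqP; rewrite -eqr_opp opprB e; apply/eqP; ring.
move=> xy; apply: MVT_segment => // z.
apply: continuous_subspaceT z => z; apply: differentiable_continuous.
by apply/derivable1_diffP; have := dg z; case.
Qed.


Lemma mean_value_lip g g1 M : (forall x, is_derive x 1 g (g1 x)) ->
  (forall x, `|g1 x| <= M) -> lip M g.
Proof.
move=> dg g1M x y; have [z _ ->] := mean_value dg y x.
by rewrite normrM ler_wpM2r.
Qed.

Lemma C11_lip M g g1 : C11 M g g1 -> lip M g.
Proof. by case=> dg _ [g1M _]; apply: mean_value_lip dg g1M. Qed.

Lemma C11_C01 M g g1 : C11 M g g1 -> C01 M g.
Proof. by move=> Cg; have lg := C11_lip Cg; case: Cg. Qed.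

Lemma C11_ge0 M g g1 : C11 M g g1 -> 0 <= M.
Proof. by move/C11_C01/C01_ge0. Qed.

Lemma C11_le M M' g g1 : M <= M' -> C11 M g g1 -> C11 M' g g1.
Proof.
move=> MM [dg gM Cg]; split=> // [x|]; first exact: le_trans MM.
exact: C01_le Cg.
Qed.

Lemma C11_taylor M g g1 x a : C11 M g g1 ->
  `|g (x + a) - g x - g1 x * a| <= M * a ^+ 2.
Proof.
move=> Cg; have M0 := C11_ge0 Cg; case: Cg => dg _ [_ lg1].
have [z] := mean_value dg x (x + a); rewrite (addrC x a) addrK => zx ->.
rewrite -mulrBl normrM -real_normK ?num_real // expr2 mulrA ler_wpM2r //.
by apply: le_trans (lg1 _ _) _; rewrite ler_wpM2l.
Qed.

Lemma C01M M M' g h : C01 M g -> C01 M' h -> C01 (2 * (M * M')) (fun x => g x * h x).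
Proof.
move=> Cg Ch; have M0 := C01_ge0 Cg; have M'0 := C01_ge0 Ch.
case: Cg Ch => [g1 g2] [h1 h2]; split=> [x|x y].
  have : `|g x| * `|h x| <= M * M' by rewrite ler_pM.
  have : 0 <= M * M' by rewrite mulr_ge0.
  rewrite normrM; lra.
rewrite (_ : _ - _ = g x * (h x - h y) + (g x - g y) * h y); last by ring.
apply: le_trans (ler_normD _ _) _; rewrite !normrM.
have k1 : `|g x| * `|h x - h y| <= M * (M' * `|x - y|) by rewrite ler_pM.
have k2 : `|g x - g y| * `|h y| <= (M * `|x - y|) * M' by rewrite ler_pM.
lra.
Qed.

Lemma C11D M M' g g1 h h1 : C11 M g g1 -> C11 M' h h1 ->
  C11 (M + M') (fun x => g x + h x) (fun x => g1 x + h1 x).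
Proof.
case=> dg gM Cg [dh hM Ch]; split; last exact: C01D.
  by move=> x; apply: is_deriveD.
by move=> x; apply: le_trans (ler_normD _ _) _; rewrite lerD.
Qed.

Lemma C11Z M b a g g1 : `|a| <= b -> C11 M g g1 ->
  C11 (M * b) (fun x => g x * a) (fun x => g1 x * a).
Proof.
move=> ab Cg; have M0 := C11_ge0 Cg; have b0 : 0 <= b by apply: le_trans ab.
case: Cg => dg gM [g1M lg1]; split; last split.
- move=> x; have H := @is_deriveM _ _ g (cst a) x 1 _ _ (dg x) (is_derive_cst a x 1).
  apply: (@is_derive_eq _ _ _ _ _ _ _ _ H).
  by rewrite scaler0 add0r /= /GRing.scale /= mulrC.
- by move=> x; rewrite normrM ler_pM.
- by move=> x; rewrite normrM ler_pM.
- move=> x y; rewrite -mulrBl normrM mulrAC ler_pM //.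
Qed.

Lemma C11_sum n M (g g1 : 'I_n -> R -> R) : (forall i, C11 M (g i) (g1 i)) ->
  C11 (n%:R * M) (fun x => \sum_i g i x) (fun x => \sum_i g1 i x).
Proof.
elim: n g g1 => [|n IH] g g1 H.
  rewrite mul0r; split=> [x|x|]; rewrite ?big_ord0 ?normr0 //.
    rewrite (_ : (fun x => _) = cst 0); first exact: is_derive_cst.
    by apply/funext => y; rewrite big_ord0.
  by split=> [x|x y]; rewrite !big_ord0 ?subrr normr0 ?mul0r.
rewrite -natr1 mulrDl mul1r addrC.
have := C11D (H ord0) (IH _ _ (fun i => H (lift ord0 i))).
by congr C11; apply/funext => x; rewrite big_ord_recl.
Qed.

Lemma C11M M g g1 g2 h h1 : 0 <= M -> C11 M g g1 -> C11 M h h1 ->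
  C11 M g1 g2 ->
  C11 (4 * (M * M)) (fun x => g1 x * h x) (fun x => g2 x * h x + g1 x * h1 x).
Proof.
move=> M0 Cg Ch Cg1.
have := C01M (C11_C01 Cg1) (C11_C01 Ch) => -[gh _].
case: Cg Ch Cg1 => dg gM Cg [dh hM Ch] [dg1 g1M Cg2].
split.
- move=> x; have H := @is_deriveM _ _ g1 h x 1 _ _ (dg1 x) (dh x).
  apply: (@is_derive_eq _ _ _ _ _ _ _ _ H).
  by rewrite /GRing.scale /= addrC [h x * _]mulrC.
- move=> x; apply: le_trans (gh x) _.
  have : 0 <= M * M by rewrite mulr_ge0.
  lra.
- have -> : 4 * (M * M) = 2 * (M * M) + 2 * (M * M) by ring.
  apply: C01D; apply: C01M => //.
    by split=> //; apply: mean_value_lip dh Ch.1.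
Qed.

(** The mean value theorem along the segments from (b, b') to (a, a'). *)
Lemma C11_near_id c k k1 : C11 c k k1 -> near_id c (fun x => x + k x).
Proof.
move=> Ck; split.
  by apply: C01_eq (C11_C01 Ck) => x; ring.
have c0 := C11_ge0 Ck; case: Ck => dk _ [k1c lk1] a b a' b'.
pose r z := b + z * (a - b); pose r' z := b' + z * (a' - b').
have dr (d e z : R) : is_derive z 1 (fun z => d + z * e) (e : R).
  have H := @is_deriveD _ _ _ (cst d) (fun z : R => z * e) z 1 _ _ (is_derive_cst d z 1)
   (@is_deriveM _ _ id (cst e) z 1 _ _ (is_derive_id z 1) (is_derive_cst e z 1)).
  apply: (@is_derive_eq _ _ _ _ _ _ _ _ H).
  by rewrite scaler0 !add0r /GRing.scale /= mulr1.
pose psi z := k (r z) - k (r' z).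
have dpsi (z : R) : is_derive z 1 psi (k1 (r z) * (a - b) - k1 (r' z) * (a' - b')).
  exact: is_deriveB.
have zb : exists2 z : R, 0 <= z <= 1 & psi 1 - psi 0 =
    k1 (r z) * (a - b) - k1 (r' z) * (a' - b').
  have := @MVT_segment _ psi _ 0 1 ler01 (fun z _ => dpsi z).
  case=> [|z zi e].
    apply: continuous_subspaceT => z; apply: differentiable_continuous.
    by apply/derivable1_diffP; have := dpsi z; case.
  by exists z; [move: zi; rewrite in_itv | rewrite e subr0 mulr1].
case: zb => z /andP[z0 z1] e.
have -> : a + k a - a - (b + k b - b) - (a' + k a' - a' - (b' + k b' - b')) =
  psi 1 - psi 0.
  have [r1 r'1] : r 1 = a /\ r' 1 = a' by split; rewrite /r /r'; ring.
  have [r0 r'0] : r 0 = b /\ r' 0 = b' by split; rewrite /r /r'; ring.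
  by rewrite /psi r1 r'1 r0 r'0; ring.
rewrite e (_ : _ - _ = k1 (r z) * (a - b - (a' - b')) +
  (k1 (r z) - k1 (r' z)) * (a' - b')); last by ring.
apply: le_trans (ler_normD _ _) _; rewrite !normrM mulrDr lerD //.
  by rewrite ler_wpM2r.
rewrite mulrA ler_wpM2r //; apply: le_trans (lk1 _ _) _; rewrite ler_wpM2l //.
rewrite (_ : r z - r' z = z * (a - a') + (1 - z) * (b - b')); last by rewrite /r /r'; ring.
apply: le_trans (ler_normD _ _) _.
rewrite !normrM (ger0_norm z0) (@ger0_norm _ (1 - z)) ?subr_ge0 //.
by apply: lerD; rewrite ler_piMl //; lra.
Qed.

End C11_functions.

(** * The germ of a rough differential equation *)

Lemma mx_coord_le (R : realType) m n (A : 'M[R]_(m, n)) i j : `|A i j| <= `|A|.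
Proof.
rewrite [leRHS]mx_normrE.
exact: (le_bigmax _ (fun ij : 'I_m * 'I_n => `|A ij.1 ij.2|) (i, j)).
Qed.

Section germ.
Context {R : realType}.

(** The defect of the germ is the second order Taylor remainder of the new
    increment B at the point moved by A + P, plus the increment of the new second
    order term Q. A and B are of order m, P and Q of order m^2, so every
    term is of order m^3, and so is every term of its derivative. *)
Lemma C11_defect (m : R) (A A1 B B1 B2 P P1 Q Q1 : R -> R) : m <= 1 ->
  C11 m A A1 -> C11 m B B1 -> C11 m B1 B2 ->
  C11 (m ^+ 2) P P1 -> C11 (m ^+ 2) Q Q1 ->
  C01 (14 * m ^+ 3) (fun x => B (x + (A x + P x)) - B x - B1 x * A x
     + (Q (x + (A x + P x)) - Q x)).
Proof.
move=> m1 CA CB CB1 CP CQ; have m0 := C11_ge0 CA.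
have m2 : m ^+ 2 <= m by rewrite expr2 ler_piMr.
have m2_ge0 : 0 <= m ^+ 2 by rewrite exprn_ge0.
have m3_ge0 : 0 <= m ^+ 3 by rewrite exprn_ge0.
pose h x := A x + P x; pose h1 x := A1 x + P1 x.
have hb x : `|h x| <= 2 * m.
  case: CA CP => _ /(_ x) aA _ [_ /(_ x) aP _].
  by apply: le_trans (ler_normD _ _) _; lra.
have h1b x : `|h1 x| <= 2 * m.
  case: CA CP => _ _ [/(_ x) aA _] [_ _ [/(_ x) aP _]].
  by apply: le_trans (ler_normD _ _) _; lra.
have hh x : h x ^+ 2 <= 4 * m ^+ 2.
  rewrite -real_normK ?num_real // (_ : 4 * m ^+ 2 = (2 * m) ^+ 2); last by ring.
  by rewrite lerXn2r ?nnegrE ?normr_ge0 // mulr_ge0.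
have mm2 (a b : R) : `|a| <= m -> `|b| <= m ^+ 2 -> `|a * b| <= m ^+ 3.
  by move=> am bm; rewrite normrM exprS ler_pM.
have m22 (a b : R) : `|a| <= m ^+ 2 -> `|b| <= 2 * m -> `|a * b| <= 2 * m ^+ 3.
  move=> am bm; rewrite normrM (_ : 2 * m ^+ 3 = m ^+ 2 * (2 * m)) ?ler_pM //; ring.
have tay g g1 x : C11 m g g1 -> `|g (x + h x) - g x - g1 x * h x| <= 4 * m ^+ 3.
  move=> Cg; apply: le_trans (C11_taylor _ _ Cg) _.
  by rewrite (_ : 4 * m ^+ 3 = m * (4 * m ^+ 2)) ?ler_wpM2l //; ring.
have linc M g x : lip M g -> `|g (x + h x) - g x| <= M * (2 * m).
  move=> lg; have M0 : 0 <= M.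
    by have := lg 1 0; rewrite subr0 normr1 mulr1; apply: le_trans.
  by apply: le_trans (lg _ _) _; rewrite addrC addKr ler_wpM2l.
pose D1 x := B1 (x + h x) * (1 + h1 x) - B1 x - (B2 x * A x + B1 x * A1 x) +
  (Q1 (x + h x) * (1 + h1 x) - Q1 x).
have [dA dP] : (forall x : R, is_derive x 1 A (A1 x)) /\ (forall x : R, is_derive x 1 P (P1 x)).
  by case: CA CP => ? ? ? [].
have [dB dB1] : (forall x : R, is_derive x 1 B (B1 x)) /\ (forall x : R, is_derive x 1 B1 (B2 x)).
  by case: CB CB1 => ? ? ? [].
have dQ : forall x : R, is_derive x 1 Q (Q1 x) by case: CQ.
have dxh (x : R) : is_derive x 1 (fun x : R => x + h x) (1 + h1 x).
  apply: is_deriveD; exact: is_deriveD.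
have dcomp (g g1 : R -> R) (x : R) : (forall x : R, is_derive x 1 g (g1 x)) ->
    is_derive x 1 (fun x : R => g (x + h x)) (g1 (x + h x) * (1 + h1 x)).
  by move=> dg; exact: (@is_derive1_comp _ g (fun x : R => x + h x) x _ _ (dg _) (dxh _)).
have dBA (x : R) : is_derive x 1 (fun x : R => B1 x * A x) (B2 x * A x + B1 x * A1 x).
  apply: (@is_derive_eq _ _ _ _ _ _ _ _ (@is_deriveM _ _ B1 A x 1 _ _ (dB1 x) (dA x))).
  by rewrite /GRing.scale /= addrC [A x * _]mulrC.
have leD (a b a' b' : R) : `|a| <= a' -> `|b| <= b' -> `|a + b| <= a' + b'.
  by move=> aa bb; apply: le_trans (ler_normD _ _) _; rewrite lerD.
have B1m x : `|B1 x| <= m by case: CB => _ _ [].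
have B2m x : `|B2 x| <= m by case: CB1 => _ _ [].
have Pm x : `|P x| <= m ^+ 2 by case: CP.
have P1m x : `|P1 x| <= m ^+ 2 by case: CP => _ _ [].
have Q1m x : `|Q1 x| <= m ^+ 2 by case: CQ => _ _ [].
have cube : m ^+ 2 * (2 * m) = 2 * m ^+ 3 by ring.
split=> [x|].
  have t1 := tay _ _ x CB; have t2 := mm2 _ _ (B1m x) (Pm x).
  have t3 := linc _ _ x (C11_lip CQ); rewrite cube in t3.
  rewrite (_ : _ + _ = (B (x + h x) - B x - B1 x * h x) + B1 x * P x +
    (Q (x + h x) - Q x)); last by rewrite /h; ring.
  by apply: le_trans (leD _ _ _ _ (leD _ _ _ _ t1 t2) t3) _; lra.
apply: (@mean_value_lip _ (fun x => B (x + h x) - B x - B1 x * A x + (Q (x + h x) - Q x)) D1) => x.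
have t1 := tay _ _ x CB1; have t2 := mm2 _ _ (B2m x) (Pm x).
have t3 : `|(B1 (x + h x) - B1 x) * h1 x| <= 4 * m ^+ 3.
  rewrite normrM (_ : 4 * m ^+ 3 = m * (2 * m) * (2 * m)); last by ring.
  by rewrite ler_pM // linc //; apply: C11_lip CB1.
have t4 := mm2 _ _ (B1m x) (P1m x).
have t5 : `|Q1 (x + h x) - Q1 x| <= 2 * m ^+ 3.
  by rewrite -cube; apply: linc; case: CQ => _ _ [].
have t6 := m22 _ _ (Q1m (x + h x)) (h1b x).
rewrite (_ : D1 x = (B1 (x + h x) - B1 x - B2 x * h x) + B2 x * P x +
  (B1 (x + h x) - B1 x) * h1 x + B1 x * P1 x + (Q1 (x + h x) - Q1 x) +
  Q1 (x + h x) * h1 x); last by rewrite /D1 /h /h1; ring.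
apply: le_trans (leD _ _ _ _ (leD _ _ _ _ (leD _ _ _ _ (leD _ _ _ _
  (leD _ _ _ _ t1 t2) t3) t4) t5) t6) _; lra.
Qed.

End germ.

Section rde_germ.
Context {R : realType} {N : nat} (f : R -> 'rV[R]_N).

Lemma Cb3_C11 : Cb 3 f -> exists2 M : R, 0 <= M & forall i : 'I_N,
  C11 M (coef f i) (derive1 (coef f i)) /\
  C11 M (derive1 (coef f i)) (derive1 (derive1 (coef f i))).
Proof.
case=> df bf.
have [M M0 bM] : exists2 M : R, 0 <= M & forall n x (i : 'I_N), (n <= 3)%N ->
    `|derive1n n f x ord0 i| <= M.
  have bn n : (n <= 3)%N -> exists2 M : R, 0 <= M & forall x (i : 'I_N),
      `|derive1n n f x ord0 i| <= M.
    move=> /bf /pinfty_ex_gt0[M /ltW M0 bM]; exists M => // x i.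
    have := bM x I; apply: le_trans.
    exact: mx_coord_le.
  have [M0 ? b0] := bn 0 isT; have [M1 ? b1] := bn 1 isT.
  have [M2 ? b2] := bn 2 isT; have [M3 ? b3] := bn 3 isT.
  exists (M0 + M1 + M2 + M3); first by lra.
  move=> [|[|[|[|n]]]] x i // _;
  [have := b0 x i|have := b1 x i|have := b2 x i|have := b3 x i]; lra.
exists M; first exact: M0.
move=> i; pose c n (x : R) : R := derive1n n f x ord0 i.
have dc n (x : R) : (n < 3)%N -> is_derive x 1 (c n) (c n.+1 x).
  move=> n3; have d := df n n3 x.
  have di : derivable (c n) x 1 by move/derivable_mxP: d => /(_ ord0 i).
  apply: DeriveDef => //.
  by rewrite /c derive1nS derive1E (derive_mx d) mxE.
have c1 : derive1 (coef f i) = c 1.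
  apply/funext => x; rewrite derive1E; have [_] := dc 0 x isT; exact.
have c2 : derive1 (c 1) = c 2.
  apply/funext => x; rewrite derive1E; have [_] := dc 1 x isT; exact.
have lipc n : (n < 3)%N -> C01 M (c n).
  move=> n3; split=> [x|]; first by apply: bM; apply: ltnW.
  by apply: mean_value_lip => [x|x]; [exact: dc | exact: bM].
rewrite c1 c2; split; split=> [x|x|].
- exact: (dc 0).
- exact: (bM 0).
- exact: lipc.
- exact: (dc 1).
- exact: (bM 1).
- exact: lipc.
Qed.

(** The identity on the diagonal, where the values of the driver are
    unconstrained. *)
Definition rde_germ (X1 : R -> R -> 'rV[R]_N) (X2 : R -> R -> 'M[R]_N) s t x : R :=
  if s < t then x + (\sum_i coef f i x * X1 s t ord0 i
                     + \sum_i \sum_j coef2 f i j x * X2 s t j i)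
  else x.

(** By the Chen relation the second order term of the germ over [s, t]
    differs from the sum of those over [s, u] and [u, t] by the first order term
    f'(x) X1_ut f(x) X1_su of the Taylor expansion, which leaves C11_defect. *)
Theorem rde_germ_almost_flow (T : R) (w : R -> R -> R) (p : R)
    (X1 : R -> R -> 'rV[R]_N) (X2 : R -> R -> 'M[R]_N) :
  0 < p -> clock T w -> Cb 3 f ->
  (forall (s t : R) i, 0 <= s -> s < t -> t <= T ->
    `|X1 s t ord0 i| <= pth_root p (w s t)) ->
  (forall (s t : R) i j, 0 <= s -> s < t -> t <= T ->
    `|X2 s t i j| <= pth_root p (w s t) ^+ 2) ->
  (forall s u t : R, 0 <= s -> s < u -> u < t -> t <= T ->
    delta2 X1 s u t = 0 /\
    forall i j, delta2 X2 s u t i j = X1 s u ord0 i * X1 u t ord0 j) ->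
  exists C d : R, [/\ 0 <= C, 0 < d &
    almost_flow (T := T) (w := w) p (rde_germ X1 X2) C d].
Proof.
move=> p0 cw /Cb3_C11[M M0 Cf] hX1 hX2 chen.
have N0 : 0 <= N%:R :> R by [].
have [L L1 LM] : exists2 L : R, 1 <= L & N%:R * M <= L /\ N%:R * (N%:R * (4 * (M * M))) <= L.
  have h1 : 0 <= N%:R * M by rewrite mulr_ge0.
  have h2 : 0 <= N%:R * (N%:R * (4 * (M * M))) by rewrite !mulr_ge0.
  by exists (N%:R * M + N%:R * (N%:R * (4 * (M * M))) + 1); [lra | split; lra].
case: LM => LM1 LM2.
have L0 : 0 < L by lra.
have iL : 0 < L^-1 by rewrite invr_gt0.
have [d d0 dP] := pth_root_small p0 iL.
pose F s t x := \sum_i coef f i x * X1 s t ord0 i.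
pose F1 s t x := \sum_i derive1 (coef f i) x * X1 s t ord0 i.
pose F2 s t x := \sum_i derive1 (derive1 (coef f i)) x * X1 s t ord0 i.
pose G s t x := \sum_i \sum_j coef2 f i j x * X2 s t j i.
pose G1 s t x := \sum_i \sum_j (derive1 (derive1 (coef f i)) x * coef f j x +
  derive1 (coef f i) x * derive1 (coef f j) x) * X2 s t j i.
have CF s t b : 0 <= b -> (forall i, `|X1 s t ord0 i| <= b) ->
    C11 (L * b) (F s t) (F1 s t) /\ C11 (L * b) (F1 s t) (F2 s t).
  move=> b0 Xb.
  have LMb : N%:R * (M * b) <= L * b by rewrite mulrA ler_wpM2r.
  split; apply: C11_le LMb _; apply: C11_sum => i; have [Ci Ci1] := Cf i.
    exact: C11Z (Xb i) Ci.
  exact: C11Z (Xb i) Ci1.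
have CG s t b : 0 <= b -> (forall i j, `|X2 s t i j| <= b) ->
    C11 (L * b) (G s t) (G1 s t).
  move=> b0 Xb.
  have LMb : N%:R * (N%:R * (4 * (M * M) * b)) <= L * b.
    by rewrite !mulrA ler_wpM2r // -!mulrA.
  apply: C11_le LMb _; apply: C11_sum => i; apply: C11_sum => j.
  have [Ci Ci1] := Cf i; have [Cj _] := Cf j.
  exact: C11Z (Xb j i) (C11M M0 Ci Cj Ci1).
have nu_le s u v t : 0 <= s -> s <= u -> u <= v -> v <= t -> t <= T ->
  pth_root p (w u v) <= pth_root p (w s t) by exact: nu_mono.
have small s t : 0 <= s -> s <= t -> t <= T -> w s t <= d ->
    let m := L * pth_root p (w s t) in [/\ 0 <= m, m <= 1, m ^+ 2 <= m &
      L * pth_root p (w s t) ^+ 2 <= m ^+ 2].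
  move=> s0 st tT wd m.
  have r0 := pth_root_ge0 p (w s t).
  have m0 : 0 <= m by rewrite mulr_ge0 // ltW.
  have m1 : m <= 1.
    have := dP _ (clock_ge0 cw s0 st tT) wd.
    by rewrite -(ler_pM2l L0) mulfV // gt_eqF.
  split=> //; first by rewrite expr2 ler_piMr.
  have L2 : L <= L ^+ 2 by rewrite -[leLHS]expr1 ler_weXn2l.
  by rewrite /m exprMn ler_wpM2r // exprn_ge0.
exists (14 * L ^+ 3), d; split=> //; first by rewrite mulr_ge0 // exprn_ge0 // ltW.
have L3 : 2 * L <= 14 * L ^+ 3.
  have : L <= L ^+ 3 by rewrite -[leLHS]expr1 ler_weXn2l.
  lra.
split=> [s x|s t s0 st tT wd|s u t s0 su ut tT wd]; first by rewrite /rde_germ ltxx.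
- have [m0 m1 m2 Lm2] := small s t s0 st tT wd.
  have r0 := pth_root_ge0 p (w s t).
  have [Cn_le] : 2 * (L * pth_root p (w s t)) <= 14 * L ^+ 3 * pth_root p (w s t).
    by rewrite mulrA ler_wpM2r.
  move: (st); rewrite le_eqVlt => /orP[/eqP ->|slt].
    rewrite /rde_germ; under eq_fun do rewrite ltxx.
    have c0 : 0 <= 14 * L ^+ 3 * pth_root p (w t t).
      by rewrite mulr_ge0 ?pth_root_ge0 // mulr_ge0 // exprn_ge0 // ltW.
    split; first split=> [x|x y].
    + by rewrite subrr normr0.
    + by rewrite !subrr normr0 mulr_ge0.
    + move=> a b a' b'; rewrite !subrr normr0.
      by apply: mulr_ge0 => //; apply: addr_ge0 => //; apply: mulr_ge0 => //; apply: addr_ge0.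
  have [C1 _] := CF s t _ r0 (fun i => hX1 s t i s0 slt tT).
  have C2 := CG s t _ (exprn_ge0 2 r0) (fun i j => hX2 s t i j s0 slt tT).
  have C3 := C11_near_id (C11_le _ (C11D C1 C2)).
  rewrite /rde_germ slt; apply: C3; lra.
- have st := le_trans su ut.
  have [m0 m1 m2 Lm2] := small s t s0 st tT wd.
  have r0 := pth_root_ge0 p (w s t).
  have c0 : 0 <= 14 * L ^+ 3 * pth_root p (w s t) ^+ 3.
    by rewrite mulr_ge0 ?exprn_ge0 // mulr_ge0 // exprn_ge0 // ltW.
  move: su; rewrite le_eqVlt => /orP[/eqP e|su].
    by rewrite -e /rde_germ ltxx; split=> [x|x y]; rewrite !subrr normr0 // mulr_ge0.
  move: ut; rewrite le_eqVlt => /orP[/eqP e|ut].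
    by rewrite e /rde_germ ltxx; split=> [x|x y]; rewrite !subrr normr0 // mulr_ge0.
  have uT : u <= T by apply: le_trans (ltW ut) tT.
  have u0 : 0 <= u by apply: le_trans (ltW su).
  have su_st : pth_root p (w s u) <= pth_root p (w s t) by apply: nu_le => //; exact: ltW.
  have ut_st : pth_root p (w u t) <= pth_root p (w s t) by apply: nu_le => //; exact: ltW.
  have sq a : 0 <= a -> a <= pth_root p (w s t) -> a ^+ 2 <= pth_root p (w s t) ^+ 2.
    by move=> a0 ab; rewrite lerXn2r ?nnegrE.
  have [CA _] := CF s u _ r0 (fun i => le_trans (hX1 s u i s0 su uT) su_st).
  have [CB CB1] := CF u t _ r0 (fun i => le_trans (hX1 u t i u0 ut tT) ut_st).
  have CP := C11_le Lm2 (CG s u _ (exprn_ge0 2 r0)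
    (fun i j => le_trans (hX2 s u i j s0 su uT) (sq _ (pth_root_ge0 _ _) su_st))).
  have CQ := C11_le Lm2 (CG u t _ (exprn_ge0 2 r0)
    (fun i j => le_trans (hX2 u t i j u0 ut tT) (sq _ (pth_root_ge0 _ _) ut_st))).
  have -> : 14 * L ^+ 3 * pth_root p (w s t) ^+ 3 = 14 * (L * pth_root p (w s t)) ^+ 3 by ring.
  have H := C11_defect m1 CA CB CB1 CP CQ.
  apply: (C01_eq _ H) => x.
  rewrite /rde_germ su ut (lt_trans su ut) -/(F s u x) -/(G s u x) -/(F s t x) -/(G s t x).
  rewrite -/(F u t (x + (F s u x + G s u x))) -/(G u t (x + (F s u x + G s u x))).
  have [ch1 ch2] := chen s u t s0 su ut tT.
  have Fst : F s t x = F s u x + F u t x.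
    rewrite /F -big_split; apply: eq_bigr => i _ /=; rewrite -mulrDr; congr (_ * _).
    move/matrixP: ch1 => /(_ ord0 i); rewrite !mxE => h; lra.
  have Gst : G s t x = G s u x + G u t x + F1 u t x * F s u x.
    rewrite /F1 /F mulr_suml /G -!big_split; apply: eq_bigr => i _ /=.
    rewrite mulr_sumr -!big_split; apply: eq_bigr => j _ /=.
    have := ch2 j i; rewrite !mxE /coef2 => h.
    rewrite (_ : X2 s t j i = X2 s u j i + X2 u t j i + X1 s u ord0 j * X1 u t ord0 i); last by lra.
    by ring.
  by rewrite Fst Gst; ring.
Qed.

End rde_germ.

(** * The reflected path *)

Section moduli.
Context {R : realType} (T : R) (T_gt0 : 0 < T).
Implicit Types (h : R -> R) (s t e : R).

Definition ucont h := forall e, 0 < e -> exists2 d : R, 0 < d &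
  forall s t, 0 <= s -> s <= t -> t <= T -> t - s < d -> `|h t - h s| <= e.

Definition clamp (x : R) : R := Num.max 0 (Num.min T x).

Lemma clampP x : [\/ x <= 0 /\ clamp x = 0, 0 <= x <= T /\ clamp x = x
  | T <= x /\ clamp x = T].
Proof.
have T0 := T_gt0; rewrite /clamp; have [Tx|xT] := leP T x.
  by apply: Or33; split=> //; apply/max_idPr; apply: ltW.
have [x0|/ltW x0] := leP x 0; first by apply: Or31.
by apply: Or32; rewrite x0 ltW.
Qed.

Lemma clamp_itv x : 0 <= clamp x <= T.
Proof.
have T0 := T_gt0; by case: (clampP x) => -[? ->] //; rewrite ?lexx ltW.
Qed.

Lemma clamp_id x : 0 <= x <= T -> clamp x = x.
Proof.
by move=> /andP[x0 xT]; case: (clampP x) => -[h ->] //; apply/eqP; rewrite eq_le ?h ?x0 ?xT.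
Qed.

Lemma clamp_dist x y : x <= y -> 0 <= clamp y - clamp x <= y - x.
Proof.
have T0 := T_gt0; move=> xy.
case: (clampP x) => -[h ->]; case: (clampP y) => -[h' ->];
  try move/andP: h => -[? ?]; try move/andP: h' => -[? ?]; apply/andP; split; lra.
Qed.

Lemma clamp_le x y : x <= y -> clamp x <= clamp y.
Proof. by move=> /clamp_dist/andP[+ _]; rewrite subr_ge0. Qed.

Lemma ucont_clamp h : ucont h -> continuous (h \o clamp).
Proof.
move=> uh x; apply/cvgrPdist_le => e e0; have [d d0 dP] := uh e e0.
near=> y.
have yx : `|x - y| < d by near: y; apply: cvgr_dist_lt.
have [c1 c2] := (clamp_itv x, clamp_itv y).
move: c1 c2 => /andP[? ?] /andP[? ?].
have [xy|/ltW yx'] := leP x y.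
  rewrite distrC; apply: dP => //; first exact: clamp_le.
  apply: le_lt_trans (andP (clamp_dist xy)).2 _.
  by apply: le_lt_trans yx; rewrite distrC ler_norm.
apply: dP => //; first exact: clamp_le.
apply: le_lt_trans (andP (clamp_dist yx')).2 _.
by apply: le_lt_trans yx; rewrite ler_norm.
Unshelve. all: by end_near. Qed.

Lemma ucont_min h s t : ucont h -> 0 <= s -> s <= t -> t <= T ->
  exists2 r, s <= r <= t & forall u, s <= u <= t -> h r <= h u.
Proof.
move=> uh s0 st tT.
have [r rst rP] := @EVT_min R (h \o clamp) s t st (continuous_subspaceT (ucont_clamp uh)).
move: rst; rewrite in_itv /= => /andP[sr rt]; exists r; first by rewrite sr.
move=> u /andP[su ut]; have := rP u; rewrite in_itv /= su ut => /(_ isT).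
rewrite !clamp_id //; apply/andP; split; lra.
Qed.

End moduli.

Section flow_defect.
Context {R : realType} {T : R} {w : R -> R -> R} (cw : clock T w).
Context {p : R} (p_gt0 : 0 < p) {mu phi : R -> R -> R -> R} {K B d c L M : R}.
Context (rf : rough_flow (T := T) (w := w) p mu phi K B d c L M).
Implicit Types (s t u v x y : R) (l : seq R) (h : R -> R).
Local Notation nu s t := (pth_root p (w s t)).

(** How much h was pushed away from the flow between s and t; for a solution
    this is the increment of m up to higher order terms. *)
Definition defect h s t : R := h t - phi s t (h s).

Let c_gt0 : 0 < c. Proof. by case: (rf_cst rf) => _ []. Qed.
Let L_ge1 : 1 <= L. Proof. by case: (rf_cst rf) => _ []. Qed.
Let B_ge0 : 0 <= B. Proof. by case: (rf_cst rf) => -[]. Qed.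

Lemma flow_mono s t x y : 0 <= s -> s <= t -> t <= T -> x <= y ->
  phi s t x <= phi s t y.
Proof.
by move=> s0 st tT; apply: slopes_mono (rf_slopes rf s0 st tT); apply: ltW.
Qed.

Lemma defect_cat h s u t : 0 <= s -> s <= u -> u <= t -> t <= T ->
  defect h s t = defect h u t + (phi u t (h u) - phi u t (phi s u (h s))).
Proof. by move=> s0 su ut tT; rewrite /defect (rf_flow rf) //; ring. Qed.

(** Telescoping: the defect of a step [u, v] reaches time t through the
    flow from v to t, whose slopes lie in [c, L]. *)
Lemma psum_defect h s t l : 0 <= s -> t <= T -> part s t l ->
  (forall u v, s <= u -> u < v -> v <= t -> 0 <= defect h u v) ->
  c * psum (defect h) s l <= defect h s t <= L * psum (defect h) s l.
Proof.
elim: l s => [|v l IH] s s0 tT.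
  move=> /andP[_ /eqP /= st] _; rewrite -st in tT *.
  by rewrite /defect !mulr0 (rf_id rf) // subrr lexx.
rewrite part_cons => /andP[sv pl] pos; have vt := part_le pl.
have v0 : 0 <= v by apply: le_trans s0 (ltW sv).
have /andP[h1 h2] : c * psum (defect h) v l <= defect h v t <= L * psum (defect h) v l.
  by apply: IH => // u u' vu; apply: pos; apply: le_trans (ltW sv) vu.
have D0 := pos s v (lexx s) sv vt.
have xy : phi s v (h s) <= h v by rewrite -subr_ge0.
have /andP[k1 k2] := rf_slopes rf v0 vt tT xy.
rewrite (defect_cat _ s0 (ltW sv) vt tT) /= (mulrDr c) (mulrDr L).
by rewrite -/(defect h s v) in k1 k2; apply/andP; split; lra.
Qed.


(** On a short interval the flow moves the defects by nearly the identity,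
    so their sum differs from the total defect by a small multiple of it. *)
Lemma psum_defect_close h s t l : 0 <= s -> t <= T -> w s t <= d -> part s t l ->
  (forall u v, s <= u -> u < v -> v <= t -> 0 <= defect h u v) ->
  `|psum (defect h) s l - defect h s t| <= B * nu s t * psum (defect h) s l.
Proof.
move=> s0 tT wd.
suff H u : s <= u -> part u t l ->
    (forall u' v, u <= u' -> u' < v -> v <= t -> 0 <= defect h u' v) ->
    `|psum (defect h) u l - defect h u t| <= B * nu s t * psum (defect h) u l.
  by move=> pl pos; apply: H.
elim: l u => [|v l IH] u su.
  move=> /andP[_ /eqP /= ut] _; rewrite -ut in tT *.
  by rewrite /defect mulr0 (rf_id rf) // ?subrr ?normr0 //; apply: le_trans su.
rewrite part_cons => /andP[uv pl] pos; have vt := part_le pl.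
have u0 : 0 <= u by apply: le_trans su.
have v0 : 0 <= v by apply: le_trans u0 (ltW uv).
have sv : s <= v by apply: le_trans su (ltW uv).
have /= h1 := IH v sv pl (fun u' v' vu => pos u' v' (le_trans (ltW uv) vu)).
have D0 := pos u v (lexx u) uv vt.
have wv : w v t <= w s t by apply: (clock_mono cw).
have [_ /(_ (h v) (phi u v (h u)))] := rf_near rf v0 vt tT (le_trans wv wd).
rewrite -/(defect h u v) (ger0_norm D0) => h2.
have nuv : B * nu v t * defect h u v <= B * nu s t * defect h u v.
  apply: ler_wpM2r => //; apply: ler_wpM2l => //.
  by apply: pth_root_le wv; [exact: p_gt0 | exact: (clock_ge0 cw)].
rewrite (defect_cat _ u0 (ltW uv) vt tT) /= mulrDr.
rewrite (_ : _ - _ = (psum (defect h) v l - defect h v t) -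
  (phi v t (h v) - h v - (phi v t (phi u v (h u)) - phi u v (h u)))); last first.
  by rewrite /(defect h u v); ring.
apply: le_trans (ler_normB _ _) _; rewrite addrC lerD //.
exact: le_trans h2 nuv.
Qed.

End flow_defect.

Section reflection.
Context {R : realType} {T : R} {w : R -> R -> R} (cw : clock T w).
Context {p : R} (p_gt0 : 0 < p).
Context {mu phi : R -> R -> R -> R} {K B d c L M : R}.
Context (rf : rough_flow (T := T) (w := w) p mu phi K B d c L M).
Context (T_gt0 : 0 < T) (a : R) (a_ge0 : 0 <= a).
Implicit Types (s t u v x y : R) (l : seq R) (h : R -> R).
Local Notation nu s t := (pth_root p (w s t)).

Let c_gt0 : 0 < c. Proof. by case: (rf_cst rf) => _ []. Qed.
Let L_ge1 : 1 <= L. Proof. by case: (rf_cst rf) => _ []. Qed.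
Let M_ge0 : 0 <= M. Proof. by case: (rf_cst rf) => _ []. Qed.
Let B_ge0 : 0 <= B. Proof. by case: (rf_cst rf) => -[]. Qed.
Let d_gt0 : 0 < d. Proof. by case: (rf_cst rf) => -[]. Qed.

Definition reflected_set t : set R :=
  [set z | z = phi 0 t a \/ exists2 s, 0 <= s <= t & z = phi s t 0].

(** Skorokhod's formula carried back by the flow: the path is either still
    on the flow line of a, or on the flow line of 0 issued from its last visit to
    the origin. *)
Definition reflected t : R := sup (reflected_set t).

Lemma reflected_has_sup t : 0 <= t -> t <= T -> has_sup (reflected_set t).
Proof.
move=> t0 tT; split; first by exists (phi 0 t a); left.
have M0 := M_ge0; have a0 := a_ge0.
exists (a + M) => z [->|[s /andP[s0 st] ->]].
  have := rf_disp rf a (lexx 0) t0 tT; rewrite ler_norml => /andP[? ?]; lra.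
have := rf_disp rf 0 s0 st tT; rewrite ler_norml => /andP[? ?]; lra.
Qed.

Lemma reflected_le t : 0 <= t -> t <= T -> reflected t <= a + M.
Proof.
move=> t0 tT; apply: ge_sup; first by exists (phi 0 t a); left.
have M0 := M_ge0; have a0 := a_ge0.
move=> z [->|[s /andP[s0 st] ->]].
  have := rf_disp rf a (lexx 0) t0 tT; rewrite ler_norml => /andP[? ?]; lra.
have := rf_disp rf 0 s0 st tT; rewrite ler_norml => /andP[? ?]; lra.
Qed.

Lemma reflected_ub t z : 0 <= t -> t <= T -> reflected_set t z -> z <= reflected t.
Proof. by move=> t0 tT zS; apply: sup_upper_bound => //; exact: reflected_has_sup. Qed.

Lemma reflected_ge0 t : 0 <= t -> t <= T -> 0 <= reflected t.
Proof.
move=> t0 tT; apply: reflected_ub => //; right; exists t; first by rewrite t0 lexx.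
by rewrite (rf_id rf).
Qed.

Lemma reflected0 : reflected 0 = a.
Proof.
have T0 := ltW T_gt0; apply/eqP; rewrite eq_le; apply/andP; split.
  apply: ge_sup; first by exists (phi 0 0 a); left.
  move=> z [->|[s /andP[s0 st] ->]]; first by rewrite (rf_id rf).
  have -> : s = 0 by apply/eqP; rewrite eq_le s0 st.
  by rewrite (rf_id rf).
by apply: reflected_ub => //; left; rewrite (rf_id rf).
Qed.

Lemma reflected_flow s t : 0 <= s -> s <= t -> t <= T ->
  0 <= defect (phi := phi) reflected s t.
Proof.
move=> s0 st tT; rewrite subr_ge0; apply/ler_addgt0Pr => e e0.
have sT := le_trans st tT; have t0 := le_trans s0 st.
have L0 : 0 < L by apply: lt_le_trans L_ge1.
have eL : 0 < e / L by rewrite divr_gt0.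
have [z zS ze] := sup_adherent eL (reflected_has_sup s0 sT).
have zt : reflected_set t (phi s t z).
  case: zS => [->|[r /andP[r0 rs] ->]]; first by left; rewrite (rf_flow rf).
  by right; exists r; rewrite ?r0 ?(le_trans rs) // (rf_flow rf).
have zy : z <= reflected s by apply: reflected_ub.
have := reflected_ub t0 tT zt.
have /andP[_] := rf_slopes rf s0 st tT zy.
have : L * (reflected s - z) <= e.
  rewrite -ler_pdivlMl // mulrC; rewrite -/(reflected s) in ze; lra.
lra.
Qed.

(** The supremum up to t is taken over the flow lines started before s, which
    lie below the one of reflected s, and over those started after s. *)
Lemma reflected_le_flow s t b : 0 <= s -> s <= t -> t <= T ->
  phi s t (reflected s) <= b -> (forall r, s <= r <= t -> phi r t 0 <= b) ->
  reflected t <= b.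
Proof.
move=> s0 st tT h1 h2; have sT := le_trans st tT.
apply: ge_sup; first by exists (phi 0 t a); left.
move=> z [->|[r /andP[r0 rt] ->]].
  apply: le_trans h1; rewrite -(rf_flow rf a (lexx 0) s0 st tT).
  by apply: (flow_mono rf) => //; apply: reflected_ub => //; left.
have [rs|/ltW sr] := leP r s; last by apply: h2; rewrite sr.
apply: le_trans h1; rewrite -(rf_flow rf 0 r0 rs st tT).
apply: (flow_mono rf) => //; apply: reflected_ub => //; right; exists r => //.
by rewrite r0.
Qed.

Lemma reflected_defect_le s t : 0 <= s -> s <= t -> t <= T -> w s t <= d ->
  defect (phi := phi) reflected s t <= 2 * (B * nu s t).
Proof.
move=> s0 st tT wd; rewrite lerBlDr; have sT := le_trans st tT.
have B0 := B_ge0.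
have Bn : 0 <= B * nu s t by rewrite mulr_ge0 ?pth_root_ge0.
apply: (reflected_le_flow s0 st tT); first by lra.
have y0 := reflected_ge0 s0 sT.
have [/(_ (reflected s)) + _] := rf_near rf s0 st tT wd.
rewrite ler_norml => /andP[h1 _] r /andP[sr rt].
have r0 := le_trans s0 sr.
have wr : w r t <= w s t by apply: (clock_mono cw).
have [/(_ 0) + _] := rf_near rf r0 rt tT (le_trans wr wd).
rewrite subr0 ler_norml => /andP[_ h2].
have : B * nu r t <= B * nu s t.
  by rewrite ler_wpM2l // pth_root_le // (clock_ge0 cw).
lra.
Qed.

Lemma reflected_dist s t : 0 <= s -> s <= t -> t <= T -> w s t <= d ->
  `|reflected t - reflected s| <= 3 * (B * nu s t).
Proof.
move=> s0 st tT wd.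
have := reflected_defect_le s0 st tT wd; have := reflected_flow s0 st tT.
have [/(_ (reflected s)) + _] := rf_near rf s0 st tT wd.
rewrite /defect !ler_norml => /andP[? ?] ? ?; apply/andP; split; lra.
Qed.

Lemma reflected_ucont : ucont T reflected.
Proof.
move=> e e0; have B1 : 0 < 3 * B + 1 by have := B_ge0; lra.
have [d1 d1_gt0 d1P] := pth_root_small p_gt0 (divr_gt0 e0 B1).
have dd : 0 < Num.min d1 d by rewrite lt_min d1_gt0 d_gt0.
have [d2 d2_gt0 d2P] := clock_reg cw dd; exists d2 => // s t s0 st tT std.
have := d2P s t s0 st tT std; rewrite lt_min => /andP[/ltW w1 /ltW w2].
apply: le_trans (reflected_dist s0 st tT w2) _.
have := d1P _ (clock_ge0 cw s0 st tT) w1; rewrite ler_pdivlMr // => h.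
have := pth_root_ge0 p (w s t); lra.
Qed.

(** If the path stays above a level eta > 0, then the flow lines issued from
    0 after s stay below it by at least c * eta and do not contribute to the
    supremum. *)
Lemma reflected_defect0 s t : 0 <= s -> s <= t -> t <= T ->
  (forall r, s <= r <= t -> 0 < reflected r) ->
  defect (phi := phi) reflected s t = 0.
Proof.
move=> s0 st tT pos; have sT := le_trans st tT.
have [r0 rst rmin] := ucont_min T_gt0 reflected_ucont s0 st tT.
have eta0 := pos _ rst; set eta := reflected r0 in eta0 rmin.
apply/eqP; rewrite eq_le (reflected_flow s0 st tT) andbT subr_le0.
have ce : 0 < c * eta by rewrite mulr_gt0.
have H : reflected t <= Num.max (phi s t (reflected s)) (reflected t - c * eta).
  apply: (reflected_le_flow s0 st tT); first by rewrite le_max lexx.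
  move=> r /andP[sr rt]; rewrite le_max; apply/orP; right.
  have er : eta <= reflected r by apply: rmin; rewrite sr.
  have rr0 := le_trans s0 sr.
  have /andP[h _] := rf_slopes rf rr0 rt tT (le_trans (ltW eta0) er).
  have := reflected_flow rr0 rt tT; rewrite /defect subr0 in h *.
  have : c * eta <= c * reflected r by rewrite ler_pM2l.
  lra.
by move: H; rewrite le_max => /orP[//|]; lra.
Qed.

End reflection.

(** * The pushing term *)

Section defect_sewing.
Context {R : realType} {T : R} {w : R -> R -> R} (cw : clock T w).
Context {p : R} (p_gt0 : 0 < p) {mu phi : R -> R -> R -> R} {K B d c L M : R}.
Context (rf : rough_flow (T := T) (w := w) p mu phi K B d c L M).
Implicit Types (s t u v x y : R) (l : seq R) (h : R -> R).
Local Notation nu s t := (pth_root p (w s t)).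
Local Notation defect := (defect (phi := phi)).

Lemma psum_mesh_le s t l (F A : R -> R -> R) e e' : 0 <= s -> t <= T ->
  (forall u v, s <= u -> u < v -> v <= t -> w u v <= e' -> F u v <= e * A u v) ->
  part s t l -> mesh w e' s l -> psum F s l <= e * psum A s l.
Proof.
elim: l s => [|v l IH] s s0 tT FA; first by rewrite mulr0.
rewrite part_cons => /andP[sv pl] /andP[wv fl] /=; rewrite mulrDr lerD //.
  by apply: FA => //; apply: part_le pl.
apply: IH => //; first by apply: le_trans (ltW sv).
by move=> u u' vu; apply: FA; apply: le_trans vu; apply: ltW.
Qed.

(** The additive map is obtained by sewing the translations x |-> x + A_uv,
    whose compositions are translations by the sums of A. *)
Theorem defect_sewing h (b : R) :
  (forall s t, 0 <= s -> s <= t -> t <= T -> 0 <= defect h s t <= b) -> 0 <= T ->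
  exists m : R -> R, [/\ m 0 = 0,
    forall s t, 0 <= s -> s <= t -> t <= T ->
      c * (m t - m s) <= defect h s t <= L * (m t - m s)
    & forall s t, 0 <= s -> s < t -> t <= T -> w s t <= d ->
      `|(m t - m s) - defect h s t| <= B * nu s t * c^-1 * defect h s t].
Proof.
move=> Ab T0.
have [[K0 B0 d0] [c0 L1 M0]] := rf_cst rf.
have A0 s t : 0 <= s -> s <= t -> t <= T -> 0 <= defect h s t.
  by move=> s0 st tT; have /andP[] := Ab s t s0 st tT.
have b0 : 0 <= b.
  have := Ab 0 0 (lexx 0) (lexx 0) T0; case/andP; exact: le_trans.
have bnd s t l : 0 <= s -> t <= T -> part s t l ->
    c * psum (defect h) s l <= defect h s t <= L * psum (defect h) s l.
  move=> s0 tT pl; apply: (psum_defect rf) => // u v su uv vt.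
  by apply: A0; [apply: le_trans su | apply: ltW | apply: le_trans tT].
have S0 s t l : 0 <= s -> t <= T -> part s t l -> 0 <= psum (defect h) s l.
  move=> s0 tT pl; apply: psum_ge0 pl => u v su uv vt.
  by apply: A0; [apply: le_trans su | apply: ltW | apply: le_trans tT].
have Sle s t l : 0 <= s -> t <= T -> part s t l ->
    psum (defect h) s l <= c^-1 * defect h s t.
  by move=> s0 tT pl; have /andP[h1 _] := bnd _ _ _ s0 tT pl; rewrite ler_pdivlMl.
pose tr s t x := x + defect h s t.
pose eta s t := B * nu s t * c^-1 * defect h s t.
have compE s l x : comp_along tr s l x = x + psum (defect h) s l.
  by elim: l s x => [|v l IH] s x /=; rewrite ?addr0 // IH /tr -addrA.
have lipT s t l x x' : 0 <= s -> t <= T -> part s t l -> mesh w d s l ->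
    `|comp_along tr s l x - comp_along tr s l x'| <= 1 * `|x - x'|.
  move=> _ _ _ _; rewrite !compE mul1r (_ : _ - _ = x - x') //; ring.
have close s t l x : 0 <= s -> s < t -> t <= T -> part s t l -> w s t <= d ->
    `|comp_along tr s l x - tr s t x| <= eta s t.
  move=> s0 st tT pl wd; rewrite compE /tr.
  rewrite (_ : _ - _ = psum (defect h) s l - defect h s t); last by ring.
  apply: le_trans (psum_defect_close cw p_gt0 rf s0 tT wd pl _) _.
    move=> u v su uv vt; apply: A0; [exact: le_trans su | exact: ltW | exact: le_trans tT].
  by rewrite /eta -[leRHS]mulrA ler_wpM2l ?mulr_ge0 ?pth_root_ge0 // Sle.
have small e : 0 < e -> exists2 d : R, 0 < d & forall s t l, 0 <= s -> t <= T ->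
    part s t l -> mesh w d s l -> psum eta s l <= e.
  move=> e0.
  have ci : 0 <= c^-1 by rewrite invr_ge0 ltW.
  have D0 : 0 <= B * c^-1 * (c^-1 * b) by rewrite !mulr_ge0.
  have D1 : 0 < B * c^-1 * (c^-1 * b) + 1 by lra.
  have e1 := divr_gt0 e0 D1; set k := e / _ in e1.
  have [d1 d1_gt0 d1P] := pth_root_small p_gt0 e1; exists d1 => // s t l s0 tT pl fl.
  apply: (@le_trans _ _ ((B * k * c^-1) * psum (defect h) s l)).
    apply: (psum_mesh_le s0 tT _ pl fl) => u v su uv vt wuv.
    have u0 := le_trans s0 su; have vT := le_trans vt tT.
    rewrite ler_wpM2r ?A0 ?(ltW uv) // ler_wpM2r // ler_wpM2l //.
    by apply: d1P => //; apply: (clock_ge0 cw) => //; exact: ltW.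
  have kb : psum (defect h) s l <= c^-1 * b.
    apply: le_trans (Sle _ _ _ s0 tT pl) _; rewrite ler_wpM2l //.
    by have /andP[] := Ab s t s0 (part_le pl) tT.
  apply: (@le_trans _ _ (B * k * c^-1 * (c^-1 * b))).
    by apply: ler_wpM2l kb; apply: mulr_ge0 => //; apply: mulr_ge0 => //; apply: ltW.
  have -> : B * k * c^-1 * (c^-1 * b) = k * (B * c^-1 * (c^-1 * b)) by ring.
  by rewrite /k mulrAC ler_pdivrMr // ler_wpM2l ?(ltW e0) // lerDl.
have [psi psiP] := sewing cw d0 (lexx 1) lipT close small.
have psiD s t x : 0 <= s -> s <= t -> t <= T -> psi s t x = x + psi s t 0.
  move=> s0 st tT; apply/eqP; rewrite -subr_eq0 -normr_le0.
  apply/ler_addgt0Pr => e e0; rewrite add0r.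
  have e2 : 0 < e / 2 by lra.
  have [l [pl fl lP]] := sewn_approx cw psiP [:: x; 0] s0 st tT e2.
  have := lP x; have := lP 0; rewrite !inE !eqxx orbT !compE => /(_ isT) + /(_ isT).
  rewrite !ler_norml => /andP[? ?] /andP[? ?]; apply/andP; split; lra.
exists (fun t => psi 0 t 0).
have dm s t : 0 <= s -> s <= t -> t <= T -> psi 0 t 0 - psi 0 s 0 = psi s t 0.
  move=> s0 st tT; rewrite -(sewn_flow cw d0 (lexx 1) lipT psiP 0 (lexx 0) s0 st tT).
  by rewrite psiD // addrAC subrr add0r.
split.
- by rewrite (sewn_id psiP).
- move=> s t s0 st tT; rewrite dm //.
  have ap e : 0 < e -> exists2 S, `|S - psi s t 0| <= e &
      c * S <= defect h s t <= L * S.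
    move=> e0; have [l [pl fl lP]] := sewn_approx cw psiP [:: 0] s0 st tT e0.
    exists (psum (defect h) s l); last exact: bnd.
    by have := lP 0 (mem_head _ _); rewrite compE add0r.
  apply/andP; split; apply/ler_addgt0Pr => e e0.
    have [S + /andP[h1 _]] := ap (e / c) (divr_gt0 e0 c0).
    rewrite ler_norml => /andP[h2 _].
    have : c * (psi s t 0 - S) <= e by rewrite mulrC -ler_pdivlMr //; lra.
    rewrite mulrBr; lra.
  have L0 : 0 < L by lra.
  have [S + /andP[_ h1]] := ap (e / L) (divr_gt0 e0 L0).
  rewrite ler_norml => /andP[_ h2].
  have : L * (S - psi s t 0) <= e by rewrite mulrC -ler_pdivlMr //; lra.
  rewrite mulrBr; lra.
- move=> s t s0 st tT wd; rewrite dm //; last exact: ltW.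
  by have := sewn_close cw close psiP 0 s0 st tT wd; rewrite /tr add0r.
Qed.

End defect_sewing.

(** * Uniqueness of the reflected path and of the pushing term *)

Section countable_cover.
Context {R : realType}.
Implicit Types (h : R -> R) (s t u v T : R).

Lemma itv_uncountable (a b : R) : a < b -> ~ countable `]a, b[%classic.
Proof.
move=> ab /countable_lebesgue_measure0 /eqP.
by rewrite lebesgue_measure_itv /= lte_fin ab -EFinB eqe subr_eq0 gt_eqF.
Qed.

(** The last time need not satisfy P, but by continuity h is close there to
    its values at times that satisfy P. *)
Lemma ucont_sup T h (P : R -> Prop) s t : ucont T h -> 0 <= s -> t <= T ->
  (exists2 r, s <= r <= t & P r) ->
  let r0 := sup [set r | s <= r <= t /\ P r] in
  [/\ s <= r0 <= t, forall r, r0 < r -> r <= t -> ~ P r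
    & forall e, 0 < e -> exists r, [/\ s <= r <= t, P r & `|h r0 - h r| <= e]].
Proof.
move=> uh s0 tT [r1 r1st Pr1]; set E := [set r | _]; move=> r0.
have hE : has_sup E.
  by split; [exists r1 | exists t => r [/andP[]]].
have r0st : s <= r0 <= t.
  apply/andP; split; last by apply: ge_sup; [exists r1 | move=> r [/andP[]]].
  have /andP[sr1 _] := r1st; apply: le_trans sr1 _.
  by apply: sup_upper_bound.
have /andP[sr0 r0t] := r0st.
split=> // [r r0r rt Pr|e e0].
  have : r <= r0 by apply: sup_upper_bound => //; split=> //; rewrite rt (le_trans sr0) // ltW.
  by rewrite leNgt r0r.
have [d d0 dP] := uh e e0.
have [r [rst Pr] rd] := sup_adherent d0 hE.
have rr0 : r <= r0 by apply: sup_upper_bound.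
exists r; split=> //; have /andP[sr rt] := rst; apply: dP => //.
- exact: le_trans sr.
- exact: le_trans tT.
- rewrite -/r0 in rd; lra.
Qed.

(** Otherwise every level v in ]h t, h s[ is reached for a last time tau v.
    Last times decrease when the level increases, so two of them in the same
    J k contradict monotonicity there; hence v |-> k injects an interval into
    the integers. *)
Lemma le_of_countable_cover T h (J : nat -> set R) : ucont T h ->
  `[0, T]%classic `<=` \bigcup_k J k ->
  (forall k u v, J k u -> J k v -> 0 <= u -> u <= v -> v <= T -> h u <= h v) ->
  forall s t, 0 <= s -> s <= t -> t <= T -> h s <= h t.
Proof.
move=> uh cov mono s t s0 st tT; rewrite leNgt; apply/negP => hts.
pose tau v := sup [set r | s <= r <= t /\ v <= h r].
have tauP v : h t < v -> v < h s -> [/\ s <= tau v <= t & h (tau v) = v].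
  move=> tv vs.
  have [|tst tau1 tau2] := @ucont_sup T h (fun r => v <= h r) s t uh s0 tT.
    by exists s; rewrite ?lexx ?st ?(ltW vs).
  rewrite -/(tau v) in tst tau1 tau2; split=> //.
  have /andP[st1 st2] := tst.
  apply/eqP; rewrite eq_le; apply/andP; split; last first.
    apply/ler_addgt0Pr => e e0; have [r [_ vr]] := tau2 e e0.
    rewrite ler_norml => /andP[? ?]; lra.
  have tt : tau v < t.
    rewrite lt_neqAle st2 andbT; apply/eqP => e.
    have e0 : 0 < (v - h t) / 2 by lra.
    have [r [_ vr]] := tau2 _ e0; rewrite e ler_norml => /andP[? ?]; lra.
  apply/ler_addgt0Pr => e e0; have [d d0 dP] := uh e e0.
  have [r [r1 r2 r3]] : exists r, [/\ tau v < r, r <= t & r - tau v < d].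
    have [td|td] := leP (t - tau v) (d / 2); first by exists t; split=> //; lra.
    by exists (tau v + d / 2); split; lra.
  have : h r < v by rewrite ltNge; apply/negP; exact: tau1.
  have := dP (tau v) r (le_trans s0 st1) (ltW r1) (le_trans r2 tT) r3.
  rewrite ler_norml => /andP[? ?]; lra.
have kex v : exists k, v \in `]h t, h s[ -> J k (tau v).
  have [vin|vout] := boolP (v \in `]h t, h s[); last by exists 0.
  move: (vin); rewrite in_itv /= => /andP[v1 v2].
  have [/andP[h1 h2] _] := tauP v v1 v2.
  have [|k _ Jk] := cov (tau v); last by exists k.
  by rewrite /= in_itv /= (le_trans s0 h1) (le_trans h2 tT).
have [k kP] := choice kex.
apply: (itv_uncountable hts); apply/countable_injP; exists k.
suff H v v' : v \in `]h t, h s[ -> v' \in `]h t, h s[ -> k v = k v' -> v <= v'.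
  move=> v v' /set_mem vin /set_mem vin' kv; apply/eqP; rewrite eq_le.
  by rewrite !H.
move=> vin vin' kv; rewrite leNgt; apply/negP => vv.
have J1 := kP v vin; have J2 := kP v' vin'; rewrite -kv in J2.
move: vin vin'; rewrite !in_itv /= => /andP[v1 v2] /andP[v'1 v'2].
have [/andP[a1 a2] e1] := tauP v v1 v2; have [/andP[b1 b2] e2] := tauP v' v'1 v'2.
have [tl|/ltW tl] := leP (tau v) (tau v').
  have := mono _ _ _ J1 J2 (le_trans s0 a1) tl (le_trans b2 tT).
  by rewrite e1 e2 leNgt vv.
have [|_ tau1 _] := @ucont_sup T h (fun r => v' <= h r) s t uh s0 tT.
  by exists s; rewrite ?lexx ?st ?(ltW v'2).
move: tl; rewrite le_eqVlt => /orP[/eqP e|tl].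
  by move: vv; rewrite -e1 -e2 e ltxx.
by apply: (tau1 _ tl) => //; rewrite e1 ltW.
Qed.

End countable_cover.

Section uniqueness.
Context {R : realType} {T : R} {w : R -> R -> R} (cw : clock T w).
Context {p : R} (p_gt0 : 0 < p) {mu phi : R -> R -> R -> R} {K B d c L M : R}.
Context (rf : rough_flow (T := T) (w := w) p mu phi K B d c L M).
Context (T_gt0 : 0 < T) (a : R) (a_ge0 : 0 <= a).
Implicit Types (s t u v x y : R) (l : seq R) (h m : R -> R).
Local Notation nu s t := (pth_root p (w s t)).
Local Notation defect := (defect (phi := phi)).
Local Notation reflected := (reflected (phi := phi) a).

(** The telescoping of psum_defect for steps whose defects are only known up
    to an error to be the increments of a nondecreasing m. *)
Lemma defect_bounds h m s t l : 0 <= s -> t <= T -> part s t l ->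
  (forall u v, s <= u -> u <= v -> v <= t -> m u <= m v) ->
  let r := psum (fun u v => `|defect h u v - (m v - m u)|) s l in
  - (L * r) <= defect h s t <= L * (m t - m s + r).
Proof.
have [[K0 B0 d0] [c0 L1 M0]] := rf_cst rf; have L0 : 0 <= L by lra.
elim: l s => [|v l IH] s s0 tT.
  move=> /andP[_ /eqP /= st] _; rewrite -st in tT *.
  by rewrite /defect (rf_id rf) // !subrr addr0 mulr0 oppr0 lexx.
rewrite part_cons => /andP[sv pl] mm; have vt := part_le pl.
have v0 : 0 <= v by apply: le_trans s0 (ltW sv).
have /= := IH v v0 tT pl (fun u u' vu => mm u u' (le_trans (ltW sv) vu)).
set r := psum _ v l => /andP[h1 h2].
have dm : m s <= m v := mm s v (lexx s) (ltW sv) vt.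
rewrite (defect_cat rf h s0 (ltW sv) vt tT).
set e := `|defect h s v - (m v - m s)|.
have e0 : 0 <= e by rewrite normr_ge0.
have : `|defect h s v - (m v - m s)| <= e by []; rewrite ler_norml => /andP[e1 e2].
have k1 : - (L * e) <= phi v t (h v) - phi v t (phi s v (h s)) <= L * (m v - m s + e).
    (* For a negative defect the two slope bounds exchange their roles. *)
  have [xy|/ltW xy] := leP (phi s v (h s)) (h v).
    have /andP[k1 k2] := rf_slopes rf v0 vt tT xy.
    rewrite -/(defect h s v) in k1 k2.
    have D0 : 0 <= defect h s v by rewrite subr_ge0.
    have : L * defect h s v <= L * (m v - m s + e) by rewrite ler_wpM2l //; lra.
    have : 0 <= c * defect h s v by rewrite mulr_ge0 // ltW.
    have : 0 <= L * e by rewrite mulr_ge0.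
    by move=> ? ? ?; apply/andP; split; lra.
  have /andP[k1 k2] := rf_slopes rf v0 vt tT xy.
  have D0 : phi s v (h s) - h v = - defect h s v by rewrite /defect opprB.
  rewrite D0 in k1 k2.
  have n0 : 0 <= - defect h s v by rewrite -D0 subr_ge0.
  have : L * - defect h s v <= L * e by rewrite ler_wpM2l //; lra.
  have : 0 <= c * - defect h s v by rewrite mulr_ge0 // ltW.
  have : 0 <= L * (m v - m s + e) by rewrite mulr_ge0 //; lra.
  by move=> ? ? ?; apply/andP; split; lra.
move: k1 => /andP[k1 k2]; apply/andP; split.
  rewrite mulrDr; lra.
rewrite (_ : L * _ = L * (m v - m s + e) + L * (m t - m v + r)); first by lra.
by ring.
Qed.

Lemma flow_pull_ucont h t : ucont T h -> 0 <= t -> t <= T ->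
  ucont t (fun r => phi r t (h r)).
Proof.
have [[K0 B0 d0] [c0 L1 M0]] := rf_cst rf; have L0 : 0 < L by lra.
move=> uh t0 tT e e0.
have e1 : 0 < e / (2 * L) by rewrite divr_gt0 // mulr_gt0.
have [d1 d1_gt0 d1P] := uh _ e1.
have B1 : 0 < B + 1 by lra.
have [d2 d2_gt0 d2P] := pth_root_small p_gt0 (divr_gt0 e1 B1).
have dd : 0 < Num.min d2 d by rewrite lt_min d2_gt0 d0.
have [d3 d3_gt0 d3P] := clock_reg cw dd.
exists (Num.min d1 d3); first by rewrite lt_min d1_gt0.
move=> u v u0 uv vt; rewrite lt_min => /andP[uv1 uv3].
have v0 := le_trans u0 uv; have vT := le_trans vt tT.
have := d3P u v u0 uv vT uv3; rewrite lt_min => /andP[/ltW w2 /ltW wd].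
rewrite -(rf_flow rf (h u) u0 uv vt tT).
apply: le_trans (slopes_lip _ _ (ltW c0) (rf_slopes rf v0 vt tT)) _.
rewrite -ler_pdivlMl // (_ : L^-1 * e = e / (2 * L) + e / (2 * L)); last first.
  by field; rewrite gt_eqF.
rewrite (_ : h v - _ = (h v - h u) - (phi u v (h u) - h u)); last by ring.
apply: le_trans (ler_normB _ _) _; rewrite lerD //; first exact: d1P.
have [/(_ (h u)) h1 _] := rf_near rf u0 uv vT wd.
apply: le_trans h1 _.
have := d2P _ (clock_ge0 cw u0 uv vT) w2; rewrite ler_pdivlMr //.
have := pth_root_ge0 p (w u v); lra.
Qed.

(** What the equation gives on each interval of a covering on which its
    remainder has finite (p/3)-variation. *)
Definition sewn_locally h m (J : set R) := forall s t e, J s -> J t ->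
  0 <= s -> s < t -> t <= T -> 0 < e -> exists l, [/\ part s t l, mesh w e s l &
    psum (fun u v => `|defect h u v - (m v - m u)|) s l <= e].

Context (h m : R -> R) (J : nat -> set R).
Context (uh : ucont T h) (um : ucont T m).
Context (m_mono : forall u v, 0 <= u -> u <= v -> v <= T -> m u <= m v).
Context (covJ : `[0, T]%classic `<=` \bigcup_k J k).
Context (locJ : forall k, sewn_locally h m (J k)).

Lemma local_defect k s t : J k s -> J k t -> 0 <= s -> s <= t -> t <= T ->
  0 <= defect h s t <= L * (m t - m s).
Proof.
have [[K0 B0 d0] [c0 L1 M0]] := rf_cst rf; have L0 : 0 < L by lra.
move=> Js Jt s0; rewrite le_eqVlt => /orP[/eqP <- sT|st tT].
  by rewrite /defect (rf_id rf) // !subrr mulr0 lexx.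
have mm u v : s <= u -> u <= v -> v <= t -> m u <= m v.
  by move=> su uv vt; apply: m_mono => //; [apply: le_trans su | apply: le_trans tT].
apply/andP; split; apply/ler_addgt0Pr => e e0.
all: have eL : 0 < e / L by rewrite divr_gt0.
all: have [l [pl _ lP]] := locJ Js Jt s0 st tT eL.
all: have /= := defect_bounds h s0 tT pl mm; set r := psum _ s l => /andP[h1 h2].
all: have : L * r <= e by rewrite mulrC -ler_pdivlMr.
  lra.
move: h2; rewrite mulrDr; lra.
Qed.

(** Applied to r |-> phi_rt(h r), whose increments are the defects of h
    carried to time t, the covering lemma turns the bounds on each J k into bounds
    on [0, T]. *)
Lemma global_defect s t : 0 <= s -> s <= t -> t <= T ->
  0 <= defect h s t <= L * (L * (m t - m s)).
Proof.
have [[K0 B0 d0] [c0 L1 M0]] := rf_cst rf; have L0 : 0 < L by lra.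
move=> s0 st tT; have t0 := le_trans s0 st.
pose g r := phi r t (h r).
have ug : ucont t g by exact: flow_pull_ucont.
have covt : `[0, t]%classic `<=` \bigcup_k J k.
  move=> r /= rt; apply: covJ; move: rt; rewrite /= !in_itv /= => /andP[-> rt].
  exact: le_trans tT.
have gt : g t - g s = defect h s t by rewrite /g /defect (rf_id rf).
have loc k u v : J k u -> J k v -> 0 <= u -> u <= v -> v <= t ->
    0 <= g v - g u <= L * (L * (m v - m u)).
  move=> Ju Jv u0 uv vt; have vT := le_trans vt tT; have v0 := le_trans u0 uv.
  have /andP[D0 D1] := local_defect Ju Jv u0 uv vT.
  rewrite /g -(rf_flow rf (h u) u0 uv vt tT).
  have xy : phi u v (h u) <= h v by rewrite -subr_ge0.
  have /andP[k1 k2] := rf_slopes rf v0 vt tT xy.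
  apply/andP; split; first by apply: le_trans k1; rewrite mulr_ge0 // ltW.
  by apply: le_trans k2 _; rewrite ler_wpM2l // ltW.
rewrite -gt; apply/andP; split.
  rewrite subr_ge0; apply: (le_of_countable_cover ug covt) => // k u v Ju Jv u0 uv vt.
  by have /andP[+ _] := loc k u v Ju Jv u0 uv vt; rewrite subr_ge0.
have ug2 : ucont t (fun r => L * (L * m r) - g r).
  move=> e e0.
  have e1 : 0 < e / 2 / (L * L) by rewrite !divr_gt0 // mulr_gt0.
  have e2 : 0 < e / 2 by lra.
  have [d1 d1_gt0 d1P] := um e1; have [d2 d2_gt0 d2P] := ug _ e2.
  exists (Num.min d1 d2); first by rewrite lt_min d1_gt0.
  move=> u v u0 uv vt; rewrite lt_min => /andP[uv1 uv2].
  have := d1P u v u0 uv (le_trans vt tT) uv1; rewrite ler_pdivlMr ?mulr_gt0 // => k1.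
  have k2 := d2P u v u0 uv vt uv2.
  rewrite (_ : _ - _ - _ = (m v - m u) * (L * L) - (g v - g u)); last by ring.
  apply: le_trans (ler_normB _ _) _; rewrite normrM (@ger0_norm _ (L * L)) ?mulr_ge0 ?(ltW L0) //.
  lra.
suff : L * (L * m s) - g s <= L * (L * m t) - g t by rewrite !mulrBr; lra.
apply: (le_of_countable_cover ug2 covt) => // k u v Ju Jv u0 uv vt.
have /andP[_ +] := loc k u v Ju Jv u0 uv vt; rewrite !mulrBr; lra.
Qed.

(** On each J k both m and m2 are the limits of the same sums of defects, so
    m - m2 is constant there. *)
Lemma unique_push m2 : ucont T m2 ->
  (forall e, 0 < e -> exists2 d1 : R, 0 < d1 & forall s t l, 0 <= s -> t <= T ->
    part s t l -> mesh w d1 s l ->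
    psum (fun u v => `|defect h u v - (m2 v - m2 u)|) s l <= e) ->
  forall t, 0 <= t -> t <= T -> m t - m 0 = m2 t - m2 0.
Proof.
move=> um2 sew2 t t0 tT.
have loc k u v : J k u -> J k v -> 0 <= u -> u <= v -> v <= T ->
    m v - m u = m2 v - m2 u.
  move=> Ju Jv u0; rewrite le_eqVlt => /orP[/eqP <- _|uv vT]; first by rewrite !subrr.
  apply/eqP; rewrite -subr_eq0 -normr_le0; apply/ler_addgt0Pr => e e0; rewrite add0r.
  have e2 : 0 < e / 2 by lra.
  have [d1 d1_gt0 d1P] := sew2 _ e2.
  have e3 : 0 < Num.min (e / 2) d1 by rewrite lt_min e2.
  have [l [pl fl lP]] := locJ Ju Jv u0 uv vT e3.
  have := d1P u v l u0 vT pl; rewrite (mesh_le _ fl) ?ge_min ?lexx ?orbT // => /(_ isT) k2.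
  have k1 : psum (fun u v => `|defect h u v - (m v - m u)|) u l <= e / 2.
    by apply: le_trans lP _; rewrite ge_min lexx.
  have -> : e = e / 2 + e / 2 by lra.
  apply: le_trans (lerD k1 k2); rewrite -psumD.
  rewrite -(psum_delta1 m pl) -(psum_delta1 m2 pl) /delta1.
  elim: l u {Ju u0 uv pl fl lP k1 k2} => [|x l IH] u /=; first by rewrite subrr normr0.
  rewrite (_ : _ - _ = ((m x - m u) - (m2 x - m2 u)) +
    (psum (delta1 m) x l - psum (delta1 m2) x l)); last by rewrite /delta1; ring.
  apply: le_trans (ler_normD _ _) _; rewrite lerD //.
  rewrite (_ : _ - _ = (defect h u x - (m2 x - m2 u)) - (defect h u x - (m x - m u))); last by ring.
  by apply: le_trans (ler_normB _ _) _; rewrite addrC.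
have uD (g1 g2 : R -> R) : ucont T g1 -> ucont T g2 -> ucont T (fun r => g1 r - g2 r).
  move=> u1 u2 e e0; have e2 : 0 < e / 2 by lra.
  have [d1 d1_gt0 d1P] := u1 _ e2; have [d2 d2_gt0 d2P] := u2 _ e2.
  exists (Num.min d1 d2); first by rewrite lt_min d1_gt0.
  move=> u v u0 uv vT; rewrite lt_min => /andP[uv1 uv2].
  rewrite (_ : _ - _ - _ = (g1 v - g1 u) - (g2 v - g2 u)); last by ring.
  apply: le_trans (ler_normB _ _) _.
  have := d1P u v u0 uv vT uv1; have := d2P u v u0 uv vT uv2; lra.
have h1 := le_of_countable_cover (uD _ _ um um2) covJ _ (lexx 0) t0 tT.
have h2 := le_of_countable_cover (uD _ _ um2 um) covJ _ (lexx 0) t0 tT.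
have {}h1 : m 0 - m2 0 <= m t - m2 t.
  by apply: h1 => k u v Ju Jv u0 uv vT; have := loc k u v Ju Jv u0 uv vT; lra.
have {}h2 : m2 0 - m 0 <= m2 t - m t.
  by apply: h2 => k u v Ju Jv u0 uv vT; have := loc k u v Ju Jv u0 uv vT; lra.
by apply/eqP; rewrite eq_le; apply/andP; split; lra.
Qed.

Context (h_ge0 : forall t, 0 <= t -> t <= T -> 0 <= h t) (h0 : h 0 = a).
Context (m_flat : forall s t, 0 <= s -> s <= t -> t <= T ->
  (forall r, s < r -> r <= t -> 0 < h r) -> m s = m t).

(** A path that dominates the flow dominates every flow line in Skorokhod's
    formula; and it follows the flow after its last zero, or from the start if
    it has none. *)
Lemma unique_path t : 0 <= t -> t <= T -> h t = reflected t.
Proof.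
move=> t0 tT; have ge s : 0 <= s -> s <= t -> phi s t (h s) <= h t.
  by move=> s0 st; have /andP[+ _] := global_defect s0 st tT; rewrite subr_ge0.
have eq s : 0 <= s -> s <= t -> (forall r, s < r -> r <= t -> 0 < h r) ->
    h t = phi s t (h s).
  move=> s0 st pos; have := global_defect s0 st tT.
  rewrite (m_flat s0 st tT pos) subrr !mulr0 => /andP[? ?].
  by apply/eqP; rewrite -subr_eq0 -/(defect h s t) eq_le; apply/andP.
apply/eqP; rewrite eq_le; apply/andP; split; last first.
  apply: ge_sup; first by exists (phi 0 t a); left.
  move=> z [->|[s /andP[s0 st] ->]]; first by rewrite -h0 ge.
  apply: le_trans (ge s s0 st); apply: (flow_mono rf) => //.
  by apply: h_ge0 => //; apply: le_trans tT.
have [|ht] := leP (h t) 0.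
  by move=> /le_trans; apply; apply: (reflected_ge0 rf).
have ub z : reflected_set (phi := phi) a t z -> z <= reflected t.
  exact: (reflected_ub rf).
have [ex|nex] := pselect (exists2 r, 0 <= r <= t & h r <= 0); last first.
  rewrite (eq 0) // => [|r r0 rt]; first by apply: ub; left; rewrite h0.
  by rewrite ltNge; apply/negP => hr; apply: nex; exists r => //; rewrite rt ltW.
have [/andP[s0 st] pos near] := @ucont_sup _ T h (fun r => h r <= 0) 0 t uh (lexx 0) tT ex.
set s := sup _ in s0 st pos near.
have hs : h s = 0.
  apply/eqP; rewrite eq_le h_ge0 ?(le_trans st) // andbT.
  apply/ler_addgt0Pr => e e0; have [r [_ hr]] := near e e0.
  rewrite ler_norml => /andP[? ?]; lra.
rewrite (eq s) //; last by move=> r sr rt; rewrite ltNge; apply/negP; exact: pos.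
by apply: ub; right; exists s; rewrite ?s0 // hs.
Qed.

End uniqueness.

(** * Variation norms and controls *)

Section variation_sums.
Context {R : realType} {E : normedModType R}.
Implicit Types (s t u v e T q : R) (l : seq R) (g : R -> R -> E) (I : set R).

Definition powsum q g := psum (fun u v => `|g u v| `^ q).

Lemma var_sumE q g s l : var_sum q g (s :: l) = powsum q g s l.
Proof.
rewrite /var_sum /=; elim: l s => [|v l IH] s; first by rewrite big_geq.
by rewrite /= big_nat_recl //=; congr (_ + _); exact: IH.
Qed.

Lemma part_is_partition s t l : part s t l -> is_partition `[s, t] (s :: l).
Proof.
move=> pl; have st := part_le pl; have /andP[pth /eqP lt] := pl.
split=> // [x /=|x].
  rewrite inE in_itv /= => /predU1P[->|/(part_mem pl)[/ltW -> -> //]].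
  by rewrite lexx st.
case=> /=; rewrite in_itv /= => /andP[sx xt] [lb|ub].
  have : x <= s by apply: lb; rewrite /= in_itv /= lexx st.
  by move=> xs; rewrite inE (eq_le x s) xs sx.
have : t <= x by apply: ub; rewrite /= in_itv /= lexx st.
move=> tx; have -> : x = t by apply/eqP; rewrite eq_le tx xt.
by rewrite -lt mem_last.
Qed.

Lemma powsum_ge0 q g s t l : part s t l -> 0 <= powsum q g s l.
Proof. by apply: psum_ge0 => *; exact: powR_ge0. Qed.

Lemma var_norm_ge q g s t l : part s t l ->
  (((powsum q g s l) `^ q^-1)%:E <= var_norm q `[s, t] g)%E.
Proof.
move=> pl; apply: ereal_sup_ubound; exists (s :: l).
  exact: part_is_partition.
by rewrite var_sumE.
Qed.

Lemma var_norm_itv q g s t : s <= t -> var_norm q `[s, t] g \in `[0%E, +oo%E].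
Proof.
move=> st; have [l pl] : exists l, part s t l.
  move: st; rewrite le_eqVlt => /orP[/eqP <-|/part1]; last by exists [:: t].
  by exists [::]; rewrite part_nil.
rewrite in_itv /= leey andbT; apply: le_trans (var_norm_ge q g pl).
by rewrite lee_fin powR_ge0.
Qed.

Lemma powsum_control q g s t l : 0 < q -> part s t l ->
  ((powsum q g s l)%:E <= var_control q g s t)%E.
Proof.
move=> q0 pl; have p0 := powsum_ge0 q g pl.
have /(gt0_ler_poweR (ltW q0)) := var_norm_ge q g pl.
rewrite poweR_EFin -powRrM mulVf ?gt_eqF // powRr1 //; apply.
  by rewrite in_itv /= leey andbT lee_fin powR_ge0.
exact: var_norm_itv (part_le pl).
Qed.

Lemma regular_powsum q I g : 0 < q -> regular I (var_control q g) ->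
  forall e, 0 < e -> exists2 d : R, 0 < d & forall s t l, I s -> I t ->
    t - s < d -> part s t l -> powsum q g s l < e.
Proof.
move=> q0 reg e e0; have [d d0 dP] := reg e e0; exists d => // s t l Is It std pl.
have := dP s t Is It (part_le pl) std; rewrite -lte_fin; apply: le_lt_trans.
exact: powsum_control.
Qed.

Lemma V2_bounded q T g : 0 < q -> V2 q `[0, T] g ->
  exists2 b : R, 0 <= b & forall s t l, 0 <= s -> t <= T -> part s t l ->
    powsum q g s l <= b.
Proof.
move=> q0 [vb _].
have vc : (var_control q g 0 T < +oo)%E by rewrite /var_control poweR_lty.
have [T0|T0] := ltP T 0.
  exists 0 => // s t l s0 tT pl; have := part_le pl; lra.
have vc0 : (0 <= var_control q g 0 T)%E by rewrite /var_control poweR_ge0.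
exists (fine (var_control q g 0 T)); first by rewrite fine_ge0.
move=> s t l s0 tT pl; have st := part_le pl.
have bnd l' : part 0 T l' -> powsum q g 0 l' <= fine (var_control q g 0 T).
  move=> pl'; rewrite -lee_fin fineK ?ge0_fin_numE //.
  exact: powsum_control.
have [a pa] : exists a, part 0 s a.
  move: s0; rewrite le_eqVlt => /orP[/eqP <-|/part1]; last by exists [:: s].
  by exists [::]; rewrite part_nil.
have [b pb] : exists b, part t T b.
  move: tT; rewrite le_eqVlt => /orP[/eqP <-|/part1]; last by exists [:: T].
  by exists [::]; rewrite part_nil.
apply: le_trans (bnd _ (part_cat (part_cat pa pl) pb)).
have /andP[_ /eqP la] := pa; have /andP[_ /eqP ll] := pl.
rewrite /powsum !psum_cat last_cat la ll -addrA addrCA lerDl.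
rewrite addr_ge0 //; [exact: powsum_ge0 pa | exact: powsum_ge0 pb].
Qed.

(** Only partitions of closed intervals enter, so that superadditivity is
    concatenation of partitions. *)
Definition pvar q g s t : R := sup [set powsum q g s l | l in part s t].

Section pvar_theory.
Context (q T : R) (g : R -> R -> E) (q_gt0 : 0 < q) (gV : V2 q `[0, T] g).

Lemma pvar_has_sup s t : 0 <= s -> s <= t -> t <= T ->
  has_sup [set powsum q g s l | l in part s t].
Proof.
move=> s0 st tT; have [b b0 bP] := V2_bounded q_gt0 gV; split.
  move: st; rewrite le_eqVlt => /orP[/eqP <-|st].
    by exists 0, [::] => //; exact: part_nil.
  by exists (powsum q g s [:: t]), [:: t] => //; exact: part1.
by exists b => _ [l pl <-]; apply: bP pl.
Qed.

Lemma powsum_pvar s t l : 0 <= s -> t <= T -> part s t l ->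
  powsum q g s l <= pvar q g s t.
Proof.
move=> s0 tT pl; apply: sup_upper_bound; last by exists l.
exact: pvar_has_sup (part_le pl) tT.
Qed.

Lemma pvar_ge s t : 0 <= s -> s < t -> t <= T -> `|g s t| `^ q <= pvar q g s t.
Proof.
move=> s0 st tT; have := powsum_pvar s0 tT (part1 st).
by rewrite /powsum /= addr0.
Qed.

Lemma pvar_add s u t : 0 <= s -> s <= u -> u <= t -> t <= T ->
  pvar q g s u + pvar q g u t <= pvar q g s t.
Proof.
move=> s0 su ut tT; have u0 := le_trans s0 su; have uT := le_trans ut tT.
apply/ler_addgt0Pr => e e0; have e2 : 0 < e / 2 by lra.
have [_ [l pl <-] l1] := sup_adherent e2 (pvar_has_sup s0 su uT).
have [_ [l' pl' <-] l2] := sup_adherent e2 (pvar_has_sup u0 ut tT).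
have := powsum_pvar s0 tT (part_cat pl pl').
have /andP[_ /eqP el] := pl; rewrite /powsum psum_cat el -/(powsum q g).
rewrite -/(pvar q g s u) -/(pvar q g u t) in l1 l2.
rewrite -/(powsum q g s l) -/(powsum q g u l'); lra.
Qed.

Lemma pvar_ge0 s t : 0 <= s -> s <= t -> t <= T -> 0 <= pvar q g s t.
Proof.
move=> s0 st tT; have [[_ [l pl _]] _] := pvar_has_sup s0 st tT.
exact: le_trans (powsum_ge0 q g pl) (powsum_pvar s0 tT pl).
Qed.

Lemma pvar_reg e : 0 < e -> exists2 d : R, 0 < d & forall s t, 0 <= s -> s <= t ->
  t <= T -> t - s < d -> pvar q g s t < e.
Proof.
move=> e0; have e2 : 0 < e / 2 by lra.
have [d d0 dP] := regular_powsum q_gt0 (proj2 gV) e2; exists d => // s t s0 st tT std.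
apply: (@le_lt_trans _ _ (e / 2)); last by lra.
apply: ge_sup => [|_ [l pl <-]]; first by have [] := pvar_has_sup s0 st tT.
apply/ltW; apply: (dP _ _ _ _ _ std pl); rewrite /= in_itv /=.
  by rewrite s0 (le_trans st).
by rewrite tT (le_trans s0).
Qed.

End pvar_theory.

Lemma V2_of_clock q T (W : R -> R -> R) g (al be : R) : clock T W -> 0 < q ->
  0 <= al -> al <= be -> be <= T ->
  (forall s t, al <= s -> s < t -> t <= be -> `|g s t| `^ q <= W s t) ->
  V2 q `[al, be] g.
Proof.
move=> cW q0 al0 ab bT gW.
have key s t : al <= s -> s <= t -> t <= be ->
    (var_norm q `[s, t] g <= ((W s t) `^ q^-1)%:E)%E.
  move=> als st tbe; have s0 := le_trans al0 als; have tT := le_trans tbe bT.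
  apply: ge_ereal_sup => _ [pi [srt sub _] <-]; rewrite lee_fin.
  apply: ge0_ler_powR; rewrite ?nnegrE ?invr_ge0 ?(ltW q0) ?(clock_ge0 cW) //.
    by apply: sumr_ge0 => i _; exact: powR_ge0.
  case: pi srt sub => [_ _|x l srt sub].
    by rewrite /var_sum /= big_geq // (clock_ge0 cW).
  rewrite var_sumE.
  have px : part x (last x l) l by rewrite /part eqxx andbT.
  have := sub x (mem_head _ _); rewrite /= in_itv /= => /andP[sx xt].
  have := sub (last x l) (mem_last _ _); rewrite /= in_itv /= => /andP[sl lt].
  apply: (@le_trans _ _ (psum W x l)).
    apply: le_psum px => u v xu uv vl; apply: gW => //.
      exact: le_trans (le_trans als sx) xu.
    exact: le_trans (le_trans vl lt) tbe.
  apply: le_trans (psum_clock cW _ _ px) _; [exact: le_trans sx|exact: le_trans tT|].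
  by apply: (clock_mono cW) => //; exact: part_le px.
split.
  by apply: le_lt_trans (key al be (lexx _) ab (lexx _)) _; rewrite ltry.
move=> e e0; have [d d0 dP] := clock_reg cW e0; exists d => // s t.
rewrite /= !in_itv /= => /andP[als sbe] /andP[alt tbe] st std.
have s0 := le_trans al0 als; have tT := le_trans tbe bT.
have W0 := clock_ge0 cW s0 st tT.
apply: (@le_lt_trans _ _ (W s t)%:E); last by rewrite lte_fin dP.
rewrite /var_control.
have -> : (W s t)%:E = (((W s t) `^ q^-1)%:E `^ q)%E.
  by rewrite poweR_EFin -powRrM mulVf ?gt_eqF // powRr1.
apply: gt0_ler_poweR (ltW q0) _ _ _ _ (key s t als st tbe).
  exact: var_norm_itv.
by rewrite in_itv /= leey andbT lee_fin powR_ge0.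
Qed.

End variation_sums.

(** * Stieltjes measures carried by a zero set *)

Section stieltjes.
Context {R : realType}.
Implicit Types (y G : R -> R).

Lemma stieltjes_itvoc (F : cumulative R R) (u v : R) : u <= v ->
  lebesgue_stieltjes_measure F `]u, v]%classic = (F v - F u)%:E.
Proof.
move=> uv; rewrite /lebesgue_stieltjes_measure /= /measure_extension /=.
rewrite measurable_mu_extE //=; last exact: is_ocitv.
by rewrite wlength_itv_bnd.
Qed.

Lemma stieltjes_measure G : {homo G : u v / u <= v} -> continuous G ->
  exists mu : {measure set (measurableTypeR R) -> \bar R},
    forall u v, u <= v -> mu `]u, v]%classic = (G v - G u)%:E.
Proof.
move=> Gmono Gcont.
pose build := isCumulative.Build R _ R G Gmono (right_continuousW Gcont).
pose F : cumulative R R := HB.pack G build.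
by exists (lebesgue_stieltjes_measure F) => u v; exact: stieltjes_itvoc.
Qed.

(** The set where y does not vanish is covered by the countably many
    intervals with rational endpoints on which y does not vanish, and G is
    constant on each of them. *)
Lemma stieltjes_carried_by_zeros y G : {homo G : u v / u <= v} -> continuous G ->
  continuous y -> (forall u v, u <= v -> v <= 0 -> G u = G v) -> G 0 = 0 ->
  (forall u v, u <= v -> (forall x, u <= x <= v -> y x != 0) -> G u = G v) ->
  exists mu : {measure set (measurableTypeR R) -> \bar R},
    (forall t, 0 <= t -> mu `[0, t]%classic = (G t)%:E) /\
    (forall t, 0 <= t -> (G t)%:E =
      (\int[mu]_(u in `[0%R, t]) (\1_[set v | y v = 0%R] u)%:E)%E).
Proof.
move=> Gmono Gcont ycont Gneg G0 Gflat.
have [mu muE] := stieltjes_measure Gmono Gcont; exists mu.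
have mu0 t : 0 <= t -> mu `[0, t]%classic = (G t)%:E.
  move=> t0; have e1 : mu `](-1), t]%classic = (G t)%:E.
    rewrite muE; last by lra.
    by rewrite (Gneg (-1) 0) ?G0 ?subr0 // lerN10.
  have e2 : mu `](-1), 0]%classic = 0%E.
    rewrite muE; last by lra.
    by rewrite (Gneg (-1) 0) ?subrr // lerN10.
  apply/eqP; rewrite eq_le; apply/andP; split.
    rewrite -e1; apply: le_measure; rewrite ?inE; [exact: measurable_itv..|].
    by move=> x /=; rewrite !in_itv /= => /andP[x0 ->]; rewrite andbT; lra.
  have -> : (G t)%:E = mu (`](-1), 0] `|` `[0, t])%classic.
    rewrite -e1; congr (mu _); apply/seteqP; split=> x /=; rewrite !in_itv /=.
      by move=> /andP[h1 h2]; have [x0|x0] := leP x 0; [left|right]; rewrite ?h1 ?h2 ?(ltW x0).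
    by move=> [/andP[h1 h2]|/andP[h1 h2]]; apply/andP; split=> //; lra.
  apply: (le_trans (measureU2 _ _ _)); [exact: measurable_itv..|].
  by rewrite [X in (X + _)%E](_ : _ = 0%E) ?add0e.
split=> // t t0.
have mA : measurable ([set v | y v = 0] : set (measurableTypeR R)).
  apply: (@measurable_realfun.closed_measurable R).
  apply: (@preimage_closed _ _ y [set x | x = 0]); last exact: closed_eq.
  by move=> x _; exact: ycont.
have mI : measurable (`[0, t]%classic : set (measurableTypeR R)) by exact: measurable_itv.
rewrite integral_indic // -mu0 // setIC.
rewrite (measureDI mu mI mA) [X in (X + _)%E](_ : _ = 0%E) ?add0e //.
suff [B [mB B0 subB]] : mu.-negligible (`[0, t]%classic `\` [set v | y v = 0]).
  apply/eqP; rewrite eq_le measure_ge0 andbT -B0; apply: le_measure; rewrite ?inE //.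
  exact: measurableD.
pose P (rq : rat * rat) := `[< ratr rq.1 <= ratr rq.2 :> R /\
  forall x : R, ratr rq.1 <= x <= ratr rq.2 -> y x != 0 >].
pose F n : set (measurableTypeR R) := if unpickle n is Some rq then
  if P rq then `](ratr rq.1), (ratr rq.2)]%classic else set0 else set0.
apply: (@negligibleS _ _ _ mu (\bigcup_n F n)); last first.
  apply: negligible_bigcup => n; rewrite /F; case: unpickle => [rq|]; last exact: negligible_set0.
  have [/asboolP[rq1 rq2]|_] := boolP (P rq); last exact: negligible_set0.
  exists `](ratr rq.1), (ratr rq.2)]%classic; split=> //.
  by rewrite muE // (Gflat _ _ rq1 rq2) subrr.
move=> x [_ /eqP yx].
have /cvgrPdist_lt /(_ `|y x|) := ycont x; rewrite normr_gt0 => /(_ yx).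
move=> [e /= e0 eP].
have [|r rP] := @rat_in_itvoo R (x - e) x; first by rewrite ltrBlDr ltrDl.
have [|q qP] := @rat_in_itvoo R x (x + e); first by rewrite ltrDl.
move: rP qP; rewrite !in_itv /= => /andP[r1 r2] /andP[q1 q2].
have PT : P (r, q).
  apply/asboolP; split; first by apply: ltW; apply: lt_trans q1.
  move=> z /andP[/= rz zq]; apply/eqP => yz.
  have : `|y x - y z| < `|y x|.
    by apply: eP; rewrite /= ltr_norml; apply/andP; split; lra.
  by rewrite yz subr0 ltxx.
have FE : F (pickle (r, q)) = `](ratr r), (ratr q)]%classic by rewrite /F pickleK PT.
exists (pickle (r, q)); first exact: I.
by rewrite FE /= in_itv /= r2 ltW.
Qed.

End stieltjes.

(** * Solutions of the reflected equation *)

Section clocks.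
Context {R : realType}.
Implicit Types (s t u v e T q p : R) (w : R -> R -> R).

Lemma clock_scale T w (C : R) : 1 <= C -> clock T w -> clock T (fun s t => C * w s t).
Proof.
move=> C1 cw; split=> [s t s0 st tT|s u t s0 su ut tT|e e0].
- apply: le_trans (clock_len cw s0 st tT) _.
  by rewrite ler_peMl // (clock_ge0 cw).
- rewrite -mulrDr ler_wpM2l ?(clock_add cw) //; lra.
- have C0 : 0 < C by lra.
  have [d d0 dP] := clock_reg cw (divr_gt0 e0 C0); exists d => // s t s0 st tT std.
  by rewrite mulrC -ltr_pdivlMr // dP.
Qed.

Lemma clock_push T w (m : R -> R) : clock T w -> ucont T m ->
  (forall s t, 0 <= s -> s <= t -> t <= T -> m s <= m t) ->
  clock T (fun s t => w s t + (m t - m s)).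
Proof.
move=> cw um mm; split=> [s t s0 st tT|s u t s0 su ut tT|e e0].
- have := clock_len cw s0 st tT; have := mm s t s0 st tT; lra.
- have := clock_add cw s0 su ut tT; lra.
- have e2 : 0 < e / 2 by lra.
  have [d d0 dP] := clock_reg cw e2; have [d' d'0 d'P] := um _ e2.
  exists (Num.min d d'); first by rewrite lt_min d0.
  move=> s t s0 st tT; rewrite lt_min => /andP[h1 h2].
  have := dP s t s0 st tT h1; have := d'P s t s0 st tT h2.
  rewrite ler_norml => /andP[_ ?] ?; lra.
Qed.

Lemma pth_root_half p (x : R) : 0 < p -> 0 <= x -> pth_root p (x `^ (p / 2)) ^+ 2 = x.
Proof.
move=> p0 x0; rewrite /pth_root -powRrM -powR_mulrn ?powR_ge0 // -powRrM.
have -> : p / 2 * p^-1 * 2 = 1 by field; rewrite gt_eqF.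
by rewrite powRr1.
Qed.

Lemma pth_root_third p (x : R) : 0 < p -> 0 <= x -> pth_root p (x `^ (p / 3)) ^+ 3 = x.
Proof.
move=> p0 x0; rewrite /pth_root -powRrM -powR_mulrn ?powR_ge0 // -powRrM.
have -> : p / 3 * p^-1 * 3 = 1 by field; rewrite gt_eqF.
by rewrite powRr1.
Qed.

Lemma pth_root_powK p (x : R) : 0 < p -> 0 <= x -> (pth_root p x) `^ p = x.
Proof. by move=> p0 x0; rewrite /pth_root -powRrM mulVf ?gt_eqF // powRr1. Qed.

Lemma V1_ucont q T (h : R -> R) : 0 < q -> V1 q `[0, T] h -> ucont T h.
Proof.
move=> q0 [_ reg] e e0.
have [d d0 dP] := regular_powsum q0 reg (powR_gt0 q e0); exists d => // s t s0 st tT std.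
move: st; rewrite le_eqVlt => /orP[/eqP ->|st]; first by rewrite subrr normr0 ltW.
have := dP s t [:: t] _ _ std (part1 st).
rewrite /= !in_itv /= s0 (le_trans (ltW st) tT) tT (le_trans s0 (ltW st)).
move=> /(_ isT isT); rewrite /powsum /= addr0 /delta1 => h1.
rewrite leNgt; apply/negP => h2; move: h1; apply/negP; rewrite -leNgt.
by apply: ge0_ler_powR; rewrite ?nnegrE ?(ltW q0) ?(ltW e0) // ltW.
Qed.

End clocks.

Section driver_clock.
Context {R : realType} {N : nat}.

Lemma rough_path_clock (p T : R) (X1 : R -> R -> 'rV[R]_N) (X2 : R -> R -> 'M[R]_N) :
  0 < p -> rough_path p T X1 X2 -> exists w : R -> R -> R, [/\ clock T w,
  (forall (s t : R) i, 0 <= s -> s < t -> t <= T ->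
    `|X1 s t ord0 i| <= pth_root p (w s t)) &
  (forall (s t : R) i j, 0 <= s -> s < t -> t <= T ->
    `|X2 s t i j| <= pth_root p (w s t) ^+ 2)].
Proof.
move=> p0 [V1X V2X _]; have p2 : 0 < p / 2 by rewrite divr_gt0.
pose w s t := (t - s) + (pvar p X1 s t + pvar (p / 2) X2 s t); exists w.
have P1 s t : 0 <= s -> s <= t -> t <= T -> 0 <= pvar p X1 s t by exact: pvar_ge0.
have P2 s t : 0 <= s -> s <= t -> t <= T -> 0 <= pvar (p / 2) X2 s t by exact: pvar_ge0.
split.
- split=> [s t s0 st tT|s u t s0 su ut tT|e e0].
  + have := P1 s t s0 st tT; have := P2 s t s0 st tT; rewrite /w; lra.
  + have := pvar_add p0 V1X s0 su ut tT; have := pvar_add p2 V2X s0 su ut tT.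
    rewrite /w; move: (pvar p X1 s u) (pvar p X1 u t) (pvar p X1 s t).
    move: (pvar (p / 2) X2 s u) (pvar (p / 2) X2 u t) (pvar (p / 2) X2 s t).
    by move=> *; lra.
  + have e3 : 0 < e / 3 by lra.
    have [d d0 dP] := pvar_reg p0 V1X e3; have [d' d'0 d'P] := pvar_reg p2 V2X e3.
    exists (Num.min (e / 3) (Num.min d d')); first by rewrite !lt_min e3 d0.
    move=> s t s0 st tT; rewrite !lt_min => /and3P[h1 h2 h3].
    have := dP s t s0 st tT h2; have := d'P s t s0 st tT h3; rewrite /w; lra.
- move=> s t i s0 st tT; apply: le_trans (mx_coord_le _ _ _) _.
  rewrite -[leLHS](pth_rootK p0) //; apply: pth_root_le; rewrite ?powR_ge0 //.
  have := pvar_ge p0 V1X s0 st tT; have := P2 s t s0 (ltW st) tT; rewrite /w; lra.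
- move=> s t i j s0 st tT; apply: le_trans (mx_coord_le _ _ _) _.
  rewrite -[leLHS](pth_root_half p0) // lerXn2r ?nnegrE ?pth_root_ge0 //.
  apply: pth_root_le; rewrite ?powR_ge0 //.
  have := pvar_ge p2 V2X s0 st tT; have := P1 s t s0 (ltW st) tT; rewrite /w; lra.
Qed.

End driver_clock.

Section local_remainder.
Context {R : realType} (p T : R) (p_gt0 : 0 < p) (p_lt3 : p < 3).
Context (w : R -> R -> R) (cw : clock T w).

(** On an interval of finite (p/3)-variation the sums of |g| vanish with
    the mesh since p / 3 < 1. The intervals of the covering are cut further into
    pieces on which the variation is at most 1, still countably many. *)
Lemma V2loc_sums (g : R -> R -> R) : V2loc (p / 3) `[0, T] g ->
  exists J : nat -> set R, `[0, T]%classic `<=` \bigcup_k J k /\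
    forall k s t e, J k s -> J k t -> 0 <= s -> t <= T -> 0 < e ->
      exists2 d : R, 0 < d & forall l, part s t l -> mesh w d s l ->
        psum (fun u v => `|g u v|) s l <= e.
Proof.
move=> [I_ [itvI covI VI]]; have q0 : 0 < p / 3 by rewrite divr_gt0.
have reg k := regular_powsum q0 (proj2 (VI k)).
have ex k : exists d : R, 0 < d /\ forall s t l, I_ k s -> I_ k t -> t - s < d ->
    part s t l -> powsum (p / 3) g s l < 1.
  by have [d d0 dP] := reg k 1 ltr01; exists d.
have [del delP] := choice ex.
(* n codes the interval I_ k and its piece [j * del k, (j + 1) * del k[. *)
pose J n := [set r | exists k j : nat, [/\ unpickle n = Some (k, j), I_ k r &
  j%:R * del k <= r < j.+1%:R * del k]].
exists J; split.
  move=> r rT; move: (rT); rewrite -covI => -[k _ Ik].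
  have [dk _] := delP k.
  exists (pickle (k, Num.truncn (r / del k))) => //.
  exists k, (Num.truncn (r / del k)); split=> //; first by rewrite pickleK.
  have := rT; rewrite /= in_itv /= => /andP[r0 _].
  rewrite -ler_pdivlMr // -ltr_pdivrMr //; apply: truncn_itv.
  by rewrite divr_ge0 // ltW.
move=> n s t e [k [j [nkj Is /andP[s1 s2]]]] [k' [j' [nkj' It /andP[t1 t2]]]] s0 tT e0.
move: nkj'; rewrite nkj => -[kk jj]; rewrite -kk -jj in It t1 t2.
have [dk dkP] := delP k.
have std : t - s < del k by move: t2; rewrite -natr1 mulrDl mul1r; lra.
have [d1 d1_gt0 d1P] := pth_root3_small p_gt0 p_lt3 e0.
have [d2 d2_gt0 d2P] := reg k d1 d1_gt0.
exists (d2 / 2); first by lra.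
move=> l pl ml.
apply: (@le_trans _ _ (e * powsum (p / 3) g s l)); last first.
  have h1 := dkP s t l Is It std pl.
  by rewrite ler_piMr ?(ltW e0) ?(ltW h1).
apply: (psum_mesh_le s0 tT _ pl ml) => u v su uv vt wuv.
have u0 := le_trans s0 su; have vT := le_trans vt tT.
have Iu : I_ k u by apply: (itvI k _ _ Is It); rewrite su (le_trans (ltW uv)).
have Iv : I_ k v by apply: (itvI k _ _ Is It); rewrite vt (le_trans su (ltW uv)).
have gd : `|g u v| `^ (p / 3) < d1.
  have := d2P u v [:: v] Iu Iv _ (part1 uv); rewrite /powsum /= addr0; apply.
  have := clock_len cw u0 (ltW uv) vT; lra.
by rewrite -[leLHS](pth_root_third p_gt0) // d1P ?powR_ge0 // ltW.
Qed.

End local_remainder.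

Section main.
Context {R : realType} {T a p : R} {N : nat} {f : R -> 'rV[R]_N}.
Context {X1 : R -> R -> 'rV[R]_N} {X2 : R -> R -> 'M[R]_N}.
Context (T_gt0 : 0 < T) (a_gt0 : 0 < a) (p_ge2 : 2 <= p) (p_lt3 : p < 3).
Context {w : R -> R -> R} (cw : clock T w).
Context {phi : R -> R -> R -> R} {K B d c L M : R}.
Context (rf : rough_flow (T := T) (w := w) p (rde_germ f X1 X2) phi K B d c L M).
Implicit Types (s t u v e : R) (y m : R -> R).
Local Notation reflected := (reflected (phi := phi) a).
Local Notation defect := (defect (phi := phi)).

Let p_gt0 : 0 < p. Proof. by have := p_ge2; lra. Qed.

Lemma itvP0 t : t \in `[0, T] -> 0 <= t /\ t <= T.
Proof. by rewrite in_itv /= => /andP[]. Qed.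

Lemma remainder_eq y m s t (r : R) : s < t ->
  delta1 y s t = \sum_i coef f i (y s) * X1 s t ord0 i
            + \sum_i \sum_j coef2 f i j (y s) * X2 s t j i
            + delta1 m s t + r ->
  defect y s t - (m t - m s) = (rde_germ f X1 X2 s t (y s) - phi s t (y s)) + r.
Proof. by rewrite /rde_germ /defect /delta1 => -> h; lra. Qed.

Lemma solution_sewn y m : solution p T a f X1 X2 y m ->
  exists J : nat -> set R, `[0, T]%classic `<=` \bigcup_k J k /\
    forall k, sewn_locally (T := T) (w := w) (phi := phi) y m (J k).
Proof.
move=> [_ _ [g Vg yE] _ _].
have [[K0 B0 d0] [c0 L1 M0]] := rf_cst rf.
have [J [cov JP]] := V2loc_sums p_gt0 p_lt3 cw Vg.
exists J; split=> // k s t e Js Jt s0 st tT e0.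
have e2 : 0 < e / 2 by lra.
have [d1 d1_gt0 d1P] := JP k s t _ Js Jt s0 tT e2.
have [d2 d2_gt0 d2P] := psum_root3_small p_gt0 p_lt3 cw K0 e2.
have dd : 0 < Num.min (Num.min d1 d2) (Num.min e d).
  by rewrite !lt_min d1_gt0 d2_gt0 e0 d0.
have [l pl ml] := exists_mesh cw s0 (ltW st) tT dd.
exists l; split=> //; first by apply: (mesh_le _ ml); rewrite !ge_min lexx /= ?orbT.
apply: (@le_trans _ _ (1 * psum (fun u v => K * pth_root p (w u v) ^+ 3 + `|g u v|) s l)).
  have mld : mesh w d s l by apply: (mesh_le _ ml); rewrite !ge_min lexx /= ?orbT.
  apply: (psum_mesh_le s0 tT _ pl mld) => u v su uv vt wuv.
  have u0 := le_trans s0 su; have vT := le_trans vt tT.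
  rewrite mul1r (remainder_eq uv (yE u v u0 (ltW uv) vT)).
  apply: le_trans (ler_normD _ _) _; rewrite lerD2r distrC.
  exact: (rf_germ rf).
rewrite mul1r psumD.
have h1 : psum (fun u v => K * pth_root p (w u v) ^+ 3) s l <= e / 2.
  have ml2 : mesh w d2 s l by apply: (mesh_le _ ml); rewrite !ge_min lexx /= ?orbT.
  exact: (d2P s t l s0 tT pl ml2).
have h2 : psum (fun u v => `|g u v|) s l <= e / 2.
  by apply: d1P => //; apply: (mesh_le _ ml); rewrite !ge_min lexx /= ?orbT.
lra.
Qed.

(** If y > 0 on ]s, t], the indicator of its zeros has the same restriction
    to [0, s] and to [0, t], so the integrals agree whatever the measure. *)
Lemma solution_flat y m : solution p T a f X1 X2 y m ->
  m 0 = 0 /\ forall s t, 0 <= s -> s <= t -> t <= T ->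
    (forall r, s < r -> r <= t -> 0 < y r) -> m s = m t.
Proof.
move=> [_ _ _ y0 [mu _ muE]]; have T0 := ltW T_gt0.
split.
  apply: EFin_inj; rewrite muE ?in_itv /= ?lexx //.
  apply: integral0_eq => x; rewrite /= in_itv /= => /andP[x0 x1].
  have -> : x = 0 by apply/eqP; rewrite eq_le x0 x1.
  by rewrite indicE memNset //= y0; apply/eqP; rewrite gt_eqF.
move=> s t s0 st tT pos; have t0 := le_trans s0 st; have sT := le_trans st tT.
apply: EFin_inj; rewrite !muE ?in_itv /= ?s0 ?t0 ?sT ?tT //.
rewrite integral_mkcond [RHS]integral_mkcond; congr integral.
apply/funext => x; rewrite /patch.
have [xs|sx] := leP x s.
  have -> // : (x \in `[0, s]%classic) = (x \in `[0, t]%classic).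
  by apply/idP/idP; rewrite !inE /= !in_itv /= => /andP[-> h]; rewrite ?xs ?(le_trans xs st).
have -> : (x \in `[0, s]%classic) = false.
  by apply/negbTE/negP; rewrite inE /= in_itv /= => /andP[_]; rewrite leNgt sx.
case: ifP => //; rewrite inE /= in_itv /= => /andP[_ xt].
by rewrite indicE memNset //=; apply/eqP; rewrite gt_eqF // pos.
Qed.

Lemma solution_unique y m m2 :
  ucont T m2 -> m2 0 = 0 ->
  (forall e, 0 < e -> exists2 d1 : R, 0 < d1 & forall s t l, 0 <= s -> t <= T ->
    part s t l -> mesh w d1 s l ->
    psum (fun u v => `|defect reflected u v - (m2 v - m2 u)|) s l <= e) ->
  solution p T a f X1 X2 y m ->
  {in `[0, T], y =1 reflected} /\ {in `[0, T], m =1 m2}.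
Proof.
move=> um2 m20 sew2 sol.
have [J [cov loc]] := solution_sewn sol.
have [m0 flat] := solution_flat sol.
case: sol => -[Vy y_ge0] [Vm _ mmono] _ y0 _.
have uy := V1_ucont p_gt0 Vy; have um := V1_ucont ltr01 Vm.
have mm u v : 0 <= u -> u <= v -> v <= T -> m u <= m v.
  move=> u0 uv vT; apply: mmono => //; rewrite in_itv /= ?u0 ?vT.
    exact: le_trans vT.
  by rewrite andbT; apply: le_trans uv.
have yr t : 0 <= t -> t <= T -> y t = reflected t.
  move=> t0 tT; apply: (unique_path cw p_gt0 rf (ltW a_gt0) uy um mm cov loc) => // r r0 rT.
  by apply: y_ge0; rewrite in_itv /= r0.
split=> t /itvP0[t0 tT]; first exact: yr.
have sew2' e : 0 < e -> exists2 d1 : R, 0 < d1 & forall s t l, 0 <= s -> t <= T ->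
    part s t l -> mesh w d1 s l ->
    psum (fun u v => `|defect y u v - (m2 v - m2 u)|) s l <= e.
  move=> /sew2[d1 d1_gt0 d1P]; exists d1 => // s t' l s0 t'T pl ml.
  apply: le_trans (d1P s t' l s0 t'T pl ml).
  apply: le_psum pl => u v su uv vt; have u0 := le_trans s0 su.
  have vT := le_trans vt t'T; have v0 := le_trans u0 (ltW uv).
  by rewrite /defect !yr // (le_trans (ltW uv)).
have := unique_push um cov loc um2 sew2' t0 tT.
by rewrite m0 m20 !subr0.
Qed.


Lemma reflected_push : exists m : R -> R, [/\ m 0 = 0,
  forall s t, 0 <= s -> s <= t -> t <= T ->
      c * (m t - m s) <= defect reflected s t <= L * (m t - m s)
    & forall s t, 0 <= s -> s < t -> t <= T -> w s t <= d ->
      `|(m t - m s) - defect reflected s t| <=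
      B * pth_root p (w s t) * c^-1 * defect reflected s t].
Proof.
have [[K0 B0 d0] [c0 L1 M0]] := rf_cst rf.
apply: (defect_sewing cw p_gt0 rf (b := a + M + M)); last exact: ltW.
move=> s t s0 st tT; have a0 := ltW a_gt0.
have sT := le_trans st tT; have t0 := le_trans s0 st.
rewrite (reflected_flow rf a0) //= /defect.
have := reflected_le rf a0 t0 tT; have := reflected_ge0 rf a0 s0 sT.
have := rf_disp rf (reflected s) s0 st tT; rewrite ler_norml => /andP[? ?]; lra.
Qed.

Section witness.
Context (m : R -> R) (m0 : m 0 = 0).
Context (mA : forall s t, 0 <= s -> s <= t -> t <= T ->
      c * (m t - m s) <= defect reflected s t <= L * (m t - m s)).
Context (mS : forall s t, 0 <= s -> s < t -> t <= T -> w s t <= d ->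
      `|(m t - m s) - defect reflected s t| <=
      B * pth_root p (w s t) * c^-1 * defect reflected s t).

Lemma push_mono s t : 0 <= s -> s <= t -> t <= T -> m s <= m t.
Proof.
have [[K0 B0 d0] [c0 L1 M0]] := rf_cst rf.
move=> s0 st tT; have /andP[_ h] := mA s0 st tT.
have := reflected_flow rf (ltW a_gt0) s0 st tT => h2.
have L0 : 0 < L by lra.
by rewrite -subr_ge0 -(pmulr_rge0 _ L0); apply: le_trans h.
Qed.

Lemma push_ucont : ucont T m.
Proof.
have [[K0 B0 d0] [c0 L1 M0]] := rf_cst rf.
move=> e e0; have B1 : 0 < 2 * B + 1 by lra.
have ce : 0 < c * e by rewrite mulr_gt0.
have [d1 d1_gt0 d1P] := pth_root_small p_gt0 (divr_gt0 ce B1).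
have dd : 0 < Num.min d1 d by rewrite lt_min d1_gt0 d0.
have [d2 d2_gt0 d2P] := clock_reg cw dd; exists d2 => // s t s0 st tT std.
have := d2P s t s0 st tT std; rewrite lt_min => /andP[/ltW w1 /ltW w2].
have /andP[h _] := mA s0 st tT.
rewrite ger0_norm ?subr_ge0 ?push_mono // -(ler_pM2l c0).
apply: (le_trans h); apply: le_trans (reflected_defect_le cw p_gt0 rf (ltW a_gt0) s0 st tT w2) _.
have := d1P _ (clock_ge0 cw s0 st tT) w1; rewrite ler_pdivlMr //.
have := pth_root_ge0 p (w s t); lra.
Qed.

Lemma push_sewn e : 0 < e -> exists2 d1 : R, 0 < d1 & forall s t l, 0 <= s -> t <= T ->
    part s t l -> mesh w d1 s l ->
    psum (fun u v => `|defect reflected u v - (m v - m u)|) s l <= e.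
Proof.
have [[K0 B0 d0] [c0 L1 M0]] := rf_cst rf.
have L0 : 0 < L by lra.
move=> e0; have T0 := ltW T_gt0.
have mT0 : 0 <= m T by rewrite -m0; apply: push_mono.
have ci : 0 <= c^-1 by rewrite invr_ge0 ltW.
have D0 : 0 <= B * c^-1 * L * m T by rewrite !mulr_ge0 // ltW.
have D1 : 0 < B * c^-1 * L * m T + 1 by lra.
have [k [kE k0]] : exists k : R, k = e / (B * c^-1 * L * m T + 1) /\ 0 < k.
  by eexists; split; [reflexivity | rewrite divr_gt0].
have [d1 d1_gt0 d1P] := pth_root_small p_gt0 k0.
exists (Num.min d1 d); first by rewrite lt_min d1_gt0 d0.
move=> s t l s0 tT pl ml.
apply: (@le_trans _ _ (B * k * c^-1 * L * psum (delta1 m) s l)).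
  apply: (psum_mesh_le s0 tT _ pl ml) => u v su uv vt.
  rewrite le_min => /andP[w1 w2].
  have u0 := le_trans s0 su; have vT := le_trans vt tT.
  rewrite distrC; apply: le_trans (mS u0 uv vT w2) _.
  have /andP[_ h] := mA u0 (ltW uv) vT.
  rewrite -[leRHS]mulrA; apply: ler_pM => //.
  - by rewrite !mulr_ge0 ?pth_root_ge0.
  - exact: (reflected_flow rf (ltW a_gt0) u0 (ltW uv) vT).
  - rewrite ler_wpM2r // ler_wpM2l // d1P // (clock_ge0 cw) //; exact: ltW.
rewrite (psum_delta1 m pl).
have mst : m t - m s <= m T.
  have := push_mono (le_trans s0 (part_le pl)) tT (lexx T).
  have := push_mono (lexx 0) s0 (le_trans (part_le pl) tT); rewrite m0; lra.
apply: (@le_trans _ _ (B * k * c^-1 * L * m T)).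
  by apply: ler_wpM2l mst; rewrite !mulr_ge0 // ltW.
have -> : B * k * c^-1 * L * m T = k * (B * c^-1 * L * m T) by ring.
have : k * (B * c^-1 * L * m T + 1) = e by rewrite kE divfK // gt_eqF.
lra.
Qed.

(** Paths are extended from [0, T] to the line by their values at the
    endpoints, which makes them continuous everywhere; the remainder is what
    the equation leaves. *)
Definition reflected_remainder s t : R :=
  delta1 (reflected \o clamp T) s t
    - \sum_i coef f i ((reflected \o clamp T) s) * X1 s t ord0 i
    - \sum_i \sum_j coef2 f i j ((reflected \o clamp T) s) * X2 s t j i
    - delta1 (m \o clamp T) s t.

Let push_clock : clock T (fun s t => w s t + (m t - m s)).
Proof. exact: (clock_push cw push_ucont push_mono). Qed.

(** The sewing error is of order nu * dm, and dm <= C * (w + dm)^(2/p)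
    because p >= 2 and w + dm is bounded. *)
Lemma remainder_bound : exists2 Q : R, 0 <= Q & forall s t, 0 <= s -> s < t -> t <= T ->
  w s t <= d -> `|reflected_remainder s t| <= Q * pth_root p (w s t + (m t - m s)) ^+ 3.
Proof.
have [[K0 B0 d0] [c0 L1 M0]] := rf_cst rf; have L0 : 0 < L by lra.
have T0 := ltW T_gt0.
pose W s t := w s t + (m t - m s).
have ci : 0 <= c^-1 by rewrite invr_ge0 ltW.
have W0 : 0 <= W 0 T by exact: (clock_ge0 push_clock).
pose b := pth_root p (W 0 T) `^ (p - 2).
have b0 : 0 <= b by exact: powR_ge0.
exists (K + B * c^-1 * L * b); first by rewrite addr_ge0 // !mulr_ge0 // ltW.
move=> s t s0 st tT wd; have t0 := le_trans s0 (ltW st); have sT := le_trans (ltW st) tT.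
rewrite -/(W s t).
have Wst : 0 <= W s t by apply: (clock_ge0 push_clock) => //; exact: ltW.
have r0 := pth_root_ge0 p (W s t).
have wW : pth_root p (w s t) <= pth_root p (W s t).
  apply: pth_root_le => //; first by apply: (clock_ge0 cw) => //; exact: ltW.
  by rewrite /W lerDl subr_ge0 push_mono // ltW.
have dm0 : 0 <= m t - m s by rewrite subr_ge0 push_mono // ltW.
have dmb : m t - m s <= pth_root p (W s t) ^+ 2 * b.
  apply: (@le_trans _ _ (W s t)); first by rewrite /W lerDr (clock_ge0 cw) // ltW.
  rewrite -[leLHS](pth_root_powK p_gt0) //.
  have -> : pth_root p (W s t) `^ p = pth_root p (W s t) ^+ 2 * pth_root p (W s t) `^ (p - 2).
    move: r0; rewrite le_eqVlt => /orP[/eqP <-|r0].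
      by rewrite powR0 ?gt_eqF // expr0n mul0r.
    rewrite -powR_mulrn ?(ltW r0) // -powRD; last by rewrite (gt_eqF r0) implybT.
    by congr (_ `^ _); ring.
  apply: ler_wpM2l; first exact: exprn_ge0.
  apply: ge0_ler_powR; rewrite ?nnegrE ?pth_root_ge0 ?subr_ge0 //.
  by apply: pth_root_le => //; apply: (clock_mono push_clock) => //; exact: ltW.
have -> : reflected_remainder s t =
    (phi s t (reflected s) - rde_germ f X1 X2 s t (reflected s))
    - ((m t - m s) - defect reflected s t).
  rewrite /reflected_remainder /delta1 /= !clamp_id ?s0 ?t0 ?sT ?tT //.
  by rewrite /rde_germ st /defect; ring.
apply: le_trans (ler_normB _ _) _; rewrite mulrDl; apply: lerD.
  apply: le_trans (rf_germ rf (reflected s) s0 st tT wd) _.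
  by rewrite ler_wpM2l // lerXn2r ?nnegrE ?pth_root_ge0.
apply: le_trans (mS s0 st tT wd) _.
have /andP[_ h] := mA s0 (ltW st) tT.
have h2 : defect reflected s t <= L * (pth_root p (W s t) ^+ 2 * b).
  by apply: le_trans h _; rewrite ler_wpM2l // ltW.
have -> : B * c^-1 * L * b * pth_root p (W s t) ^+ 3 =
  (B * pth_root p (W s t) * c^-1) * (L * (pth_root p (W s t) ^+ 2 * b)) by ring.
apply: ler_pM => //.
- by rewrite !mulr_ge0 ?pth_root_ge0.
- exact: (reflected_flow rf (ltW a_gt0) s0 (ltW st) tT).
- by rewrite ler_wpM2r // ler_wpM2l.
Qed.

(** On short intervals increments are of order w^(1/p); on the others w is
    bounded below and the path is bounded. *)
Lemma reflected_V1 : V1 p `[0, T] (reflected \o clamp T).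
Proof.
have [[K0 B0 d0] [c0 L1 M0]] := rf_cst rf; have a0 := ltW a_gt0.
have B3 : 0 <= 3 * B by rewrite mulr_ge0.
have h1 : 0 <= (3 * B) `^ p by exact: powR_ge0.
have h2 : 0 <= (a + M) `^ p / d by rewrite divr_ge0 ?powR_ge0 // ltW.
have C1 : 1 <= 1 + (3 * B) `^ p + (a + M) `^ p / d by lra.
apply: (V2_of_clock (clock_scale C1 cw) p_gt0 (lexx 0) (ltW T_gt0) (lexx T)).
move=> s t s0 st tT; have t0 := le_trans s0 (ltW st); have sT := le_trans (ltW st) tT.
rewrite /delta1 /= !clamp_id ?s0 ?t0 ?sT ?tT //.
have w0 : 0 <= w s t by apply: (clock_ge0 cw) => //; exact: ltW.
have hw1 : 0 <= (3 * B) `^ p * w s t by rewrite mulr_ge0.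
have hw2 : 0 <= (a + M) `^ p / d * w s t by rewrite mulr_ge0.
rewrite mulrDl mulrDl mul1r.
have [wd|dw] := leP (w s t) d.
  have : `|reflected t - reflected s| `^ p <= (3 * B) `^ p * w s t.
    rewrite -[w s t in leRHS](pth_root_powK p_gt0) // -powRM ?pth_root_ge0 //.
    apply: ge0_ler_powR; rewrite ?nnegrE ?mulr_ge0 ?pth_root_ge0 ?(ltW p_gt0) //.
    rewrite -mulrA; exact: (reflected_dist cw p_gt0 rf a0 s0 (ltW st) tT wd).
  by move=> h; apply: (le_trans h); rewrite -addrA addrCA lerDl addr_ge0.
have : `|reflected t - reflected s| `^ p <= (a + M) `^ p / d * w s t.
  apply: (@le_trans _ _ ((a + M) `^ p)).
    apply: ge0_ler_powR; rewrite ?nnegrE ?addr_ge0 ?(ltW p_gt0) //.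
    have := reflected_ge0 rf a0 s0 sT; have := reflected_ge0 rf a0 t0 tT.
    have := reflected_le rf a0 s0 sT; have := reflected_le rf a0 t0 tT.
    by rewrite ler_norml => ? ? ? ?; apply/andP; split; lra.
  by rewrite mulrAC ler_pdivlMr // ler_wpM2l ?powR_ge0 // ltW.
by move=> h; apply: (le_trans h); rewrite lerDr addr_ge0.
Qed.

Lemma push_V1 : V1 1 `[0, T] (m \o clamp T).
Proof.
apply: (V2_of_clock push_clock ltr01 (lexx 0) (ltW T_gt0) (lexx T)).
move=> s t s0 st tT; have t0 := le_trans s0 (ltW st); have sT := le_trans (ltW st) tT.
rewrite powRr1 // /delta1 /= !clamp_id ?s0 ?t0 ?sT ?tT //.
rewrite ger0_norm ?subr_ge0 ?push_mono // ?lerDr ?(clock_ge0 cw) //; exact: ltW.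
Qed.

Lemma remainder_V2loc : V2loc (p / 3) `[0, T] reflected_remainder.
Proof.
have [[K0 B0 d0] [c0 L1 M0]] := rf_cst rf; have T0 := ltW T_gt0.
have [Q Q0 QP] := remainder_bound.
have [d1 d1_gt0 d1P] := clock_reg cw d0.
(* The cells have length at most eta < d1, so that w <= d on each of them. *)
pose eta := d1 / 2; have eta0 : 0 < eta by rewrite divr_gt0.
pose al k := Num.min (k%:R * eta) T.
have al0 k : 0 <= al k by rewrite le_min T0 mulr_ge0 // ltW.
have alT k : al k <= T by rewrite ge_min lexx orbT.
have alS k : al k <= al k.+1.
  by rewrite le_min !ge_min lexx orbT andbT ler_wpM2r ?(ltW eta0) // ler_nat leqnSn.
exists (fun k => `[al k, al k.+1]%classic); split=> [k||k].
- exact: interval_is_interval.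
- apply/seteqP; split=> x /=.
    move=> [k _ /=]; rewrite !in_itv /= => /andP[h1 h2].
    by rewrite (le_trans (al0 k)) // (le_trans h2).
  rewrite in_itv /= => /andP[x0 xT]; exists (Num.truncn (x / eta)) => //=.
  have /andP[h1 h2] : (Num.truncn (x / eta))%:R <= x / eta < (Num.truncn (x / eta)).+1%:R.
    by apply: truncn_itv; rewrite divr_ge0 // ltW.
  rewrite in_itv /=; apply/andP; split.
    by rewrite ge_min -ler_pdivlMr // h1.
  by rewrite le_min xT andbT -ler_pdivrMr // ltW.
- have C1 : 1 <= 1 + Q `^ (p / 3) by rewrite lerDl powR_ge0.
  apply: (V2_of_clock (clock_scale C1 push_clock) _ (al0 k) (alS k) (alT _)).
    by rewrite divr_gt0.
  move=> s t als st tal.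
  have s0 := le_trans (al0 k) als; have tT := le_trans tal (alT _).
  have W0 : 0 <= w s t + (m t - m s) by apply: (clock_ge0 push_clock) => //; exact: ltW.
  have wd : w s t <= d.
    apply/ltW/d1P => //; first exact: ltW.
    have : al k.+1 - al k <= eta.
      rewrite /al -natr1 mulrDl mul1r /Num.min.
      by case: ifPn => ?; case: ifPn; rewrite -?leNgt => ?; lra.
    by rewrite /eta; lra.
  apply: (@le_trans _ _ (Q `^ (p / 3) * (w s t + (m t - m s)))).
    apply: (@le_trans _ _ ((Q * pth_root p (w s t + (m t - m s)) ^+ 3) `^ (p / 3))).
      apply: ge0_ler_powR; rewrite ?nnegrE ?mulr_ge0 ?exprn_ge0 ?pth_root_ge0 ?divr_ge0 ?(ltW p_gt0) //.
      exact: QP.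
    rewrite powRM ?exprn_ge0 ?pth_root_ge0 // ler_wpM2l ?powR_ge0 //.
    rewrite -powR_mulrn ?pth_root_ge0 // -powRrM (_ : 3 * (p / 3) = p) ?(pth_root_powK p_gt0) //.
    by field.
  by rewrite mulrDl mul1r lerDr.
Qed.

Lemma push_flat u v : u <= v ->
  (forall x, u <= x <= v -> (reflected \o clamp T) x != 0) ->
  (m \o clamp T) u = (m \o clamp T) v.
Proof.
have [[K0 B0 d0] [c0 L1 M0]] := rf_cst rf; have a0 := ltW a_gt0.
move=> uv pos /=; have cuv := clamp_le T_gt0 uv.
have /andP[cu0 cuT] := clamp_itv T_gt0 u; have /andP[cv0 cvT] := clamp_itv T_gt0 v.
move: cuv; rewrite le_eqVlt => /orP[/eqP -> //|cuv].
have D0 : defect reflected (clamp T u) (clamp T v) = 0.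
  apply: (reflected_defect0 cw p_gt0 rf T_gt0 a0 cu0 (ltW cuv) cvT) => r /andP[ur rv].
  have rT : 0 <= r <= T by rewrite (le_trans cu0 ur) (le_trans rv cvT).
  have /andP[r0 rT'] := rT.
  rewrite lt_neqAle (reflected_ge0 rf a0 r0 rT') andbT eq_sym.
  have := pos r; rewrite /= clamp_id //; apply.
  case: (clampP T_gt0 u) (clampP T_gt0 v) => -[h e]; rewrite e in cuv ur;
    case=> -[h' e']; rewrite e' in cuv rv; lra.
have /andP[h _] := mA cu0 (ltW cuv) cvT; rewrite D0 in h.
have mm := push_mono cu0 (ltW cuv) cvT.
apply/eqP; rewrite eq_le mm /=.
by rewrite -subr_le0 -(pmulr_rle0 _ c0).
Qed.

Theorem reflected_solution :
  solution p T a f X1 X2 (reflected \o clamp T) (m \o clamp T).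
Proof.
have a0 := ltW a_gt0; have T0 := ltW T_gt0.
have Ghomo : {homo (m \o clamp T) : u v / u <= v}.
  move=> u v uv /=; have /andP[cu0 cuT] := clamp_itv T_gt0 u.
  by have /andP[cv0 cvT] := clamp_itv T_gt0 v; apply: push_mono => //; apply: clamp_le.
have G0 : (m \o clamp T) 0 = 0 by rewrite /= clamp_id ?m0 // lexx.
split.
- split; first exact: reflected_V1.
  move=> t /itvP0[t0 tT]; rewrite /= clamp_id ?t0 //.
  exact: (reflected_ge0 rf).
- split; first exact: push_V1.
    by move=> t /itvP0[t0 tT]; rewrite -G0; apply: Ghomo.
  by move=> u v _ _; exact: Ghomo.
- exists reflected_remainder; first exact: remainder_V2loc.
  by move=> s t _ _ _; rewrite /reflected_remainder; ring.
- by rewrite /= clamp_id ?lexx //; exact: (reflected0 rf).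
- have Gneg u v : u <= v -> v <= 0 -> (m \o clamp T) u = (m \o clamp T) v.
    move=> uv v0 /=; congr m.
    by case: (clampP T_gt0 u) (clampP T_gt0 v) => -[h e] [] [h' e']; lra.
  have [mu [mu1 mu2]] := stieltjes_carried_by_zeros Ghomo (ucont_clamp T_gt0 push_ucont)
    (ucont_clamp T_gt0 (reflected_ucont cw p_gt0 rf a0)) Gneg G0 push_flat.
  by exists mu => t /itvP0[t0 tT]; [exact: mu1 | exact: mu2].
Qed.

End witness.

End main.

Theorem theorem4 (R : realType) (T a p : R) (N : nat)
    (f : R -> 'rV[R]_N)
    (X1 : R -> R -> 'rV[R]_N) (X2 : R -> R -> 'M[R]_N)
    (hT : 0 < T) (ha : 0 < a) (hN : (1 <= N)%N) (hp : 2 <= p < 3)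
    (hf : Cb 3 f) (hX : geometric_rough_path p T X1 X2) :
  exists y m : R -> R,
    solution p T a f X1 X2 y m /\
    forall y' m' : R -> R, solution p T a f X1 X2 y' m' ->
      {in `[0, T], y' =1 y} /\ {in `[0, T], m' =1 m}.
Proof.
have /andP[p2 p3] := hp; have p0 : 0 < p by lra.
have [rX _] := hX; have [_ _ chen] := rX.
have [w [cw bX1 bX2]] := rough_path_clock p0 rX.
have [C [d1 [C0 d1_gt0 af]]] := rde_germ_almost_flow p0 cw hf bX1 bX2 chen.
have [phi [K [B [d [c [L [M rf]]]]]]] := almost_flow_sewing cw p0 p3 C0 d1_gt0 af.
have [m [m0 mA mS]] := reflected_push hT ha p2 cw rf.
have sol := reflected_solution hT ha p2 cw rf m0 mA mS.
exists (reflected (phi := phi) a \o clamp T), (m \o clamp T); split=> // y' m' sol'.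
have [ey em] := solution_unique hT ha p2 p3 cw rf (push_ucont ha p2 cw rf mA) m0
  (push_sewn hT ha p2 cw rf m0 mA mS) sol'.
by split=> t /[dup] tT /itvP0[t0 tT']; rewrite /= clamp_id ?t0 //; [exact: ey | exact: em].
Qed.
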